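(* Let $m_{13},m_{22}$ be non-negative integers, let $R=(m_{22})^{m_{13}}$ be the rectangular partition with $m_{13}$ rows and $m_{22}$ columns, and for partitions $\lambda,\mu,\nu$ define $d^R_{\lambda,\mu,\nu}$ by $\Delta^2(\mathcal{G}_R)=\sum_{\lambda,\mu,\nu}d^R_{\lambda,\mu,\nu}\,\mathcal{G}_\lambda\otimes\mathcal{G}_\mu\otimes\mathcal{G}_\nu$. Then $d^R_{\lambda,\mu,\nu}$ is zero unless $\lambda$, $\mu$, and $\nu$ are contained in $R$, in which case it is equal to $(-1)^{|\lambda|+|\mu|+|\nu|-m_{22}m_{13}}$ times the number of triples $(\sigma,\tau,T)$, where $\sigma$ and $\tau$ are partitions such that $\sigma\subset\tau\subset R$, and $T$ is a set-valued tableau of skew shape $\tau/\sigma$, satisfying the following conditions. (i) The Young diagram $\sigma$ is contained in $\lambda$, and $\lambda/\sigma$ is a rook-strip. (ii) If $\tau$ is placed in the upper-left corner of $R$ and the 180 degree rotation of $\nu$ is placed in the lower-right corner, then their union is $R$ and their overlap is a rook-strip. (iii) The word $w(T)$ is a reverse lattice word with content $\mu$.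
   Context: Partitions are identified with Young diagrams; $|\lambda|$ is the sum of the parts. A rook-strip is a set of boxes containing at most one box in any row or column. A set-valued tableau of shape $\lambda$ (respectively of skew shape $\tau/\sigma$) is a filling of the boxes of $\lambda$ (respectively of the skew diagram $\tau/\sigma$) with finite non-empty sets of positive integers such that the largest integer in any box is at most the smallest integer in the box to its right and strictly smaller than the smallest integer in the box below it; $x^T$ is the monomial in which the exponent of $x_i$ is the number of boxes containing $i$; $|T|=\deg x^T$. Put $\mathcal{G}_\lambda=\sum_T(-1)^{|T|-|\lambda|}x^T$ over set-valued tableaux of shape $\lambda$. The $\mathcal{G}_\lambda$ are linearly independent and their span $\Gamma=\bigoplus\mathbb{Z}\mathcal{G}_\lambda$ is a commutative ring; $\mathcal{G}_\lambda\mathcal{G}_\mu=\sum_\nu c^\nu_{\lambda\mu}\mathcal{G}_\nu$ defines $c^\nu_{\lambda\mu}$. Define $d^\nu_{\lambda\mu}=c^\rho_{R'\nu}$, where $R'=(q)^p$ is any rectangle ($p$ rows, $q$ columns) containing $\lambda$ and $\mu$ and $\rho=(q+\mu_1,\dots,q+\mu_p,\lambda_1,\lambda_2,\dots)$ (independent of $R'$). These define a coassociative coproduct $\Delta:\Gamma\to\Gamma\otimes\Gamma$, $\Delta(\mathcal{G}_\nu)=\sum_{\lambda,\mu}d^\nu_{\lambda\mu}\mathcal{G}_\lambda\otimes\mathcal{G}_\mu$, and $\Delta^2=(\Delta\otimes\mathrm{id})\Delta:\Gamma\to\Gamma^{\otimes3}$. The word $w(T)$ is the sequence of integers in the boxes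 of $T$ read one row at a time from left to right, with rows ordered from bottom to top, and integers in the same box arranged in increasing order. A word of positive integers is a reverse lattice word if every occurrence of an integer $i\ge2$ is followed by more occurrences of $i-1$ than of $i$. The content of a word is $(\nu_1,\nu_2,\dots)$ with $\nu_i$ the number of occurrences of $i$.
   Formalization: Condition (i) is strengthened to require also that λ is contained in τ; without it the count is wrong, e.g. for R=λ=ν=(1), μ=∅ two triples are counted while the coefficient is −1. *)

(* Defs.v *)
From HB Require Import structures.
From mathcomp Require Export all_boot all_order all_algebra finmap.
From mathcomp Require Export monalg.
From mathcomp Require Export boolp classical_sets functions cardinality fsbigop.

Set Implicit Arguments.
Unset Strict Implicit.
Unset Printing Implicit Defensive.

Import GRing.Theory.
Local Open Scope fset_scope.
Local Open Scope ring_scope.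

(** * Partitions and Young diagrams *)

Definition is_part (s : seq nat) : bool := sorted geq s && (0%N \notin s).

Record part := Part { pseq :> seq nat; _ : is_part pseq }.

HB.instance Definition _ := [isSub for pseq].
HB.instance Definition _ := [Choice of part by <:].

Fact mkpart_subproof (s : seq nat) : is_part (sort geq [seq x <- s | x != 0%N]).
Proof.
rewrite /is_part sort_sorted /=; last by move=> x y; apply: leq_total.
by rewrite mem_sort mem_filter.
Qed.

(* The partition with the same nonzero parts as [s]; for a weakly decreasing
   [s] this only discards trailing zeros. *)
Definition mkpart (s : seq nat) : part := Part (mkpart_subproof s).

(* lambda_(i+1), equal to 0 beyond the last part *)
Definition prow (l : part) (i : nat) : nat := nth 0%N l i.

Definition psize (l : part) : nat := sumn l.

(* (q)^p : p rows, q columns *)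
Definition rect (p q : nat) : part := mkpart (nseq p q).

(* Boxes are pairs (row, column), both counted from 0, rows from top to
   bottom. *)
Definition box : choiceType := (nat * nat)%type.

Definition diag (l : part) : {fset box} :=
  [fset b in [seq (i, j) | i <- iota 0 (size l), j <- iota 0 (prow l i)]].

Definition pincl (l m : part) : bool := diag l `<=` diag m.

Definition skew (t s : part) : {fset box} := diag t `\` diag s.

(* 180 degree rotation of [diag l] placed in the lower-right corner of the
   rectangle with p rows and q columns; meaningful when [l] fits in it. *)
Definition rot_diag (p q : nat) (l : part) : {fset box} :=
  ((fun b : box => ((p - b.1.+1)%N, (q - b.2.+1)%N) : box) @` diag l)%fset.

Definition rook_strip (D : {fset box}) : Prop :=
  forall b b' : box, b \in D -> b' \in D ->
    b.1 = b'.1 \/ b.2 = b'.2 -> b = b'.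

(** * Set-valued tableaux *)

(* The support of a filling is the set of boxes that carry a nonempty set. *)
Definition filling : choiceType := {fsfun box -> {fset nat} with fset0}.

Definition svt (D : {fset box}) (T : filling) : Prop :=
  [/\ finsupp T = D,
      forall b a, a \in T b -> (0 < a)%N,
      forall i j a b, a \in T (i, j) -> b \in T (i, j.+1) -> (a <= b)%N
    & forall i j a b, a \in T (i, j) -> b \in T (i.+1, j) -> (a < b)%N].

(* x^T; the variable x_i is [ucm i], and x_0 never occurs in tableaux *)
Definition xmon (T : filling) : {cmonom nat} :=
  \big[mmul/mone]_(b <- finsupp T) \big[mmul/mone]_(i <- T b) ucm i.

Definition tdeg (T : filling) : nat := mdeg (xmon T).

(* rows from bottom to top, each row from left to right *)
Definition reading_order : rel box :=
  fun b b' => (b'.1 < b.1)%N || ((b.1 == b'.1) && (b.2 <= b'.2)%N).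

Definition word (T : filling) : seq nat :=
  flatten [seq sort leq (T b) | b <- sort reading_order (finsupp T)].

Definition reverse_lattice (w : seq nat) : Prop :=
  forall k, (k < size w)%N -> (2 <= nth 0%N w k)%N ->
    let i := nth 0%N w k in
    (count_mem i (drop k.+1 w) < count_mem i.-1 (drop k.+1 w))%N.

Definition has_content (w : seq nat) (m : part) : Prop :=
  forall i, count_mem i.+1 w = prow m i.

(** * Stable Grothendieck polynomials *)

(* Power series in countably many variables, as coefficient functions. *)
Definition pseries := {cmonom nat} -> int.

(* Only finitely many pairs of monomials have product [m]. *)
Definition psmul (f g : pseries) : pseries := fun m =>
  \sum_(ab \in [set ab : {cmonom nat} * {cmonom nat} | mmul ab.1 ab.2 = m]%classic)
     f ab.1 * g ab.2.

Definition groth (l : part) : pseries := fun m =>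
  \sum_(T \in [set T : filling | svt (diag l) T /\ xmon T = m]%classic)
     (-1 : int) ^ ((tdeg T)%:Z - (psize l)%:Z).

(* Since the G_lambda are linearly independent, their span is represented by
   the free Z-module on partitions, << l >> standing for G_l; [gamma_series]
   is the inclusion into power series. *)
Definition Gamma := {malg int[part]}.

Definition gamma_series (a : Gamma) : pseries := fun m =>
  \sum_(l <- msupp a) a@_l * groth l m.

(* The expansion of G_l * G_m in the basis (G_n), which exists and is unique;
   0 is the default value of the choice operator and is not reached. *)
Definition groth_mul (l m : part) : Gamma :=
  xget 0 [set a : Gamma | gamma_series a = psmul (groth l) (groth m)]%classic.

(* [cG l m n] is c^n_{l m} *)
Definition cG (l m n : part) : int := (groth_mul l m)@_n.

(** * The coproduct *)

(* (q + mu_1, ..., q + mu_p, lambda_1, lambda_2, ...) *)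
Definition stack (p q : nat) (l m : part) : part :=
  mkpart ([seq (q + prow m i)%N | i <- iota 0 p] ++ l).

(* [dG n l m] is d^n_{l m}.  The rectangle may be any one containing [l] and
   [m], the result being independent of it; the smallest one is used. *)
Definition dG (n l m : part) : int :=
  let p := maxn (size l) (size m) in
  let q := maxn (prow l 0) (prow m 0) in
  cG (rect p q) n (stack p q l m).

(* Free modules: {malg int[K * L]} is the tensor product of {malg int[K]} and
   {malg int[L]}, with << (k, l) >> the tensor of << k >> and << l >>. *)

Definition linext (K L : choiceType) (f : K -> {malg int[L]})
    (a : {malg int[K]}) : {malg int[L]} :=
  \sum_(k <- msupp a) a@_k *: f k.

Definition tensor (K L : choiceType) (a : {malg int[K]}) (b : {malg int[L]}) :
    {malg int[(K * L)%type]} :=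
  \sum_(k <- msupp a) \sum_(l <- msupp b) << a@_k * b@_l *g (k, l) >>.

Definition tensor_map (K L K' L' : choiceType)
    (f : {malg int[K]} -> {malg int[K']}) (g : {malg int[L]} -> {malg int[L']}) :
    {malg int[(K * L)%type]} -> {malg int[(K' * L')%type]} :=
  linext (fun kl => tensor (f << kl.1 >>) (g << kl.2 >>)).

(* For each [n], only finitely many [dG n l m] are nonzero. *)
Definition Delta : Gamma -> {malg int[(part * part)%type]} :=
  linext (fun n =>
    \sum_(lm \in [set: part * part]%classic) << dG n lm.1 lm.2 *g lm >>).

Definition Delta2 (a : Gamma) : {malg int[(part * part * part)%type]} :=
  tensor_map Delta id (Delta a).

(* The conditions on a triple (sigma, tau, T).  The inclusion of lambda in tau
   is imposed separately because it does not follow from the others, and the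
   count is wrong without it: for p = q = 1, l = n = (1) and m empty, both
   sigma = tau = empty and sigma = tau = (1), with T empty, satisfy all the
   other conditions, whereas the coefficient to be computed is -1. *)
Definition triple_cond (p q : nat) (l m n : part)
    (s t : part) (T : filling) : Prop :=
  [/\ pincl s t && pincl t (rect p q),
      svt (skew t s) T,
      [/\ pincl s l, pincl l t & rook_strip (skew l s)],
      diag t `|` rot_diag p q n = diag (rect p q) /\
        rook_strip (diag t `&` rot_diag p q n)
    & reverse_lattice (word T) /\ has_content (word T) m].

Definition triples (p q : nat) (l m n : part) : set (part * part * filling) :=
  [set sT | triple_cond p q l m n sT.1.1 sT.1.2 sT.2]%classic.

(* Main.v *)
Require Import Defs.
From mathcomp Require Import zify ring.
From mathcomp Require fingroup perm mpoly.

(** The coefficient of the iterated coproduct at (lambda, mu, nu) is a sum over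
kappa of products of two coproduct coefficients: d^R_(kappa nu) times
d^kappa_(lambda mu).  Everything rests on one formula for the latter, valid for
all partitions ([dG_formula]): up to the sign given by the sizes,
d^kappa_(lambda mu) counts the pairs (sigma, T) where lambda/sigma is a
rook-strip and T is a set-valued tableau of shape kappa/sigma whose word is a
reverse lattice word of content mu.

The formula comes from computing a product with a rectangle in n variables.  Let
A(alpha) be the alternating sum over S_n of the images of
x^alpha prod_j x_j^(n-j) (1 - x_j)^(j-1), and V = A(0); these are [alternant]
and [vdm] below.  The proof combines symmetry and cancellation.

Symmetry ([tab_poly_sym]).  In each row, the boxes that contain i or i+1 and
have no such vertical neighbour form a string in which first come the boxes
containing i and last those containing i+1, with an overlap of at most one box.
Exchanging the two multiplicities, while keeping the overlap, is an involution
that exchanges the numbers of i and of i+1.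

Cancellation ([lattice_cancellation]).  For a symmetric polynomial written as a
signed sum of x^T over tableaux, V times it is the signed sum of the A(content
of T), and the tableaux that violate the lattice condition cancel.  At the first
violation, by the pair (i, i+1) in some box, take the part of the tableau that
is not yet read: one move exchanges the numbers of i and i+1 there, another
adds or removes one i.  The four contents obtained give four alternants with
total zero, because alternating x_i^s x_(i+1)^(t+1) (1 - x_i), times the factors
common to the four, is antisymmetric in s and t ([alt_swap]).  Only pairs (i, i+1) that
are adjacent as variables are needed, so the argument works separately for
blocks of letters.

Consequences.  A straight tableau with a reverse lattice word is the
superstandard one, whence V G_lambda = A(lambda) ([vdm_groth]).  For a rectangle
with p rows and q columns, V G_((q)^p) G_kappa is an alternating sum to which
the cancellation applies with the variables divided as x_1, ..., x_p and the
others.  As G_kappa is symmetric, the letters of the second group may be taken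
smaller than those of the first.  A tableau of shape kappa that is lattice in
both blocks is superstandard of some shape lambda in the small letters, and a
lattice tableau T of shape kappa/sigma in the large ones, where lambda/sigma, the
set of boxes with letters of both kinds, is a rook-strip ([split_of_data],
[split_of_surj]).  It contributes A(q + mu, lambda), mu being the content of T.
If this sequence is a partition, it is the index of one basis element;
otherwise straightening ([straighten]) gives partitions whose part number p+1
exceeds q, and these do not interfere.  Linear independence of the G_lambda
follows from the lowest-degree coefficients of the A(lambda)
([gamma_series_inj]), so that the expansion found is the only one.

Finally, when kappa is replaced by R and lambda by kappa, the only lattice
tableau on R/sigma has in the k-th box of each column the letter k, and its
content is the complement of sigma ([rot_unique], [rot_cont]).  This turns
d^R_(kappa nu) into a sign times the truth value of condition (ii), and the sum
over kappa into the count of triples. *)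

Set Implicit Arguments.
Unset Strict Implicit.
Unset Printing Implicit Defensive.

Import GRing.Theory.
Local Open Scope ring_scope.

(** * Tableaux as incidence predicates *)

Local Open Scope nat_scope.

(** [f r c a] tells whether the box in row r and column c contains a.  Letters are
counted from 0, one less than in the fillings of the statement. *)
Definition tab := nat -> nat -> nat -> bool.

(** The skew shape is given by its row lengths: row r occupies the columns from
[sg r] to [kp r - 1]. *)
Definition tableau (sg kp : nat -> nat) (f : tab) : Prop :=
  [/\ forall r c a, f r c a -> sg r <= c < kp r,
      forall r c, sg r <= c < kp r -> exists a, f r c a,
      forall r c a b, f r c a -> f r c.+1 b -> a <= b
    & forall r c a b, f r c a -> f r.+1 c b -> a < b].

(** Row lengths of a Young diagram contained in the rectangle with N rows and C
columns. *)
Definition row_shape (N C : nat) (g : nat -> nat) : Prop :=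
  [/\ forall r, g r.+1 <= g r, forall r, N <= r -> g r = 0 & forall r, g r <= C].

Lemma shape_le N C g r r' : row_shape N C g -> r <= r' -> g r' <= g r.
Proof.
move=> [h _ _]; elim: r' => [|r' IH]; first by rewrite leqn0 => /eqP->.
rewrite leq_eqVlt => /predU1P[->//|/IH]; exact: leq_trans.
Qed.

Section TableauOrder.
Variables (N C : nat) (sg kp : nat -> nat) (f : tab).
Hypotheses (Hsg : row_shape N C sg) (Hkp : row_shape N C kp) (Tf : tableau sg kp f).

Lemma tab_row r c c' a b : f r c a -> f r c' b -> c < c' -> a <= b.
Proof.
case: Tf => sup ne row _ fa fb; elim: c' b fb => // c' IH b fb.
rewrite ltnS leq_eqVlt => /predU1P[e|lt]; first by subst; exact: row fa fb.
have [d fd] : exists d, f r c' d.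
  by apply: ne; have := sup _ _ _ fa; have := sup _ _ _ fb; lia.
exact: leq_trans (IH _ fd lt) (row _ _ _ _ fd fb).
Qed.

Lemma tab_col r r' c a b : f r c a -> f r' c b -> r < r' -> a < b.
Proof.
case: Tf => sup ne _ col fa fb; elim: r' b fb => // r' IH b fb.
rewrite ltnS leq_eqVlt => /predU1P[e|lt]; first by subst; exact: col fa fb.
have [d fd] : exists d, f r' c d.
  apply: ne; have := sup _ _ _ fa; have := sup _ _ _ fb.
  have := shape_le Hsg (ltnW lt); have := shape_le Hkp (leqnSn r'); lia.
exact: ltn_trans (IH _ fd lt) (col _ _ _ _ fd fb).
Qed.

(** A skew shape is convex: with two boxes, one weakly north-west of the other, it
contains the rectangle that they span. *)
Lemma tab_between r c r' c' a b r1 c1 : f r c a -> f r' c' b ->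
  r <= r1 <= r' -> c <= c1 <= c' -> exists d, f r1 c1 d.
Proof.
case: Tf => sup ne _ _ fa fb hr hc; apply: ne.
have := sup _ _ _ fa; have := sup _ _ _ fb.
have : sg r1 <= sg r by apply: (shape_le Hsg); lia.
have : kp r' <= kp r1 by apply: (shape_le Hkp); lia.
lia.
Qed.

Lemma tab_bound r c a : f r c a -> (r < N) && (c < C).
Proof.
case: Tf => sup _ _ _ /sup; case: Hkp => _ h0 hC.
by have := hC r; case: (ltnP r N) => [|/h0]; lia.
Qed.
End TableauOrder.

(** * Rearranging two consecutive letters *)

Definition meets_pair (f : tab) a r c := f r c a || f r c a.+1.

(** A box with a that has a+1 below it, or with a+1 that has a above it, cannot
change; the remaining boxes meeting {a, a+1} have no vertical neighbour meeting
{a, a+1}, so that column strictness puts no constraint on a rearrangement. *)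
Definition unpaired (f : tab) a r c :=
  [&& meets_pair f a r c, ~~ meets_pair f a r.+1 c & (r == 0) || ~~ meets_pair f a r.-1 c].

(** The number of indices in S below c.  Positions inside a region of boxes in a row
are measured by this rank, so that no contiguity of the region is needed. *)
Definition rk (S : nat -> bool) (c : nat) := \sum_(j < c) S j.

Lemma rkS S c : rk S c.+1 = rk S c + S c.
Proof. by rewrite /rk big_ord_recr. Qed.

Lemma rk_le S c c' : c <= c' -> rk S c <= rk S c'.
Proof.
elim: c' => [|c' IH]; first by rewrite leqn0 => /eqP->.
by rewrite leq_eqVlt => /predU1P[->//|/IH]; rewrite rkS; lia.
Qed.

Lemma rk_lt (S : nat -> bool) c C : c < C -> S c -> rk S c < rk S C.
Proof. by move=> /(rk_le S); rewrite rkS => h Sc; rewrite Sc in h; lia. Qed.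

Lemma rk_count (S : nat -> bool) C k :
  \sum_(c < C) (S c && (rk S c < k)) = minn k (rk S C).
Proof.
elim: C => [|C IH]; first by rewrite !big_ord0 /rk big_ord0 minn0.
by rewrite big_ord_recr /= IH rkS; case: (S C) => /=; lia.
Qed.

Lemma rk_count_last (S : nat -> bool) C k :
  \sum_(c < C) (S c && (rk S C <= rk S c + k)) = minn k (rk S C).
Proof.
have := rk_count S C (rk S C - k).
have : \sum_(c < C) (S c && (rk S C <= rk S c + k)) +
  \sum_(c < C) (S c && (rk S c < rk S C - k)) = rk S C.
  rewrite -big_split /= /rk; apply: eq_bigr => c _; case: (S c) => //=; rewrite -/(rk S c) -/(rk S C); lia.
lia.
Qed.

Lemma rk_down (S P : nat -> bool) C c : c < C -> S c ->
  (forall i j, S i -> S j -> i < j -> P j -> P i) ->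
  P c = (rk S c < \sum_(j < C) (S j && P j)).
Proof.
move=> cC Sc down.
have E k : \sum_(j < k) (S j && P j) = rk (fun j => S j && P j) k by [].
rewrite E; case Pc: (P c).
  suff: rk S c <= rk (fun j => S j && P j) c.
    by move/leq_ltn_trans=> h; symmetry; apply: h; apply: rk_lt => //; rewrite Sc.
  apply: leq_sum => -[j /= jc] _; case Sj: (S j) => //=.
  by rewrite (down j c).
symmetry; apply/negbTE; rewrite -leqNgt /rk.
rewrite (bigID (fun j : 'I_C => (j : nat) < c)) /= [X in _ + X]big1 => [|j jc]; last first.
  have [Sj|] := boolP (S j) => //=; rewrite [P j]negbTE //; apply/negP => Pj.
  move: jc; rewrite -leqNgt leq_eqVlt => /predU1P[e|lt]; first by rewrite e Pj in Pc.
  by have := down _ _ Sc Sj lt Pj; rewrite Pc.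
rewrite addn0 (big_ord_widen_cond C xpredT (fun j => nat_of_bool (S j)) (ltnW cC)) /=.
by apply: leq_sum => j _; case: (S j) => //=; case: (P j).
Qed.

(** In row r, a is put in the first [xs r] boxes of S, and a+1 in the last [ys r].
This is the general form of such a row, by [normal_a] and [normal_b]. *)
Definition renorm (C a : nat) (S : nat -> nat -> bool) (xs ys : nat -> nat)
    (f : tab) : tab := fun r c l =>
  if S r c && (l == a) then rk (S r) c < xs r
  else if S r c && (l == a.+1) then rk (S r) C <= rk (S r) c + ys r
  else f r c l.

(** Conditions under which rearranging a and a+1 inside S keeps a tableau: no
vertical interaction, and at the two ends of S in a row no conflict with the
neighbouring box. *)
Definition good_region (f : tab) (a : nat) (S : nat -> nat -> bool) : Prop :=
  [/\ forall r c, S r c -> meets_pair f a r c /\ ~~ meets_pair f a r.+1 c,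
      forall r c, S r.+1 c -> ~~ meets_pair f a r c,
      forall r c, S r c -> ~~ S r c.+1 -> ~~ f r c.+1 a
    & forall r c, S r c.+1 -> ~~ S r c -> ~~ f r c a.+1].

Definition rowc C (S : nat -> nat -> bool) (f : tab) l r := \sum_(c < C) (S r c && f r c l).

Section Renorm.
Variables (N C : nat) (sg kp : nat -> nat) (f : tab) (a : nat).
Hypotheses (Hsg : row_shape N C sg) (Hkp : row_shape N C kp) (Tf : tableau sg kp f).
Variable S : nat -> nat -> bool.
Hypothesis GS : good_region f a S.

Lemma region_bound r c : S r c -> (r < N) && (c < C).
Proof.
case: GS => h _ _ _ /h[/orP[fa|fa] _]; exact: (tab_bound Hkp Tf fa).
Qed.

(** The boxes of S in a row that contain a form an initial segment of S, since a box
containing only a+1 cannot be left of a box containing a. *)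
Lemma normal_a r c : S r c -> f r c a = (rk (S r) c < rowc C S f a r).
Proof.
move=> Sc; apply: (rk_down (P := fun c => f r c a)) => //; first by have := region_bound Sc; lia.
move=> i j Si Sj lt fj; case: GS => /(_ r i Si)[/orP[//|fi] _] _ _ _.
by have := tab_row Tf fi fj lt; lia.
Qed.

Lemma normal_b r c : S r c ->
  f r c a.+1 = (rk (S r) C <= rk (S r) c + rowc C S f a.+1 r).
Proof.
move=> Sc.
have cC : c < C by have := region_bound Sc; lia.
have := @rk_down (S r) (fun c => ~~ f r c a.+1) C c cC Sc.
have -> : \sum_(j < C) (S r j && ~~ f r j a.+1) = rk (S r) C - rowc C S f a.+1 r.
  suff E : \sum_(j < C) (S r j && ~~ f r j a.+1) + rowc C S f a.+1 r = rk (S r) C by lia.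
  rewrite /rowc -big_split /= /rk; apply: eq_bigr => j _.
  by case: (S r j) => //=; case: (f r j a.+1).
move=> H; rewrite -[LHS]negbK H; first by rewrite -leqNgt; lia.
move=> i j Si Sj lt; apply: contra => fi.
case: GS => /(_ r j Sj)[/orP[fj|//] _] _ _ _.
by have := tab_row Tf fi fj lt; lia.
Qed.

(** Each box of S contains a or a+1, and at most one box in a row contains both. *)
Lemma rowc_bounds r :
  rk (S r) C <= rowc C S f a r + rowc C S f a.+1 r <= (rk (S r) C).+1.
Proof.
pose B c := S r c && (f r c a && f r c a.+1).
have E : rowc C S f a r + rowc C S f a.+1 r = rk (S r) C + rk B C.
  rewrite /rowc /rk -!big_split /=; apply: eq_bigr => c _; rewrite /B.
  case Sc: (S r c) => //=; case: GS => /(_ r c Sc)[+ _] _ _ _; rewrite /meets_pair.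
  by case: (f r c a); case: (f r c a.+1).
suff : rk B C <= 1 by rewrite E; lia.
elim: C => [|k IH]; first by rewrite /rk big_ord0.
rewrite rkS; case Bk: (B k); last by lia.
suff -> : rk B k = 0 by [].
rewrite /rk big1 // => -[j jk] _ /=; apply/eqP; rewrite eqb0; apply/negP => /and3P[_ _ fj].
move/and3P: Bk => [_ fk _].
by have := tab_row Tf fj fk jk; lia.
Qed.

Lemma rowc_le l r : rowc C S f l r <= rk (S r) C.
Proof. by apply: leq_sum => c _; case: (S r c) => //=; case: (f r c l). Qed.

Lemma renorm_id : renorm C a S (rowc C S f a) (rowc C S f a.+1) f =2 f.
Proof.
move=> r c; apply/funext => l; rewrite /renorm.
case Sc: (S r c) => //=; case: eqP => [->|_]; first by rewrite normal_a.
by case: eqP => [->|//]; rewrite normal_b.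
Qed.

Variables xs ys : nat -> nat.
Hypothesis xy : forall r, rk (S r) C <= xs r + ys r <= (rk (S r) C).+1.
Let g := renorm C a S xs ys f.

Lemma renorm_out r c l : ~~ S r c -> g r c l = f r c l.
Proof. by rewrite /g /renorm => /negbTE->. Qed.

Lemma renorm_other r c l : l != a -> l != a.+1 -> g r c l = f r c l.
Proof. by rewrite /g /renorm => /negbTE-> /negbTE->; rewrite !andbF. Qed.

Lemma renorm_a r c : S r c -> g r c a = (rk (S r) c < xs r).
Proof. by move=> Sc; rewrite /g /renorm Sc eqxx. Qed.

Lemma renorm_b r c : S r c -> g r c a.+1 = (rk (S r) C <= rk (S r) c + ys r).
Proof. by move=> Sc; rewrite /g /renorm Sc eqxx (gtn_eqF (ltnSn a)). Qed.

Lemma renorm_meets r c : meets_pair g a r c = meets_pair f a r c.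
Proof.
case Sc: (S r c); last by rewrite /meets_pair !renorm_out ?Sc.
case: GS => /(_ r c Sc)[-> _] _ _ _.
rewrite /meets_pair renorm_a // renorm_b //.
by have := xy r; lia.
Qed.

Lemma renorm_box_meets r c l : g r c l ->
  f r c l \/ [/\ S r c, meets_pair f a r c & (l = a \/ l = a.+1)].
Proof.
case Sc: (S r c); last by rewrite renorm_out ?Sc //; left.
have Pc : meets_pair f a r c by case: GS => /(_ r c Sc)[].
case: (eqVneq l a) => [->|n1]; first by right; split=> //; left.
case: (eqVneq l a.+1) => [->|n2]; first by right; split=> //; right.
by rewrite renorm_other //; left.
Qed.

(** The sum of [xs] and [ys] is at least the number of boxes, so no box becomes
empty; it exceeds that number by at most one, so a+1 never precedes a strictly. *)
Lemma renorm_tableau : tableau sg kp g.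
Proof.
case: (Tf) => sup ne row col; case: (GS) => S1 S1' S2 S2'; split.
- move=> r c l /renorm_box_meets[|[_ /orP[] + _]]; exact: sup.
- move=> r c /ne[l fl].
  have [/negbTE n1|/negbNE/eqP e1] := boolP (l != a); last first.
    have : meets_pair g a r c by rewrite renorm_meets /meets_pair -e1 fl.
    by case/orP => h; [exists a|exists a.+1].
  have [/negbTE n2|/negbNE/eqP e2] := boolP (l != a.+1); last first.
    have : meets_pair g a r c by rewrite renorm_meets /meets_pair -e2 fl orbT.
    by case/orP => h; [exists a|exists a.+1].
  by exists l; rewrite renorm_other ?n1 ?n2.
- move=> r c l l' gl gl'.
  have [sg1|[Sc Pc El]] := renorm_box_meets gl;
  have [sg2|[Sc' Pc' El']] := renorm_box_meets gl'.
  + exact: row sg1 sg2.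
  + (* new letter on the right *)
    have [f0|f1] := orP Pc'; first by have := row _ _ _ _ sg1 f0; lia.
    have h := row _ _ _ _ sg1 f1.
    case: El' => El'; last by rewrite El'.
    rewrite El' in gl' *; rewrite leqNgt; apply/negP => lt.
    have el : l = a.+1 by lia.
    rewrite el in gl sg1; case Sc: (S r c); last first.
      by have := S2' _ _ Sc'; rewrite Sc => /(_ isT); rewrite sg1.
    move: gl gl'; rewrite renorm_b // renorm_a // rkS Sc.
    by have := xy r; lia.
  + have [f0|f1] := orP Pc; last by have := row _ _ _ _ f1 sg2; lia.
    have h := row _ _ _ _ f0 sg2.
    case: El => El; first by rewrite El.
    rewrite El in gl *; rewrite leqNgt; apply/negP => lt.
    have el : l' = a by lia.
    rewrite el in gl' sg2; case Sc': (S r c.+1); last first.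
      by have := S2 _ _ Sc; rewrite Sc' => /(_ isT); rewrite sg2.
    move: gl gl'; rewrite renorm_b // renorm_a // rkS Sc.
    by have := xy r; lia.
  + case: El => El; case: El' => El'; rewrite El El' ?leqnSn ?leqnn //.
    move: gl gl'; rewrite El El' renorm_b // renorm_a // rkS Sc.
    by have := xy r; lia.
- move=> r c l l' gl gl'.
  have [f1|[Sc Pc El]] := renorm_box_meets gl;
  have [f2|[Sc' Pc' El']] := renorm_box_meets gl'.
  + exact: col f1 f2.
  + have nP := S1' _ _ Sc'.
    have : l != a by apply: contra nP => /eqP e; rewrite /meets_pair -e f1.
    have : l != a.+1 by apply: contra nP => /eqP e; rewrite /meets_pair -e f1 orbT.
    by case/orP: Pc' => f2; have := col _ _ _ _ f1 f2; lia.
  + have [_ nP] := S1 _ _ Sc.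
    have : l' != a by apply: contra nP => /eqP e; rewrite /meets_pair -e f2.
    have : l' != a.+1 by apply: contra nP => /eqP e; rewrite /meets_pair -e f2 orbT.
    by case/orP: Pc => f1; have := col _ _ _ _ f1 f2; lia.
  + by have [_ /negP] := S1 _ _ Sc.
Qed.

Lemma renorm_unpaired : unpaired g a =2 unpaired f a.
Proof. by move=> r c; rewrite /unpaired !renorm_meets. Qed.

Lemma rowc_renorm_a r : xs r <= rk (S r) C -> rowc C S g a r = xs r.
Proof.
move=> h; rewrite -[RHS](minn_idPl h) -rk_count; apply: eq_bigr => c _.
by case Sc: (S r c) => //=; rewrite renorm_a.
Qed.

Lemma rowc_renorm_b r : ys r <= rk (S r) C -> rowc C S g a.+1 r = ys r.
Proof.
move=> h; rewrite -[RHS](minn_idPl h) -rk_count_last; apply: eq_bigr => c _.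
by case Sc: (S r c) => //=; rewrite renorm_b.
Qed.
End Renorm.

Lemma renorm_renorm C a S xs ys xs' ys' f :
  renorm C a S xs' ys' (renorm C a S xs ys f) = renorm C a S xs' ys' f.
Proof.
apply/funext => r; apply/funext => c; apply/funext => l; rewrite /renorm.
by case: (S r c) => //=; case: eqP => //=; case: eqP.
Qed.

(** The number of boxes in the region B that contain l. *)
Definition wcont N C (B : nat -> nat -> bool) (f : tab) l :=
  \sum_(r < N) \sum_(c < C) (B r c && f r c l).
Definition cont N C (f : tab) l := wcont N C (fun _ _ => true) f l.

Lemma wcont_rowc N C S f l : wcont N C S f l = \sum_(r < N) rowc C S f l r.
Proof. by []. Qed.

Lemma wcontD N C (B1 B2 B3 : nat -> nat -> bool) (f : tab) l :
  (forall r c, f r c l -> (B1 r c + B2 r c = B3 r c :> nat)) ->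
  wcont N C B1 f l + wcont N C B2 f l = wcont N C B3 f l.
Proof.
move=> H; rewrite /wcont -big_split; apply: eq_bigr => r _; rewrite -big_split /=.
by apply: eq_bigr => c _; have := H r c; case: (f r c l); rewrite ?andbF ?andbT //; apply.
Qed.

Lemma eq_wcont N C (B B' : nat -> nat -> bool) (f f' : tab) l l' :
  (forall r c, r < N -> c < C -> B r c && f r c l = B' r c && f' r c l') ->
  wcont N C B f l = wcont N C B' f' l'.
Proof. by move=> H; apply: eq_bigr => r _; apply: eq_bigr => c _; rewrite H. Qed.

(** * The Bender-Knuth involution on set-valued tableaux *)

Local Open Scope nat_scope.

Section FreeBoxes.
Variables (N C : nat) (sg kp : nat -> nat) (f : tab) (a : nat).
Hypotheses (Hsg : row_shape N C sg) (Hkp : row_shape N C kp) (Tf : tableau sg kp f).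

Lemma not_unpaired_a r c : f r c a -> ~~ unpaired f a r c = f r.+1 c a.+1.
Proof.
case: Tf => _ _ _ col fa; rewrite /unpaired {1}/meets_pair fa /= negb_and negbK.
have -> : (r == 0) || ~~ meets_pair f a r.-1 c.
  case: r fa => //= r fa; apply/negP => /orP[] h; have := col _ _ _ _ h fa; lia.
rewrite orbF /meets_pair; case h: (f r.+1 c a) => //; have := col _ _ _ _ fa h; lia.
Qed.

Lemma not_unpaired_b r c : f r c a.+1 -> ~~ unpaired f a r c = (0 < r) && f r.-1 c a.
Proof.
case: Tf => _ _ _ col fa; rewrite /unpaired {1}/meets_pair fa orbT /= negb_and negbK.
have -> : meets_pair f a r.+1 c = false.
  apply/negP => /orP[] h; have := col _ _ _ _ fa h; lia.
case: r fa => //= r fa; rewrite negbK /meets_pair.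
case h: (f r c a.+1); rewrite ?orbF //; have := col _ _ _ _ h fa; lia.
Qed.

(** If the right neighbour contains a and has a+1 below it, then the box below
the given one contains a+1 as well, and the given box is not unpaired. *)
Lemma unpaired_right r c : unpaired f a r c -> f r c.+1 a -> unpaired f a r c.+1.
Proof.
case: (Tf) => _ _ row col => /and3P[P nb _] f1; apply: contraT; rewrite not_unpaired_a // => f2.
case/orP: P => f0; last by have := row _ _ _ _ f0 f1; lia.
have [d fd] := tab_between Hsg Hkp Tf (r1 := r.+1) (c1 := c) f0 f2 ltac:(lia) ltac:(lia).
have := row _ _ _ _ fd f2; have := col _ _ _ _ f0 fd => h1 h2.
by case/negP: nb; rewrite /meets_pair -(_ : d = a.+1) ?fd ?orbT //; lia.
Qed.

Lemma unpaired_left r c : unpaired f a r c.+1 -> f r c a.+1 -> unpaired f a r c.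
Proof.
case: (Tf) => _ _ row col => /and3P[P _ nb] f1; apply: contraT; rewrite not_unpaired_b // => /andP[r0 f2].
case: r r0 P nb f1 f2 => //= r _ P nb f1 f2.
case/orP: P => f0; first by have := row _ _ _ _ f1 f0; lia.
have [d fd] := tab_between Hsg Hkp Tf (r1 := r) (c1 := c.+1) f2 f0 ltac:(lia) ltac:(lia).
have := row _ _ _ _ f2 fd; have := col _ _ _ _ fd f0 => h1 h2.
by case/negP: nb; rewrite /meets_pair -(_ : d = a) ?fd //; lia.
Qed.

Variable B : nat -> nat -> bool.
Hypothesis Bleft : forall r c, B r c.+1 -> B r c.
Hypothesis Bright : forall r c, B r c -> unpaired f a r c -> ~~ B r c.+1 -> ~~ f r c.+1 a.
Hypothesis Bpair : forall r c, f r c a -> f r.+1 c a.+1 -> B r c = B r.+1 c.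

Lemma unpaired_good : good_region f a (fun r c => B r c && unpaired f a r c).
Proof.
split.
- by move=> r c /and3P[_ -> /andP[-> _]].
- by move=> r c /andP[_ /and3P[]].
- move=> r c /andP[Bc Fc]; case Bc': (B r c.+1) => /= nF.
    by apply: contra nF; apply: unpaired_right.
  by apply: Bright => //; rewrite Bc'.
- move=> r c /andP[Bc Fc]; rewrite (Bleft Bc) /= => nF.
  by apply: contra nF; apply: unpaired_left.
Qed.

(** The boxes with a above a+1 are in bijection with those with a+1 below a.  The
hypothesis [Bpair] says that the region separates no such pair. *)
Lemma wcont_paired : wcont N C (fun r c => B r c && ~~ unpaired f a r c) f a =
  wcont N C (fun r c => B r c && ~~ unpaired f a r c) f a.+1.
Proof.
transitivity (\sum_(r < N) \sum_(c < C) (B r c && (f r c a && f r.+1 c a.+1))).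
  apply: eq_bigr => r _; apply: eq_bigr => c _.
  by case fa: (f r c a); rewrite ?andbF // not_unpaired_a ?andbT.
have supf r c l : N <= r -> f r c l = false.
  by move=> h; apply/negP => /(tab_bound Hkp Tf); lia.
transitivity (\sum_(r < N) \sum_(c < C) (B r c && ((0 < r) && f r.-1 c a && f r c a.+1))); last first.
  apply: eq_bigr => r _; apply: eq_bigr => c _.
  by case fa: (f r c a.+1); rewrite ?andbF // not_unpaired_b ?andbT.
case: N supf => [|n] supf; first by rewrite !big_ord0.
rewrite big_ord_recr big_ord_recl /= [X in _ + X]big1 => [|c _]; last first.
  by rewrite (supf n.+1) ?andbF.
rewrite [X in _ = X + _]big1 => [|c _]; last by rewrite andbF.
rewrite addn0 add0n; apply: eq_bigr => r _; apply: eq_bigr => c _ /=.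
rewrite /bump leq0n add1n /=.
by case fa: (f r c a); case fb: (f r.+1 c a.+1); rewrite ?andbF // (Bpair fa fb).
Qed.

Lemma wcont_region l : wcont N C B f l =
  wcont N C (fun r c => B r c && ~~ unpaired f a r c) f l +
  \sum_(r < N) rowc C (fun r c => B r c && unpaired f a r c) f l r.
Proof.
by rewrite -wcont_rowc; symmetry; apply: wcontD => r c _; case: (B r c); case: (unpaired f a r c).
Qed.

Lemma wcont_renorm (S : nat -> nat -> bool) xs ys l : (forall r c, S r c -> B r c && unpaired f a r c) ->
  wcont N C (fun r c => B r c && ~~ unpaired f a r c) (renorm C a S xs ys f) l =
  wcont N C (fun r c => B r c && ~~ unpaired f a r c) f l.
Proof.
move=> SB; apply: eq_wcont => r c _ _; rewrite /renorm.
by case Sc: (S r c) => //=; have /andP[_ ->] := SB _ _ Sc; rewrite andbF.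
Qed.
End FreeBoxes.

Lemma renorm_wcont_other N C a S xs ys B (f : tab) l : l != a -> l != a.+1 ->
  wcont N C B (renorm C a S xs ys f) l = wcont N C B f l.
Proof. by move=> h1 h2; apply: eq_wcont => r c _ _; rewrite renorm_other. Qed.

Definition bender_knuth C a (f : tab) : tab :=
  renorm C a (unpaired f a) (rowc C (unpaired f a) f a.+1) (rowc C (unpaired f a) f a) f.

Section BK.
Variables (N C : nat) (sg kp : nat -> nat) (a : nat).
Hypotheses (Hsg : row_shape N C sg) (Hkp : row_shape N C kp).

Lemma unpaired_good_all f : tableau sg kp f -> good_region f a (unpaired f a).
Proof. by move=> Tf; exact: (unpaired_good Hsg Hkp Tf (B := fun _ _ => true)). Qed.

Lemma bk_xy f : tableau sg kp f -> forall r, rk (unpaired f a r) C <=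
  rowc C (unpaired f a) f a.+1 r + rowc C (unpaired f a) f a r <= (rk (unpaired f a r) C).+1.
Proof.
by move=> Tf r; rewrite addnC; exact: (rowc_bounds _ Tf (unpaired_good_all Tf)).
Qed.

(** Exchanging the two multiplicities keeps their sum, hence the bounds of
[rowc_bounds]. *)
Lemma bk_tableau f : tableau sg kp f -> tableau sg kp (bender_knuth C a f).
Proof.
move=> Tf; exact: (renorm_tableau Tf (unpaired_good_all Tf) (bk_xy Tf)).
Qed.

Lemma bk_unpaired f : tableau sg kp f -> unpaired (bender_knuth C a f) a = unpaired f a.
Proof.
move=> Tf; apply/funext => r; apply/funext => c.
exact: (renorm_unpaired (unpaired_good_all Tf) (bk_xy Tf)).
Qed.

Lemma bk_rowc_a f : rowc C (unpaired f a) (bender_knuth C a f) a = rowc C (unpaired f a) f a.+1.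
Proof. by apply/funext=> r; rewrite rowc_renorm_a // rowc_le. Qed.

Lemma bk_rowc_b f : rowc C (unpaired f a) (bender_knuth C a f) a.+1 = rowc C (unpaired f a) f a.
Proof. by apply/funext=> r; rewrite rowc_renorm_b // rowc_le. Qed.

Lemma bkK f : tableau sg kp f -> bender_knuth C a (bender_knuth C a f) = f.
Proof.
move=> Tf; rewrite {1}/bender_knuth bk_unpaired // bk_rowc_a bk_rowc_b /bender_knuth renorm_renorm.
apply/funext => r; apply/funext => c; exact: (renorm_id Hkp Tf (unpaired_good_all Tf)).
Qed.

Lemma bk_cont_a f : tableau sg kp f -> cont N C (bender_knuth C a f) a = cont N C f a.+1.
Proof.
move=> Tf; have Tb := bk_tableau Tf.
rewrite /cont (wcont_region N C (bender_knuth C a f) a) (wcont_region N C f a) /= bk_unpaired //.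
rewrite -(wcont_paired (a := a) (B := fun _ _ => true) Hkp Tf) //.
rewrite (@wcont_renorm N C f a (fun _ _ => true)) //; congr (_ + _).
by apply: eq_bigr => r _; exact: (congr1 (fun g => g (r : nat)) (bk_rowc_a f)).
Qed.

Lemma bk_cont_b f : tableau sg kp f -> cont N C (bender_knuth C a f) a.+1 = cont N C f a.
Proof. by move=> Tf; rewrite -[in RHS](bkK Tf) bk_cont_a //; apply: bk_tableau. Qed.
End BK.

(** Boxes are read by rows from top to bottom and from right to left in each row,
the reverse of the order of the letters in the word; (r, c) is read before
(r0, c0). *)
Definition bef (r0 c0 r c : nat) := (r < r0) || ((r == r0) && (c0 < c)).

(** Inside a box the larger letters are read first, so the count of a excludes the
box itself while the count of a+1 includes it; the inequality says that the
latter exceeds the former. *)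
Definition viol N C (f : tab) r c a :=
  f r c a.+1 && (wcont N C (bef r c) f a <= wcont N C (bef r c) f a.+1).

Lemma viol_ext N C (f g : tab) r c a : (forall r' c', bef r c r' c' -> f r' c' = g r' c') ->
  f r c a.+1 = g r c a.+1 -> viol N C f r c a = viol N C g r c a.
Proof.
move=> E1 E2; rewrite /viol E2; congr (_ && (_ <= _)); apply: eq_wcont => r' c' _ _;
by case Bc: (bef _ _ _ _) => //=; rewrite E1.
Qed.

Lemma wcont_row N C (B : nat -> bool) (f : tab) l r1 : r1 < N ->
  wcont N C (fun r c => (r == r1) && B c) f l = \sum_(c < C) (B c && f r1 c l).
Proof.
move=> h; rewrite /wcont (bigD1 (Ordinal h)) //= eqxx /= [X in _ + X]big1 ?addn0 // => r.
by rewrite -val_eqE /= => /negbTE->; apply: big1.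
Qed.

Lemma wcont_pt N C (f : tab) l r1 c1 : r1 < N -> c1 < C ->
  wcont N C (fun r c => (r == r1) && (c == c1)) f l = f r1 c1 l.
Proof.
move=> h hc; rewrite (wcont_row _ (fun c => c == c1)) // (bigD1 (Ordinal hc)) //= eqxx /=.
by rewrite big1 ?addn0 // => c; rewrite -val_eqE /= => /negbTE->.
Qed.

Section Lattice.
Variables (N C : nat) (sg kp : nat -> nat) (f : tab) (a : nat).
Hypotheses (Hsg : row_shape N C sg) (Hkp : row_shape N C kp) (Tf : tableau sg kp f).

(** Reading the last a+1 before the given box, the counts would be out of balance
already there. *)
Lemma balance r0 c0 : (forall r c, bef r0 c0 r c -> ~~ viol N C f r c a) ->
  wcont N C (bef r0 c0) f a.+1 <= wcont N C (bef r0 c0) f a.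
Proof.
move=> nv; rewrite leqNgt; apply/negP => lt.
pose P (b : 'I_N * 'I_C) := bef r0 c0 b.1 b.2 && f b.1 b.2 a.+1.
have [b Pb] : exists b, P b.
  apply/existsP; apply: contraT; rewrite negb_exists => /forallP H.
  suff E : wcont N C (bef r0 c0) f a.+1 = 0 by rewrite E in lt.
  rewrite /wcont big1 // => r _; rewrite big1 // => c _; apply/eqP.
  by rewrite eqb0; exact: (H (r, c)).
case: (arg_maxnP (fun b : 'I_N * 'I_C => b.1 * C + (C - b.2)) Pb) => -[r1 c1] /andP[/= B1 f1] M.
have E1 : wcont N C (bef r1 c1) f a.+1 + 1 = wcont N C (bef r0 c0) f a.+1.
  have W1 : wcont N C (fun r c => (r == r1) && (c == c1)) f a.+1 = 1.
    by rewrite wcont_pt ?ltn_ord // f1.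
  rewrite -[X in _ + X]W1.
  apply: wcontD => r c fr; have := tab_bound Hkp Tf fr => /andP[rN cC].
  have := M (Ordinal rN, Ordinal cC); rewrite /P /= fr andbT => M1.
  case Bc: (bef r0 c0 r c) M1 => M1.
    have {}M1 := M1 isT.
    suff : bef r1 c1 r c || ((r == r1) && (c == c1)) by rewrite /bef; lia.
    rewrite /bef.
    case: (ltngtP r r1) => //= [lt1|e]; last first.
      by move: M1; rewrite e leq_add2l; have := ltn_ord c1; lia.
    have : r1.+1 * C <= r * C by rewrite leq_mul2r lt1 orbT.
    by have := ltn_ord c1; rewrite mulSn; lia.
  by move: B1 Bc; rewrite /bef; lia.
have E2 : wcont N C (bef r1 c1) f a <= wcont N C (bef r0 c0) f a.
  apply: leq_sum => r _; apply: leq_sum => c _.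
  by case: (f r c a); rewrite ?andbF // !andbT; move: B1; rewrite /bef; lia.
by have /negP := nv _ _ B1; apply; rewrite /viol f1 /=; lia.
Qed.

Variables (r0 c0 : nat).
Hypothesis nv : forall r c, bef r0 c0 r c -> ~~ viol N C f r c a.
Hypothesis v : viol N C f r0 c0 a.

Lemma viol_eq : wcont N C (bef r0 c0) f a = wcont N C (bef r0 c0) f a.+1.
Proof. by apply/eqP; rewrite eqn_leq (balance nv) andbT; case/andP: v. Qed.

(** Were a above the first violation, then each a+1 of the row weakly to the right
of the violation would have an a above it.  These a are read after the last
place of the upper row where the counts are known to be balanced, and they
outnumber the occurrences of a+1 read since. *)
Lemma viol_unpaired : 0 < r0 -> ~~ f r0.-1 c0 a.
Proof.
move=> r0p; apply/negP => fa.
have fb : f r0 c0 a.+1 by case/andP: v.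
case: (Tf) => _ _ row col.
have [c2 f2 M] : exists2 c2, f r0 c2 a.+1 & forall c, f r0 c a.+1 -> c <= c2.
  have ex : exists c, f r0 c a.+1 by exists c0.
  have ub c : f r0 c a.+1 -> c <= C by move/(tab_bound Hkp Tf); lia.
  by case: (ex_maxnP ex ub) => c2 h1 h2; exists c2.
have c02 := M _ fb.
(* c2 is the last column of row r0 with a+1 *)
have F1 c : c0 <= c <= c2 -> f r0 c a.+1.
  move=> h; have [->//|[->//|lt]] : c = c0 \/ c = c2 \/ c0 < c < c2 by lia.
  have [d fd] := tab_between Hsg Hkp Tf (r1 := r0) (c1 := c) fb f2 ltac:(lia) h.
  suff <- : d = a.+1 by [].
  have := tab_row Tf fb fd ltac:(lia); have := tab_row Tf fd f2 ltac:(lia); lia.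
case: r0 r0p fa fb v F1 M nv f2 => //= r1 _ fa fb v' F1 M nv' f2.
have F2 c : c0 <= c <= c2 -> f r1 c a.
  move=> h; have [->//|lt] : c = c0 \/ c0 < c by lia.
  have [d fd] := tab_between Hsg Hkp Tf (r1 := r1) (c1 := c) fa f2 ltac:(lia) h.
  suff <- : d = a by [].
  have := tab_row Tf fa fd lt; have := col _ _ _ _ fd (F1 _ h); lia.
have r1N : r1.+1 < N by have := tab_bound Hkp Tf fb; lia.
have bal : wcont N C (bef r1 c2) f a.+1 <= wcont N C (bef r1 c2) f a.
  by apply: balance => r c h; apply: nv'; move: h; rewrite /bef; lia.
have E1 : wcont N C (bef r1 c2) f a.+1 +
    wcont N C (fun r c => (r == r1.+1) && (c0 < c <= c2)) f a.+1 =
  wcont N C (bef r1.+1 c0) f a.+1.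
  apply: wcontD => r c fr; rewrite /bef.
  have H1 : r = r1.+1 -> c <= c2 by move=> e; rewrite e in fr; exact: M.
  have H2 : r = r1 -> c2 < c.
    move=> e; rewrite e in fr; case: (ltngtP c2 c) => // lt; exfalso.
      by have := tab_row Tf fr (F2 c2 ltac:(lia)) lt; lia.
    by rewrite -lt in fr; have := col _ _ _ _ fr f2; lia.
  case: (ltngtP r r1) => [lt|gt|e].
  - by rewrite (ltnW lt : r < r1.+1) (ltn_eqF (ltnW lt : r < r1.+1)).
  - rewrite (_ : (r < r1.+1) = false) /= ?add0n; last by lia.
    case: eqP => //= e.
    by rewrite (H1 e) andbT.
  - by rewrite H2 // e ltnSn (ltn_eqF (ltnSn r1)).
have E2 : wcont N C (bef r1 c2) f a +
    wcont N C (fun r c => (r == r1) && (c0 <= c <= c2)) f a <=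
  wcont N C (bef r1.+1 c0) f a.
  rewrite /wcont -big_split; apply: leq_sum => r _; rewrite -big_split /=.
  by apply: leq_sum => c _; case: (f r c a); rewrite ?andbF // !andbT /bef; lia.
have E3 : wcont N C (fun r c => (r == r1.+1) && (c0 < c <= c2)) f a.+1 <
    wcont N C (fun r c => (r == r1) && (c0 <= c <= c2)) f a.
  rewrite (wcont_row _ (fun c => c0 < c <= c2)) // (wcont_row _ (fun c => c0 <= c <= c2)); last by lia.
  have c0C : c0 < C by have := tab_bound Hkp Tf fb; lia.
  rewrite (bigD1 (Ordinal c0C)) //= [X in _ < X](bigD1 (Ordinal c0C)) //= ltnn /= leqnn c02 fa /=.
  rewrite add0n add1n ltnS; apply: leq_sum => c _.
  case h: (c0 < c <= c2) => //=.
  have h' : c0 <= c <= c2 by case/andP: h => h1 ->; rewrite ltnW.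
  by rewrite F2 // h' leq_b1.
by move: v'; rewrite /viol; lia.
Qed.
End Lattice.

(** * The two moves at a first violation *)

Local Open Scope nat_scope.

Section FirstViolation.
Variables (N C : nat) (sg kp : nat -> nat) (J : nat -> bool) (r0 c0 a : nat).
Hypotheses (Hsg : row_shape N C sg) (Hkp : row_shape N C kp) (Ja : J a).

(** The violation at (r0, c0) by the pair (a, a+1) comes first among those by pairs
in J.  In the box (r0, c0) larger letters come first, as in the reading order. *)
Definition first_violation (f : tab) : Prop :=
  [/\ tableau sg kp f, viol N C f r0 c0 a,
      forall r c b, J b -> bef r0 c0 r c -> ~~ viol N C f r c b
    & forall b, J b -> a < b -> ~~ viol N C f r0 c0 b].

(** The unpaired boxes that are not yet read, together with the violating box
itself, which always keeps its a+1. *)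
Definition rest (f : tab) r c := ~~ bef r0 c0 r c && unpaired f a r c.

Section Region.
Variable f : tab.
Hypothesis Vf : first_violation f.

Lemma first_violation_b : f r0 c0 a.+1.
Proof. by case: Vf => _ /andP[]. Qed.

Lemma first_violation_unpaired c : 0 < r0 -> c <= c0 -> f r0 c a.+1 -> ~~ f r0.-1 c a.
Proof.
case: (Vf) => Tf v nv _ r0p le fb; apply/negP => fa.
have fb0 := first_violation_b; case: (Tf) => _ _ row col.
have nv' r c' : bef r0 c0 r c' -> ~~ viol N C f r c' a by exact: nv.
have /negP := viol_unpaired Hsg Hkp Tf nv' v r0p; apply.
case: (ltngtP c c0) le => // [lt _|<- //].
case: r0 r0p fa fb fb0 => // r1 _ /= fa fb fb0.
have [d fd] := tab_between Hsg Hkp Tf (r1 := r1) (c1 := c0) fa fb0 ltac:(lia) ltac:(lia).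
have := tab_row Tf fa fd lt; have := col _ _ _ _ fd fb0 => h1 h2.
by rewrite (_ : a = d) //; lia.
Qed.

Lemma rest_pair r c : f r c a -> f r.+1 c a.+1 ->
  ~~ bef r0 c0 r c = ~~ bef r0 c0 r.+1 c.
Proof.
case: (Vf) => Tf v nv _ fa fb; rewrite /bef.
have fb0 := first_violation_b; case: (Tf) => _ _ row col.
have [e|ne] := eqVneq r.+1 r0.
  rewrite -e; have [lt|ge] := ltnP c0 c; first by lia.
  have := @first_violation_unpaired c; rewrite -e fa fb => /(_ isT ge isT); done.
have [e|ne'] := eqVneq r r0; last by lia.
subst r; have [lt|ge] := ltnP c0 c; last by lia.
by have := tab_row Tf fb0 fa lt; lia.
Qed.

Lemma rest_good : good_region f a (rest f).
Proof.
case: (Vf) => Tf v nv _; have fb0 := first_violation_b; case: (Tf) => _ _ row col.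
apply: (unpaired_good Hsg Hkp Tf).
- by move=> r c; rewrite /bef; lia.
- move=> r c; rewrite /bef => h1 _ h2; apply/negP => fa.
  have [e1 e2] : r = r0 /\ c = c0 by lia.
  by subst; have := row _ _ _ _ fb0 fa; lia.
Qed.

Lemma rest_b : rest f r0 c0.
Proof.
case: (Vf) => Tf v nv _; have fb0 := first_violation_b.
rewrite /rest /bef ltnn eqxx ltnn /=; apply: contraT.
rewrite (not_unpaired_b Tf fb0) => /andP[r0p fa].
by have := first_violation_unpaired r0p (leqnn _) fb0; rewrite fa.
Qed.

Lemma rest_rk : rk (rest f r0) C = (rk (rest f r0) c0).+1.
Proof.
case: (Vf) => Tf v nv _; have fb0 := first_violation_b.
have cC : c0 < C by have := tab_bound Hkp Tf fb0; lia.
have E k : rk (rest f r0) (c0.+1 + k) = rk (rest f r0) c0.+1.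
  elim: k => [|k IH]; first by rewrite addn0.
  rewrite addnS rkS IH {2}/rest /bef (_ : c0 < c0.+1 + k) ?eqxx ?orbT ?addn0 //; lia.
by rewrite -(subnKC cC) E rkS rest_b addn1.
Qed.

Let x := rowc C (rest f) f a.
Let y := rowc C (rest f) f a.+1.

Lemma rest_xy r : rk (rest f r) C <= x r + y r <= (rk (rest f r) C).+1.
Proof. by case: (Vf) => Tf _ _ _; exact: (rowc_bounds _ Tf rest_good). Qed.

Lemma rest_y : 0 < y r0.
Proof.
case: (Vf) => Tf _ _ _; have := normal_b Hkp Tf rest_good rest_b.
by rewrite first_violation_b rest_rk -/y; lia.
Qed.

Variables xs ys : nat -> nat.
Hypothesis xy : forall r, rk (rest f r) C <= xs r + ys r <= (rk (rest f r) C).+1.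
Let g := renorm C a (rest f) xs ys f.

Lemma rest_renorm : rest g = rest f.
Proof.
apply/funext => r; apply/funext => c; rewrite /rest.
by rewrite (renorm_unpaired rest_good xy).
Qed.

Lemma renorm_before r c : bef r0 c0 r c -> g r c = f r c.
Proof. by move=> h; apply/funext => l; rewrite /g renorm_out // /rest h. Qed.

(** Rearranging [rest] changes nothing that is read before the violation, and keeps
a+1 in the violating box as long as its row keeps at least one a+1. *)
Lemma first_violation_renorm : 0 < ys r0 -> first_violation g.
Proof.
case: (Vf) => Tf v nv nv' yp; split.
- exact: (renorm_tableau Tf rest_good xy).
- suff <- : viol N C f r0 c0 a = viol N C g r0 c0 a by [].
  apply: viol_ext; first by move=> r c h; rewrite renorm_before.
  by rewrite first_violation_b /g renorm_b ?rest_b // rest_rk; lia.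
- move=> r c b Jb h; suff <- : viol N C f r c b = viol N C g r c b by exact: nv.
  apply: viol_ext; last by rewrite renorm_before.
  by move=> r' c' h'; rewrite renorm_before //; move: h h'; rewrite /bef; lia.
- move=> b Jb lt; suff <- : viol N C f r0 c0 b = viol N C g r0 c0 b by exact: nv'.
  apply: viol_ext; first by move=> r c h; rewrite renorm_before.
  by rewrite /g renorm_other //; lia.
Qed.

End Region.

(** Up to the violation the two letters are read equally often, and the paired
boxes not yet read contain them equally often; only [rest] makes a difference. *)
Lemma cont_rest f : first_violation f ->
  cont N C f a = wcont N C (bef r0 c0) f a +
        wcont N C (fun r c => ~~ bef r0 c0 r c && ~~ unpaired f a r c) f a +
        \sum_(r < N) rowc C (rest f) f a r /\
  cont N C f a.+1 = wcont N C (bef r0 c0) f a +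
        wcont N C (fun r c => ~~ bef r0 c0 r c && ~~ unpaired f a r c) f a +
        \sum_(r < N) rowc C (rest f) f a.+1 r.
Proof.
move=> Vf; case: (Vf) => Tf v nv _.
have E l : cont N C f l = wcont N C (bef r0 c0) f l +
    wcont N C (fun r c => ~~ bef r0 c0 r c) f l.
  by rewrite /cont; symmetry; apply: wcontD => r c _; case: (bef _ _ _ _).
have nv' r c' : bef r0 c0 r c' -> ~~ viol N C f r c' a by exact: nv.
split; rewrite E (wcont_region N C f a (fun r c => ~~ bef r0 c0 r c)) addnA //.
congr (_ + _ + _); first by rewrite (viol_eq Hkp Tf nv' v).
symmetry; apply: (wcont_paired (B := fun r c => ~~ bef r0 c0 r c) Hkp Tf).
by move=> r c; exact: rest_pair.
Qed.

Section Maps.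
Variable f : tab.
Hypothesis Vf : first_violation f.
Let S := rest f.
Let x := rowc C S f a.
Let y := rowc C S f a.+1.
Let L := rk (S r0) C.

(** In the row of the violation, no box of [rest] contains both a and a+1. *)
Definition tight (h : tab) :=
  rowc C (rest h) h a r0 + rowc C (rest h) h a.+1 r0 == rk (rest h r0) C.

Let r0N : r0 < N.
Proof. by case: (Vf) => Tf _ _ _; have := tab_bound Hkp Tf (first_violation_b Vf); lia. Qed.

Lemma sum_update (u v : nat -> nat) :
  (forall r, r != r0 -> v r = u r) ->
  \sum_(r < N) v r + u r0 = \sum_(r < N) u r + v r0.
Proof.
move=> E; rewrite (bigD1 (Ordinal r0N)) //= [in RHS](bigD1 (Ordinal r0N)) //=.
rewrite (eq_bigr (fun r : 'I_N => u r)); first by lia.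
by move=> r; rewrite -val_eqE /= => /E.
Qed.

Lemma renorm_cont xs ys (g := renorm C a S xs ys f) :
  (forall r, rk (S r) C <= xs r + ys r <= (rk (S r) C).+1) -> 0 < ys r0 ->
  (forall r, xs r <= rk (S r) C) -> (forall r, ys r <= rk (S r) C) ->
  [/\ first_violation g, rest g = S, rowc C S g a = xs, rowc C S g a.+1 = ys &
   exists K, [/\ cont N C f a = K + \sum_(r < N) x r, cont N C f a.+1 = K + \sum_(r < N) y r,
   cont N C g a = K + \sum_(r < N) xs r & cont N C g a.+1 = K + \sum_(r < N) ys r]].
Proof.
move=> xy yp hx hy.
have Vg : first_violation g by exact: first_violation_renorm.
have Rg : rest g = S by exact: rest_renorm.
have ex : rowc C S g a = xs by apply/funext => r; rewrite rowc_renorm_a.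
have ey : rowc C S g a.+1 = ys by apply/funext => r; rewrite rowc_renorm_b.
split=> //; have [E1 E2] := cont_rest Vf; have [E3 E4] := cont_rest Vg.
exists (wcont N C (bef r0 c0) f a +
        wcont N C (fun r c => ~~ bef r0 c0 r c && ~~ unpaired f a r c) f a).
split=> //; rewrite ?E3 ?E4 Rg ?ex ?ey; congr (_ + _ + _).
- by apply: eq_wcont => r c _ _; case h: (bef _ _ _ _) => //=; rewrite /g (renorm_before _ _ _ h).
- have Fg : unpaired g a =2 unpaired f a by exact: (renorm_unpaired (rest_good Vf) xy).
  apply: eq_wcont => r c _ _; rewrite Fg; case h: (unpaired _ _ _ _); rewrite ?andbF //.
  by rewrite /g renorm_out // /S /rest h andbF.
- by apply: eq_wcont => r c _ _; case h: (bef _ _ _ _) => //=; rewrite /g (renorm_before _ _ _ h).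
- have Fg : unpaired g a =2 unpaired f a by exact: (renorm_unpaired (rest_good Vf) xy).
  apply: eq_wcont => r c _ _; rewrite Fg; case h: (unpaired _ _ _ _); rewrite ?andbF //.
  by rewrite /g renorm_out // /S /rest h andbF.
Qed.
End Maps.

(** The a+1 of the violating box is counted on the side that is already read.  Thus
in its row y-1 plays the role of y, and the exchange sends (x, y) to
(y-1, x+1). *)
Definition swap_rest (f : tab) : tab :=
  let x := rowc C (rest f) f a in let y := rowc C (rest f) f a.+1 in
  renorm C a (rest f) (fun r => if r == r0 then (y r).-1 else y r)
    (fun r => if r == r0 then (x r).+1 else x r) f.

(** Adds a to the leftmost box containing a+1 in the row of the violation, or
removes it from there. *)
Definition toggle_first (f : tab) : tab :=
  let x := rowc C (rest f) f a in let y := rowc C (rest f) f a.+1 in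
  renorm C a (rest f)
    (fun r => if r == r0 then (if tight f then (x r).+1 else (x r).-1) else x r) y f.

Lemma swap_rest_spec f : first_violation f -> tight f ->
  [/\ first_violation (swap_rest f), tight (swap_rest f), swap_rest (swap_rest f) = f,
      cont N C (swap_rest f) a + 1 = cont N C f a.+1 & cont N C (swap_rest f) a.+1 = cont N C f a + 1].
Proof.
move=> Vf tf; have Tf : tableau sg kp f by case: Vf.
rewrite /swap_rest.
set x := rowc C (rest f) f a; set y := rowc C (rest f) f a.+1.
set xs := fun r : nat => _; set ys := fun r : nat => _.
have y0 : 0 < y r0 by exact: rest_y.
have hx r : x r <= rk (rest f r) C by exact: rowc_le.
have hy r : y r <= rk (rest f r) C by exact: rowc_le.
have exy : x r0 + y r0 = rk (rest f r0) C by exact/eqP.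
have [Vg Rg ex ey [K [E1 E2 E3 E4]]] := @renorm_cont f Vf xs ys
   ltac:(by move=> r; have := rest_xy Vf r; rewrite /xs /ys -/x -/y; case: eqP => [->|]; lia)
   ltac:(by rewrite /ys eqxx)
   ltac:(by move=> r; rewrite /xs; case: eqP => [->|]; have := hy r; have := hy r0; lia)
   ltac:(by move=> r; rewrite /ys; case: eqP => [->|]; have := hx r; have := hx r0; lia).
split=> //.
- by rewrite /tight Rg ex ey /xs /ys eqxx; apply/eqP; lia.
- rewrite Rg ex ey renorm_renorm.
  apply/funext => r; apply/funext => c; rewrite -[RHS](renorm_id Hkp Tf (rest_good Vf)).
  congr (renorm _ _ _ _ _ _ _ _); apply/funext => k; rewrite /xs /ys; case: eqP => // ->.
  by rewrite prednK.
- rewrite E3 E2; have := @sum_update f Vf y xs; rewrite -/y /xs eqxx => H.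
  by have := H ltac:(by move=> r /negbTE->); lia.
- rewrite E4 E1; have := @sum_update f Vf x ys; rewrite -/x /ys eqxx => H.
  by have := H ltac:(by move=> r /negbTE->); lia.
Qed.

Lemma toggle_first_spec f : first_violation f ->
  [/\ first_violation (toggle_first f), tight (toggle_first f) = ~~ tight f, toggle_first (toggle_first f) = f,
      tight f -> cont N C (toggle_first f) a = cont N C f a + 1 &
      cont N C (toggle_first f) a.+1 = cont N C f a.+1].
Proof.
move=> Vf; have Tf : tableau sg kp f by case: Vf.
rewrite /toggle_first.
set x := rowc C (rest f) f a; set y := rowc C (rest f) f a.+1; set xs := fun r : nat => _.
have y0 : 0 < y r0 by exact: rest_y.
have hx r : x r <= rk (rest f r) C by exact: rowc_le.
have hy r : y r <= rk (rest f r) C by exact: rowc_le.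
have := rest_xy Vf r0; rewrite -/x -/y => b0.
have tE : tight f = (x r0 + y r0 == rk (rest f r0) C) by [].
have [Vg Rg ex ey [K [E1 E2 E3 E4]]] := @renorm_cont f Vf xs y
   ltac:(by move=> r; have := rest_xy Vf r; rewrite /xs -/x -/y; case: eqP => [->|_]; [move: tE; case: (tight f)|]; lia)
   ltac:(by [])
   ltac:(by move=> r; rewrite /xs; have := hx r; have := hx r0; have := hy r0; case: eqP => [->|_]; [move: tE; case: (tight f)|]; lia)
   ltac:(by []).
have tg' : tight (renorm C a (rest f) xs y f) = ~~ tight f.
  by rewrite {1}/tight Rg ex ey /xs eqxx; move: tE; have := hy r0; case: (tight f) => /=; lia.
split=> //.
- rewrite tg' Rg ex ey renorm_renorm.
  apply/funext => r; apply/funext => c; rewrite -[RHS](renorm_id Hkp Tf (rest_good Vf)).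
  congr (renorm _ _ _ _ _ _ _ _); apply/funext => k; rewrite /xs; case: eqP => // ->.
  by rewrite -/x; move: tE; have := hy r0; case: (tight f) => /=; lia.
- move=> tf; rewrite E3 E1; have := @sum_update f Vf x xs; rewrite -/x /xs eqxx tf => H.
  by have := H ltac:(by move=> r /negbTE->); lia.
- by rewrite E4 E2.
Qed.

Lemma swap_rest_other f l : l != a -> l != a.+1 -> cont N C (swap_rest f) l = cont N C f l.
Proof. by move=> h1 h2; apply: renorm_wcont_other. Qed.

Lemma toggle_first_other f l : l != a -> l != a.+1 -> cont N C (toggle_first f) l = cont N C f l.
Proof. by move=> h1 h2; apply: renorm_wcont_other. Qed.
End FirstViolation.

(** * Alternants in n variables *)

Local Open Scope ring_scope.

Section Alternant.
Import fingroup perm mpoly.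
Variable n : nat.
Implicit Types F G H : mpoly n int.

(** Exponent vectors are functions on all of nat, of which the first n values
matter.  This avoids coercions between index types. *)
Definition xmono (g : nat -> nat) : mpoly n int := 'X_[[multinom g i | i < n]].

Lemma xmonoD g h : xmono (fun i => g i + h i)%N = xmono g * xmono h.
Proof. by rewrite /xmono -mpolyXD; congr mpolyX; apply/mnmP => i; rewrite mnmDE !mnmE. Qed.

Lemma eq_xmono g h : (forall i, (i < n)%N -> g i = h i) -> xmono g = xmono h.
Proof. by move=> E; congr mpolyX; apply/mnmP => i; rewrite !mnmE E. Qed.

Lemma xmonoE g : xmono g = \prod_(j < n) 'X_j ^+ g j.
Proof. by rewrite /xmono mpolyXE_id; apply: eq_bigr => j _; rewrite mnmE. Qed.

Lemma msym_var (s : 'S_n) i : msym s 'X_i = 'X_(s i) :> mpoly n int.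
Proof. by rewrite /msym mmapX mmap1U. Qed.

Definition one_minus : mpoly n int := \prod_(j < n) (1 - 'X_j) ^+ j.

(** The factor x^delta prod_j (1 - x_j)^j, for j counted from 0; with the factor
prod_j (1 - x_j)^j removed, the alternants below become those of Schur
polynomials. *)
Definition Kdelta : mpoly n int := xmono (fun j => n.-1 - j)%N * one_minus.
Definition alt F := \sum_(w : 'S_n) (-1) ^+ w *: msym w F.

Lemma altD F G : alt (F + G) = alt F + alt G.
Proof. by rewrite /alt -big_split; apply: eq_bigr => w _; rewrite msymD scalerDr. Qed.

Lemma alt0 : alt 0 = 0.
Proof. by rewrite /alt big1 // => w _; rewrite msym0 scaler0. Qed.

Lemma altZ c F : alt (c *: F) = c *: alt F.
Proof.
rewrite /alt scaler_sumr; apply: eq_bigr => w _.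
by rewrite msymZ !scalerA mulrC.
Qed.

Lemma altB F G : alt (F - G) = alt F - alt G.
Proof. by rewrite altD -scaleN1r altZ scaleN1r. Qed.

Lemma alt_sum (I : Type) (r : seq I) (P : pred I) (E : I -> mpoly n int) :
  alt (\sum_(i <- r | P i) E i) = \sum_(i <- r | P i) alt (E i).
Proof. exact: (big_morph alt altD alt0). Qed.

Lemma alt_msym s F : alt (msym s F) = (-1) ^+ s *: alt F.
Proof.
rewrite /alt scaler_sumr (reindex_inj (mulgI (s^-1)%g)) /=.
apply: eq_bigr => w _; rewrite -msymMm mulKVg scalerA odd_permM odd_permV.
by rewrite signr_addb.
Qed.

Lemma alt_sym g F : (forall s : 'S_n, msym s g = g) -> alt (g * F) = g * alt F.
Proof.
move=> sg; rewrite /alt mulr_sumr; apply: eq_bigr => w _.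
by rewrite msymM sg scalerAr.
Qed.

Lemma msym_prod_other (i0 i1 : 'I_n) (f : 'I_n -> mpoly n int) :
  (forall j, j != i0 -> j != i1 -> msym (tperm i0 i1) (f j) = f j) ->
  msym (tperm i0 i1) (\prod_(j < n | (j != i0) && (j != i1)) f j) =
  \prod_(j < n | (j != i0) && (j != i1)) f j.
Proof. by move=> E; rewrite rmorph_prod; apply: eq_bigr => j /andP[]; exact: E. Qed.

(** Apart from x_j (1 - x_(j+1)), all factors of [Kdelta] can be grouped
symmetrically in x_j and x_(j+1). *)
Lemma Kdelta_split (i0 i1 : 'I_n) : i1 = i0.+1 :> nat ->
  exists2 D, msym (tperm i0 i1) D = D & Kdelta = D * ('X_i0 * (1 - 'X_i1)).
Proof.
move=> e; have n01 : i1 != i0 by rewrite -val_eqE /= e; lia.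
pose Q := \prod_(j < n | (j != i0) && (j != i1)) ('X_j ^+ (n.-1 - j) * (1 - 'X_j) ^+ j) : mpoly n int.
exists (('X_i0 * 'X_i1) ^+ (n.-1 - i1) * ((1 - 'X_i0) * (1 - 'X_i1)) ^+ i0 * Q).
  rewrite !(rmorphM, rmorphXn, rmorphB, rmorph1) /= !msym_var tpermL tpermR.
  rewrite /Q msym_prod_other; first by rewrite [_ * 'X_i0]mulrC [(1 - 'X_i1) * _]mulrC.
  move=> j j0 j1; rewrite !(rmorphM, rmorphXn, rmorphB, rmorph1) /= !msym_var.
  by rewrite tpermD // eq_sym.
have -> : Kdelta = \prod_(j < n) ('X_j ^+ (n.-1 - j) * (1 - 'X_j) ^+ j).
  by rewrite /Kdelta xmonoE /one_minus -big_split.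
rewrite (bigD1 i0) //= (bigD1 i1) //= -/Q.
have -> : (n.-1 - i0 = (n.-1 - i1).+1)%N by have := ltn_ord i1; lia.
by rewrite e !exprMn !exprS; ring.
Qed.

(** By [Kdelta_split], the two sides differ by the transposition of two variables:
the factor 1 - x_j completes 1 - x_(j+1) to a symmetric product, and the
exponents s, t+1 with the factor x_j become s+1, t+1. *)
Lemma alt_swap (i0 i1 : 'I_n) H s t : i1 = i0.+1 :> nat ->
  msym (tperm i0 i1) H = H ->
  alt (Kdelta * (H * ('X_i0 ^+ s * 'X_i1 ^+ t.+1 * (1 - 'X_i0)))) =
  - alt (Kdelta * (H * ('X_i0 ^+ t * 'X_i1 ^+ s.+1 * (1 - 'X_i0)))).
Proof.
move=> e sH; have [D sD ->] := Kdelta_split e.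
have n01 : i0 != i1 by rewrite -val_eqE /= e; lia.
set u := (X in alt X = _); set v := (X in _ = - alt X).
suff -> : v = msym (tperm i0 i1) u.
  by rewrite alt_msym odd_tperm n01 expr1 scaleN1r opprK.
rewrite /u /v !(rmorphM, rmorphXn, rmorphB, rmorph1) /= sD sH !msym_var tpermL tpermR.
by rewrite !exprS; ring.
Qed.

Lemma one_minus_coef0 : one_minus@_0%MM = 1.
Proof.
rewrite /one_minus (rmorph_prod (mcoeff 0%MM)) big1 // => j _.
rewrite rmorphXn rmorphB /= mcoeff1 eqxx mcoeffX.
have -> : (U_(j)%MM == 0%MM :> 'X_{1..n}) = false by apply/eqP=> /mnmP/(_ j); rewrite mnm1E mnm0E eqxx.
by rewrite subr0 expr1n.
Qed.

Lemma low_coef (g m : 'X_{1..n}) : (mdeg m <= mdeg g)%N ->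
  ('X_[g] * one_minus)@_m = (g == m)%:R.
Proof.
move=> le; rewrite mulrC; have [e|ne] := eqVneq g m.
  by rewrite -e -[X in _@_X]addm0 mcoeffMX one_minus_coef0.
rewrite mcoeffM big1 // => -[k1 k2] /= /eqP E; rewrite mcoeffX.
case: eqP => [e|_]; last by rewrite mulr0.
have := congr1 (@mdeg n) E; rewrite mdegD -e => D.
have k0 : mdeg (k1 : 'X_{1..n}) == 0%N by lia.
by move: k0; rewrite mdeg_eq0 => /eqP k0; case/eqP: ne; rewrite E k0 add0m.
Qed.

Definition strict_mnm (m : 'X_{1..n}) := forall i j : 'I_n, (i < j)%N -> (m j < m i)%N.

Lemma strict_mnm_perm (g m : 'X_{1..n}) (w : 'S_n) : strict_mnm g -> strict_mnm m ->
  g = [multinom m (w i) | i < n] -> w = 1%g.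
Proof.
move=> sg sm E; have H (i j : 'I_n) : (i < j)%N -> (w i < w j)%N.
  move=> lt; have := sg _ _ lt; rewrite E !mnmE => h.
  rewrite ltnNge; apply/negP; rewrite leq_eqVlt => /predU1P[/val_inj e|/sm]; last by lia.
  by rewrite e ltnn in h.
suff W k : forall i : 'I_n, i = k :> nat -> w i = k :> nat.
  by apply/permP => i; rewrite perm1; apply: val_inj; apply: W.
have ge k' : forall i : 'I_n, i = k' :> nat -> (k' <= w i)%N.
  elim: k' => // k' IH i ei.
  have lt : (k' < n)%N by have := ltn_ord i; lia.
  by have := IH (Ordinal lt) erefl; have := H (Ordinal lt) i; rewrite /= ei => /(_ (ltnSn _)); lia.
have le d : forall i : 'I_n, (i + d.+1 = n)%N -> (w i + d.+1 <= n)%N.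
  elim: d => [|d IH] i ei; first by have := ltn_ord (w i); lia.
  have lt : (i.+1 < n)%N by lia.
  by have := IH (Ordinal lt); have := H i (Ordinal lt); rewrite /= => /(_ (ltnSn _)); lia.
move=> i ei; have := ge k i ei; have := le (n - i).-1 i; have := ltn_ord i; lia.
Qed.

(** In degree at most that of x^g, the factors 1 - x_j contribute only their
constant terms, and a strictly decreasing exponent vector is fixed by no
permutation except the identity. *)
Lemma alt_low_coef (g m : 'X_{1..n}) : strict_mnm g -> strict_mnm m ->
  (mdeg m <= mdeg g)%N -> (alt ('X_[g] * one_minus))@_m = (g == m)%:R.
Proof.
move=> sg sm le; rewrite /alt linear_sum /= (bigD1 1%g) //= msym1m odd_perm1 expr0 scale1r.
rewrite low_coef // big1 ?addr0 // => w w1.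
rewrite mcoeffZ mcoeff_sym low_coef ?mdeg_mperm //.
by case: eqP => [/(strict_mnm_perm sg sm)/eqP|_]; [rewrite (negbTE w1)|rewrite mulr0].
Qed.

Definition alternant (al : nat -> nat) := alt (Kdelta * xmono al).
Definition vdm := alt Kdelta.

Lemma alternantE al : alternant al = alt ('X_[[multinom (al i + (n.-1 - i))%N | i < n]] * one_minus).
Proof.
rewrite /alternant /Kdelta mulrAC -xmonoD; congr (alt (_ * _)); congr mpolyX.
by apply/mnmP => i; rewrite !mnmE addnC.
Qed.

Lemma delta_strict (al : nat -> nat) : (forall i j, (i <= j)%N -> (al j <= al i)%N) ->
  strict_mnm [multinom (al i + (n.-1 - i))%N | i < n].
Proof.
move=> h i j lt; rewrite !mnmE; have := h i j (ltnW lt); have := ltn_ord j; lia.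
Qed.

Lemma alternant_coef al be : (forall i j, (i <= j)%N -> (al j <= al i)%N) ->
  (forall i j, (i <= j)%N -> (be j <= be i)%N) ->
  (\sum_(i < n) be i <= \sum_(i < n) al i)%N ->
  (alternant al)@_[multinom (be i + (n.-1 - i))%N | i < n] = [forall i : 'I_n, al i == be i]%:R.
Proof.
move=> ha hb le; rewrite alternantE alt_low_coef; try exact: delta_strict; last first.
  rewrite !mdegE (eq_bigr (fun i : 'I_n => be i + (n.-1 - i))%N) => [|i _]; last by rewrite mnmE.
  rewrite [leqRHS](eq_bigr (fun i : 'I_n => al i + (n.-1 - i))%N) => [|i _]; last by rewrite mnmE.
  by rewrite !big_split /= leq_add2r.
congr (nat_of_bool _)%:R; apply/eqP/forallP => [/mnmP E i|E].
  by have := E i; rewrite !mnmE => /addIn->.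
by apply/mnmP => i; rewrite !mnmE (eqP (E i)).
Qed.

Lemma vdm_neq0 : vdm != 0.
Proof.
have -> : vdm = alternant (fun _ => 0%N).
  by rewrite /alternant /vdm (_ : xmono _ = 1) ?mulr1 // xmonoE big1.
apply/eqP => A0; have := @alternant_coef (fun _ => 0%N) (fun _ => 0%N) (fun _ _ _ => isT) (fun _ _ _ => isT) (leqnn _).
by rewrite A0 mcoeff0 (_ : [forall i, _] = true) //; apply/forallP.
Qed.

Definition upd (al : nat -> nat) j x y : nat -> nat :=
  fun i => if i == j then x else if i == j.+1 then y else al i.

Lemma xmono_upd al j x y (i0 i1 : 'I_n) : i0 = j :> nat -> i1 = j.+1 :> nat ->
  xmono (upd al j x y) = xmono (upd al j 0 0) * ('X_i0 ^+ x * 'X_i1 ^+ y).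
Proof.
move=> e0 e1; have n01 : i1 != i0 by rewrite -val_eqE /= e0 e1; lia.
rewrite !xmonoE (bigD1 i0) //= (bigD1 i1) //= [in RHS](bigD1 i0) //= [in RHS](bigD1 i1) //=.
rewrite /upd e0 e1 !eqxx (gtn_eqF (ltnSn j)) !expr0 !mul1r mulrA mulrC; congr (_ * _).
apply: eq_bigr => i; rewrite -!val_eqE /= e0 e1.
by move=> /andP[/negbTE-> /negbTE->].
Qed.

Lemma xmono_upd_sym al j (i0 i1 : 'I_n) : i0 = j :> nat -> i1 = j.+1 :> nat ->
  msym (tperm i0 i1) (xmono (upd al j 0 0)) = xmono (upd al j 0 0).
Proof.
move=> e0 e1; have n01 : i1 != i0 by rewrite -val_eqE /= e0 e1; lia.
rewrite !xmonoE (bigD1 i0) //= (bigD1 i1) //= /upd e0 e1 eqxx (gtn_eqF (ltnSn j)) eqxx !expr0 !mul1r.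
apply: msym_prod_other => i h0 h1.
by rewrite rmorphXn /= msym_var tpermD // eq_sym.
Qed.

(** The relation [alt_swap] in terms of exponents: the only linear relation between
alternants that is needed. *)
Lemma alternant_swap al j s t : (j.+1 < n)%N ->
  alternant (upd al j s t.+1) - alternant (upd al j s.+1 t.+1) =
  - (alternant (upd al j t s.+1) - alternant (upd al j t.+1 s.+1)).
Proof.
move=> jn; pose i0 := Ordinal (ltnW jn); pose i1 := Ordinal jn.
have := @alt_swap i0 i1 (xmono (upd al j 0 0)) s t erefl (@xmono_upd_sym al j i0 i1 erefl erefl).
have E p q : alternant (upd al j p q) = alt (Kdelta * (xmono (upd al j 0 0) * ('X_i0 ^+ p * 'X_i1 ^+ q))).
  by rewrite /alternant (@xmono_upd _ _ _ _ i0 i1).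
rewrite !E -!altB => H.
rewrite (_ : _ - _ = Kdelta * (xmono (upd al j 0 0) * ('X_i0 ^+ s * 'X_i1 ^+ t.+1 * (1 - 'X_i0)))); last first.
  by rewrite !exprS; ring.
rewrite H; congr (- alt _); rewrite !exprS; ring.
Qed.
End Alternant.

(** * Polynomials of finite tableaux *)

Local Open Scope ring_scope.

Section FiniteTableaux.
Local Open Scope nat_scope.
Variables N C n : nat.

(** A finite type, in order that sums over tableaux can be reindexed by
involutions. *)
Definition ftab := {set 'I_N * 'I_C * 'I_n}.

Definition tabf (T : ftab) : tab := fun r c a =>
  [exists v : 'I_N * 'I_C * 'I_n in T, [&& v.1.1 == r :> nat, v.1.2 == c :> nat & v.2 == a :> nat]].

Definition mkT (f : tab) : ftab := [set v : 'I_N * 'I_C * 'I_n | f v.1.1 v.1.2 v.2].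

Lemma tabf_mem T (v : 'I_N * 'I_C * 'I_n) : tabf T v.1.1 v.1.2 v.2 = (v \in T).
Proof.
apply/existsP/idP => [[w /and4P[wT /eqP e1 /eqP e2 /eqP e3]]|vT].
  by case: v e1 e2 e3 => -[v1 v2] v3 /=; case: w wT => -[w1 w2] w3 /= wT /val_inj <- /val_inj <- /val_inj <-.
by exists v; rewrite vT !eqxx.
Qed.

Lemma tabf_bound T r c a : tabf T r c a -> [&& r < N, c < C & a < n].
Proof. by case/existsP => v /and4P[_ /eqP<- /eqP<- /eqP<-]; rewrite !ltn_ord. Qed.

Lemma tabf_mk (f : tab) : (forall r c a, f r c a -> [&& r < N, c < C & a < n]) -> tabf (mkT f) = f.
Proof.
move=> h; apply/funext => r; apply/funext => c; apply/funext => a.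
apply/idP/idP => [/existsP[v /and4P[+ /eqP<- /eqP<- /eqP<-]]|fr]; first by rewrite inE.
have /and3P[h1 h2 h3] := h _ _ _ fr.
by apply/existsP; exists (Ordinal h1, Ordinal h2, Ordinal h3); rewrite inE /= fr !eqxx.
Qed.

Lemma tabf_inj : injective tabf.
Proof. by move=> T T' E; apply/setP => v; rewrite -!tabf_mem E. Qed.

Definition tabsize (f : tab) := \sum_(l < n) cont N C f l.

Lemma renorm_tabf sg kp (T : ftab) S xs ys a : row_shape N C kp -> a.+1 < n ->
  let g := renorm C a S xs ys (tabf T) in tableau sg kp g -> tabf (mkT g) = g.
Proof.
move=> Hkp an g Tg; apply: tabf_mk => r c l gl.
have /andP[-> ->] := tab_bound Hkp Tg gl => /=; move: gl; rewrite /g /renorm.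
do 2! [case: ifP => [/andP[_ /eqP->] _|_]; first lia].
by case/tabf_bound/and3P.
Qed.
End FiniteTableaux.

Section Symmetry.
Import fingroup perm mpoly.
Variables N C n : nat.
Variables sg kp : nat -> nat.
Hypotheses (Hsg : row_shape N C sg) (Hkp : row_shape N C kp).

Definition is_tab (T : ftab N C n) : bool := `[< tableau sg kp (tabf T) >].

(** The sign is that of the degree; normalizing it by the size of the shape, as in
Grothendieck polynomials, is left to [groth_trunc]. *)
Definition tab_poly : mpoly n int :=
  \sum_(T : ftab N C n | is_tab T) (-1) ^+ tabsize N C n (tabf T) *: xmono n (cont N C (tabf T)).

Lemma msym_xmono (s : 'S_n) g : msym s (xmono n g) = xmono n (fun j => if insub j is Some i then g ((s^-1)%g i) else 0%N).
Proof.
rewrite /xmono msymX; congr mpolyX; apply/mnmP => i; rewrite !mnmE.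
by rewrite valK.
Qed.

Lemma tab_poly_adj (i0 i1 : 'I_n) : i1 = i0.+1 :> nat -> msym (tperm i0 i1) tab_poly = tab_poly.
Proof.
move=> e; rewrite /tab_poly rmorph_sum /=.
pose h (T : ftab N C n) : ftab N C n := if is_tab T then mkT N C n (bender_knuth C i0 (tabf T)) else T.
have an : (i0.+1 < n)%N by rewrite -e.
have hE T : is_tab T -> tabf (h T) = bender_knuth C i0 (tabf T).
  move=> iT; rewrite /h iT; move/asboolP: iT => Tf.
  exact: (renorm_tabf (sg := sg) Hkp an (bk_tableau i0 Hsg Hkp Tf)).
have hT T : is_tab (h T) = is_tab T.
  case iT: (is_tab T); last by rewrite /h iT.
  move/asboolP: (iT) => Tf; apply/asboolP; rewrite hE //.
  exact: (bk_tableau i0 Hsg Hkp Tf).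
have hK : involutive h.
  move=> T; case iT: (is_tab T); last by rewrite {2}/h iT /h iT.
  apply: (@tabf_inj N C n); rewrite hE ?hT // hE //.
  by move/asboolP: iT => Tf; apply: (bkK i0 Hsg Hkp Tf).
rewrite [RHS](reindex_inj (inv_inj hK)) /=.
apply: eq_big => [T|T iT]; first by rewrite hT.
have Tf : tableau sg kp (tabf T) by apply/asboolP.
rewrite msymZ msym_xmono hE //.
have E (i : 'I_n) : cont N C (bender_knuth C i0 (tabf T)) i = cont N C (tabf T) (tperm i0 i1 i).
  case: tpermP => [->|->|/eqP n0 /eqP n1].
  - by rewrite (bk_cont_a i0 Hsg Hkp Tf) e.
  - by rewrite e (bk_cont_b i0 Hsg Hkp Tf).
  - by apply: renorm_wcont_other; rewrite -?e ?val_eqE.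
congr (_ *: _).
  congr (_ ^+ _); rewrite /tabsize [LHS](reindex_inj (perm_inj (s := tperm i0 i1))) /=.
  by apply: eq_bigr => i _; rewrite E.
by apply: eq_xmono => i lt; rewrite insubT /= tpermV -E.
Qed.

(** A transposition of distant points is conjugate to one of closer points by an
adjacent transposition. *)
Lemma adj_generate (P : 'S_n -> Prop) : P 1%g -> (forall s t, P s -> P t -> P (s * t)%g) ->
  (forall i0 i1 : 'I_n, i1 = i0.+1 :> nat -> P (tperm i0 i1)) -> forall s, P s.
Proof.
move=> P1 PM Padj.
have Pt d (i j : 'I_n) : (j = i + d.+1 :> nat)%N -> P (tperm i j).
  elim: d i j => [|d IH] i j e; first by apply: Padj; rewrite e addn1.
  have lt : (i + d.+1 < n)%N by have := ltn_ord j; lia.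
  pose k := Ordinal lt.
  have -> : tperm i j = (tperm k j * tperm i k * tperm k j)%g.
    rewrite -[tperm k j in X in (X * _)%g]tpermV -mulgA -conjgE tpermJ tpermL tpermD //.
      by rewrite -val_eqE /=; lia.
    by rewrite -val_eqE /=; lia.
  have Pk : P (tperm k j) by apply: Padj; rewrite e /= addnS.
  exact: (PM _ _ (PM _ _ Pk (IH i k erefl)) Pk).
have Pt' (i j : 'I_n) : P (tperm i j).
  case: (ltngtP i j) => [lt|lt|/val_inj ->]; last by rewrite tperm1.
    by apply: (Pt (j - i).-1); lia.
  by rewrite tpermC; apply: (Pt (i - j).-1); lia.
move=> s; case: (prod_tpermP s) => ts -> _; elim: ts => [|t ts IH]; first by rewrite big_nil.
by rewrite big_cons; apply: PM.
Qed.

Lemma tab_poly_sym (s : 'S_n) : msym s tab_poly = tab_poly.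
Proof.
apply: (adj_generate (P := fun s => msym s tab_poly = tab_poly)) => [|u v pu pv|].
- exact: msym1m.
- by rewrite msymMm pu.
- exact: tab_poly_adj.
Qed.
End Symmetry.

(** * Cancellation of the tableaux that violate the lattice condition *)

Local Open Scope ring_scope.

Definition lattice N C (J : nat -> bool) (f : tab) : Prop :=
  forall r c b, J b -> ~~ viol N C f r c b.

Section FirstViolationExists.
Local Open Scope nat_scope.
Variables (N C n : nat) (sg kp : nat -> nat) (J : nat -> bool).
Hypotheses (Hkp : row_shape N C kp) (Jn : forall b, J b -> b.+1 < n).

Definition isfirst (f : tab) (v : 'I_N * 'I_C * 'I_n) : bool :=
  J v.2 && `[< first_violation N C sg kp J v.1.1 v.1.2 v.2 f >].

Lemma isfirst_uniq f v w : isfirst f v -> isfirst f w -> v = w.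
Proof.
case: v w => [[r c] a] [[r' c'] a'] /andP[/= Ja /asboolP[_ v nv nv']] /andP[/= Ja' /asboolP[_ w nw nw']].
have n1 : ~~ bef r' c' r c by apply/negP => h; have := nw _ _ _ Ja h; rewrite v.
have n2 : ~~ bef r c r' c' by apply/negP => h; have := nv _ _ _ Ja' h; rewrite w.
have [er ec] : r = r' :> nat /\ c = c' :> nat by move: n1 n2; rewrite /bef; lia.
have n3 : ~~ (a < a') by apply/negP => h; have := nv' _ Ja' h; rewrite er ec w.
have n4 : ~~ (a' < a) by apply/negP => h; have := nw' _ Ja h; rewrite -er -ec v.
by congr (_, _, _); apply: val_inj => //=; lia.
Qed.

Lemma isfirst_ex f : tableau sg kp f -> (forall r c l, f r c l -> l < n) ->
  ~ lattice N C J f -> exists v, isfirst f v.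
Proof.
move=> Tf fn nl.
pose P (v : 'I_N * 'I_C * 'I_n) := J v.2 && viol N C f v.1.1 v.1.2 v.2.
have loc r c b : J b -> viol N C f r c b -> exists v, [/\ P v, v.1.1 = r :> nat, v.1.2 = c :> nat & v.2 = b :> nat].
  move=> Jb vb; have /andP[fb _] := vb; have /andP[h1 h2] := tab_bound Hkp Tf fb.
  have h3 := ltnW (Jn Jb).
  by exists (Ordinal h1, Ordinal h2, Ordinal h3); rewrite /P /= Jb.
have [v Pv] : exists v, P v.
  apply: contrapT => no; apply: nl => r c b Jb; apply/negP => vb.
  by have [v [Pv _ _ _]] := loc _ _ _ Jb vb; apply: no; exists v.
pose k1 (v : 'I_N * 'I_C * 'I_n) := v.1.1 * C + (C - v.1.2.+1).
case: (arg_minnP (fun v => k1 v * n + (n - v.2.+1)) Pv) => -[[r c] a] /andP[/= Ja va] M.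
exists (r, c, a); rewrite /isfirst /= Ja; apply/asboolP; split=> //.
- move=> r' c' b Jb bf; apply/negP => vb.
  have [w [Pw e1 e2 e3]] := loc _ _ _ Jb vb; have := M _ Pw; rewrite /k1 /= e1 e2 e3.
  have lt : r' * C + (C - c'.+1) < r * C + (C - c.+1).
    have := ltn_ord w.1.2; rewrite e2 => cC.
    move: bf; rewrite /bef => /orP[lt|/andP[/eqP -> lt]]; last by rewrite ltn_add2l; lia.
    have : r'.+1 * C <= r * C by rewrite leq_mul2r lt orbT.
    by rewrite mulSn; lia.
  have : (r' * C + (C - c'.+1)).+1 * n <= (r * C + (C - c.+1)) * n by rewrite leq_mul2r lt orbT.
  by have := Jn Jb; rewrite mulSn; lia.
- move=> b Jb lt; apply/negP => vb.
  have [w [Pw e1 e2 e3]] := loc _ _ _ Jb vb; have := M _ Pw; rewrite /k1 /= e1 e2 e3.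
  by have := Jn Jb; rewrite leq_add2l; lia.
Qed.
End FirstViolationExists.

Section Cancel.
Import fingroup perm mpoly.
Variables (p m N C : nat) (sg kp : nat -> nat) (al : nat -> nat).
Hypotheses (Hsg : row_shape N C sg) (Hkp : row_shape N C kp).
Let n := (p + m)%N.

(** The letters below m are attached to the last m variables, and the other p
letters to the first p variables; [letter_of] and [var_of] are inverse to each
other. *)
Definition letter_of j := (if j < p then m + j else j - p)%N.
Definition var_of a := (if a < m then p + a else a - m)%N.

(** The pairs (b, b+1) inside one block: their variables are adjacent too. *)
Definition block_pair b := ((b.+1 != m) && (b.+1 < p + m))%N.

Hypothesis al_inv : forall j, (j.+1 < n)%N -> j.+1 != p -> al j = al j.+1.

Definition varexp (f : tab) j := cont N C f (letter_of j).
Definition tab_term (f : tab) : mpoly.mpoly n int :=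
  (-1) ^+ tabsize N C n f *: alternant n (fun j => al j + varexp f j)%N.

Lemma var_ofP a : block_pair a -> [/\ ((var_of a).+1 < n)%N, letter_of (var_of a) = a, letter_of (var_of a).+1 = a.+1,
  al (var_of a) = al (var_of a).+1 & forall i, (i < n)%N -> i != var_of a -> i != (var_of a).+1 -> letter_of i != a /\ letter_of i != a.+1].
Proof.
move=> /andP[am an].
have E : var_of a = (if a < m then p + a else a - m)%N by [].
have h : ((var_of a).+1 < n)%N by rewrite E /n; case: (ltnP a m); lia.
have h' : (var_of a).+1 != p by rewrite E; case: (ltnP a m); lia.
split=> //; last move=> i lt i1 i2; rewrite /letter_of; last 1 first.
- by move: i1 i2 lt; rewrite E /n; case: (ltnP a m) => h1 i1 i2 lt; split; case: ifP; lia.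
- by rewrite E; case: (ltnP a m) => h1; case: ifP; lia.
- by rewrite E; case: (ltnP a m) => h1; case: ifP; lia.
- exact: al_inv.
Qed.

Lemma eq_alternant (be be' : nat -> nat) : (forall i, (i < n)%N -> be i = be' i) -> alternant n be = alternant n be'.
Proof. by move=> E; rewrite /alternant (eq_xmono E). Qed.

(** The exponents of a tableau g that has the contents of f except for a and a+1. *)
Lemma alternant_two a (f g : tab) x y : block_pair a ->
  (forall l, (l < n)%N -> l != a -> l != a.+1 -> cont N C g l = cont N C f l) ->
  cont N C g a = x -> cont N C g a.+1 = y ->
  alternant n (fun j => al j + varexp g j)%N =
  alternant n (upd (fun j => al j + varexp f j)%N (var_of a) (al (var_of a) + x) (al (var_of a) + y)).
Proof.
move=> Ja E <- <-; have [jn e1 e2 e3 e4] := var_ofP Ja; apply: eq_alternant => i lt.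
rewrite /upd /varexp; case: eqVneq => [->|n1]; first by rewrite e1.
case: eqVneq => [->|n2]; first by rewrite e2 -e3.
have [h1 h2] := e4 _ lt n1 n2; rewrite E // /letter_of /n.
by move: lt; rewrite /n; case: (ltnP i p); lia.
Qed.

Lemma tabsize_two a (f g : tab) d : block_pair a ->
  (forall l, (l < n)%N -> l != a -> l != a.+1 -> cont N C g l = cont N C f l) ->
  (cont N C g a + cont N C g a.+1 = cont N C f a + cont N C f a.+1 + d)%N ->
  (tabsize N C n g = tabsize N C n f + d)%N.
Proof.
move=> /andP[_ an] E H; have an' : (a < n)%N by rewrite /n; lia.
pose i0 : 'I_n := Ordinal an'; pose i1 : 'I_n := Ordinal an.
have n01 : i1 != i0 by rewrite -val_eqE /=; lia.
have S h : (tabsize N C n h = cont N C h a + cont N C h a.+1 +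
    \sum_(l < n | (l != i0) && (l != i1)) cont N C h l)%N.
  by rewrite /tabsize (bigD1 i0) //= (bigD1 i1) //= addnA.
rewrite !S H addnAC; congr (_ + _ + _)%N.
by apply: eq_bigr => l /andP[h1 h2]; apply: E.
Qed.

Lemma int_poly_opp (P : mpoly.mpoly n int) : P = - P -> P = 0.
Proof.
move=> E; apply/mpoly.mpolyP => k; rewrite mpoly.mcoeff0.
by have := congr1 (mpoly.mcoeff k) E; rewrite mpoly.mcoeffN; lia.
Qed.

Let X := ftab N C n.

(** With h the common value of [al] at the two variables, and u, v the numbers of a
and a+1 in a tight tableau, the toggle turns A(h+u, h+v) into A(h+u+1, h+v) with
the opposite sign, and the exchange replaces (u, v) by (v-1, u+1).  By
[alternant_swap] the four terms cancel. *)
Lemma first_cancel (v : 'I_N * 'I_C * 'I_n) :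
  \sum_(T : X | isfirst sg kp block_pair (tabf T) v) tab_term (tabf T) = 0.
Proof.
case: v => [[r0 c0] a]; have [Ja|nJ] := boolP (block_pair a); last first.
  by apply: big1 => T; rewrite /isfirst /= (negbTE nJ).
have an : (a.+1 < n)%N by case/andP: Ja.
pose fst_ f := first_violation N C sg kp block_pair r0 c0 a f.
have isfE (T : X) : isfirst sg kp block_pair (tabf T) (r0, c0, a) = `[< fst_ (tabf T) >].
  by rewrite /isfirst /= Ja.
pose tgt := tight C r0 c0 a.
pose mtg (T : X) : X := if `[< fst_ (tabf T) >] then mkT N C n (toggle_first C r0 c0 a (tabf T)) else T.
pose msw (T : X) : X := if `[< fst_ (tabf T) >] && tgt (tabf T) then mkT N C n (swap_rest C r0 c0 a (tabf T)) else T.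
have tabtg T : fst_ (tabf T) -> tabf (mtg T) = toggle_first C r0 c0 a (tabf T).
  move=> h; rewrite /mtg asboolT //.
  have [[Tg _ _ _] _ _ _ _] := toggle_first_spec Hsg Hkp Ja h.
  exact: (renorm_tabf (sg := sg) Hkp an Tg).
have tabsw T : fst_ (tabf T) -> tgt (tabf T) -> tabf (msw T) = swap_rest C r0 c0 a (tabf T).
  move=> h ht; rewrite /msw asboolT // ht.
  have [[Tg _ _ _] _ _ _ _] := swap_rest_spec Hsg Hkp Ja h ht.
  exact: (renorm_tabf (sg := sg) Hkp an Tg).
have mtgK : involutive mtg.
  move=> T; have [h|h] := pselect (fst_ (tabf T)); last by rewrite /mtg (asboolF h) (asboolF h).
  have [h1 _ h2 _ _] := toggle_first_spec Hsg Hkp Ja h.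
  by apply: (@tabf_inj N C n); rewrite tabtg tabtg.
have mswK : involutive msw.
  move=> T; have [h|h] := pselect (fst_ (tabf T)); last by rewrite /msw !(asboolF h).
  have [ht|/negbTE ht] := boolP (tgt (tabf T)); last by rewrite /msw ht !andbF ht !andbF.
  have [h1 h2 h3 _ _] := swap_rest_spec Hsg Hkp Ja h ht.
  by apply: (@tabf_inj N C n); rewrite tabsw tabsw.
rewrite (eq_bigl _ _ isfE) (bigID (fun T : X => tgt (tabf T))) /=.
rewrite [X in _ + X](reindex_inj (inv_inj mtgK)) /=.
rewrite [X in _ + X](eq_bigl (fun T : X => `[< fst_ (tabf T) >] && tgt (tabf T))); last first.
  move=> T; have [h|h] := pselect (fst_ (tabf T)); last first.
    by rewrite /mtg (asboolF h) /= (asboolF h).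
  have [h1 h2 _ _ _] := toggle_first_spec Hsg Hkp Ja h.
  by rewrite tabtg // !asboolT // /tgt h2 negbK.
(* B + B = 0 for the sum B of the terms of the tight tableaux and their toggles *)
rewrite -big_split /=; apply: int_poly_opp.
rewrite {1}(reindex_inj (inv_inj mswK)) /= -sumrN; apply: eq_big.
  move=> T; have [h|h] := pselect (fst_ (tabf T)); last by rewrite /msw (asboolF h) /= (asboolF h).
  have [ht|/negbTE ht] := boolP (tgt (tabf T)); last by rewrite /msw ht !andbF ht !andbF.
  have [h1 h2 _ _ _] := swap_rest_spec Hsg Hkp Ja h ht.
  by rewrite tabsw // !asboolT // h2.
move=> T /andP[].
have [h|h] := pselect (fst_ (tabf T)); last by rewrite /msw (asboolF h) /= (asboolF h).
have [ht|/negbTE ht] := boolP (tgt (tabf T)); last by rewrite /msw ht andbF /= ht.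
have [S1 S2 _ S4 S5] := swap_rest_spec Hsg Hkp Ja h ht.
have [T1 T2 _ T4 T5] := toggle_first_spec Hsg Hkp Ja h.
rewrite tabtg // tabsw // => _ _.
rewrite tabtg ?tabsw //.
have [U1 U2 _ U4 U5] := toggle_first_spec Hsg Hkp Ja S1.
have {}T4 := T4 ht; have {}U4 := U4 S2.
set f := tabf T in S1 S2 S4 S5 T1 T2 T4 T5 U1 U2 U4 U5 *.
set g := swap_rest C r0 c0 a f in S1 S2 S4 S5 U1 U2 U4 U5 *.
have Eg l : (l < n)%N -> l != a -> l != a.+1 -> cont N C g l = cont N C f l.
  by move=> _; apply: swap_rest_other.
have Etf l : (l < n)%N -> l != a -> l != a.+1 -> cont N C (toggle_first C r0 c0 a f) l = cont N C f l.
  by move=> _; apply: toggle_first_other.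
have Etg l : (l < n)%N -> l != a -> l != a.+1 -> cont N C (toggle_first C r0 c0 a g) l = cont N C f l.
  by move=> ln l1 l2; rewrite toggle_first_other // Eg.
have Zg := tabsize_two (d := 0) Ja Eg ltac:(lia).
have Ztf := tabsize_two (d := 1) Ja Etf ltac:(lia).
have Ztg := tabsize_two (d := 1) Ja Etg ltac:(lia).
rewrite /tab_term Zg Ztf Ztg !addn0 addn1 exprS mulN1r !scaleNr.
have [jn _ _ _ _] := var_ofP Ja.
rewrite (alternant_two Ja (f := f) (fun _ _ _ _ => erefl) erefl erefl).
rewrite (alternant_two Ja Eg erefl erefl) (alternant_two Ja Etf erefl erefl) (alternant_two Ja Etg erefl erefl).
rewrite S5 T4 T5 U4 U5 S5 S4 !addn1 !addnS.
have -> : (al (var_of a) + cont N C f a.+1 = (al (var_of a) + cont N C g a).+1)%N by lia.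
rewrite -!scalerBr -scalerN; congr (_ *: _).
by rewrite alternant_swap // opprK.
Qed.

(** Each tableau that is not lattice has exactly one first violation, and the
tableaux with a given one cancel by [first_cancel]. *)
Lemma lattice_cancellation :
  \sum_(T : X | is_tab sg kp T) tab_term (tabf T) =
  \sum_(T : X | is_tab sg kp T && `[< lattice N C block_pair (tabf T) >]) tab_term (tabf T).
Proof.
rewrite (bigID (fun T : X => `[< lattice N C block_pair (tabf T) >])) /=.
rewrite [X in _ + X](_ : _ = 0) ?addr0 //.
have E (T : X) : is_tab sg kp T && ~~ `[< lattice N C block_pair (tabf T) >] ->
    tab_term (tabf T) = \sum_(v : 'I_N * 'I_C * 'I_n | isfirst sg kp block_pair (tabf T) v) tab_term (tabf T).
  move=> /andP[/asboolP Tf /asboolP nl].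
  have [|r c l|v fv] := isfirst_ex Hkp (n := n) (J := block_pair) _ Tf _ nl.
  - by move=> b /andP[].
  - by move=> /tabf_bound/and3P[].
  rewrite (big_pred1 v) // => w; apply/idP/eqP => [fw|->//]; exact: isfirst_uniq fw fv.
rewrite (eq_bigr _ E) (exchange_big_dep xpredT) //= big1 // => v _.
rewrite -[RHS](first_cancel v); apply: eq_bigl => T.
apply/andP/idP => [[]//|fv]; split=> //.
case/andP: fv => Jv /asboolP[Tf vv _ _]; apply/andP; split; first exact/asboolP.
by apply/asboolP => L; have := L v.1.1 v.1.2 _ Jv; rewrite vv.
Qed.
End Cancel.

(** * Lattice tableaux in two blocks of letters *)

Local Open Scope nat_scope.

Lemma rk_lt_down (P : nat -> bool) C c : (forall i j, i < j -> P j -> P i) ->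
  (forall i, P i -> i < C) -> (c < rk P C) = P c.
Proof.
move=> down bd; case Pc: (P c).
  have cC := bd _ Pc; rewrite -(_ : rk P c.+1 = c.+1) ?rk_le //.
  rewrite /rk -[RHS]card_ord -sum1_card; apply: eq_bigr => -[i /= ic] _.
  by move: ic; rewrite ltnS leq_eqVlt => /predU1P[->|/down/(_ Pc)->]; rewrite ?Pc.
apply/negbTE; rewrite -leqNgt; elim: C {bd} => [|C IH]; first by rewrite /rk big_ord0.
rewrite rkS; case PC: (P C); last by rewrite addn0.
have [lt|ge] := ltnP c C; first by rewrite (down _ _ lt PC) in Pc.
(* the induction step needs c > C, as P holds at C but not at c *)
have ne : c != C by apply/eqP => e; rewrite e PC in Pc.
have : rk P C <= C by rewrite -[leqRHS]card_ord -sum1_card; apply: leq_sum => i _; case: (P i).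
lia.
Qed.

Lemma rk_initial x C : x <= C -> rk (fun c => c < x) C = x.
Proof.
move=> h; rewrite /rk -(subnKC h) big_split_ord /= [X in _ + X]big1 ?addn0.
  by rewrite -[RHS]card_ord -sum1_card; apply: eq_bigr => i _; rewrite ltn_ord.
by move=> i _; rewrite ltnNge leq_addr.
Qed.

Section LatticeRows.
Variables (N C : nat) (sg kp : nat -> nat) (f : tab) (M : nat).
Hypotheses (Hsg : row_shape N C sg) (Hkp : row_shape N C kp) (Tf : tableau sg kp f).

Lemma wcont_pos B l : 0 < wcont N C B f l -> exists r c, B r c /\ f r c l.
Proof.
move=> h; apply: contrapT => no; move: h; rewrite /wcont big1 // => r _.
rewrite big1 // => c _; apply/eqP; rewrite eqb0; apply/negP => /andP[h1 h2].
by apply: no; exists r, c.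
Qed.

(** The first b+1 that is read follows some b, which is in a higher row because rows
increase weakly. *)
Lemma lattice_row : (forall r c b, b.+1 < M -> ~~ viol N C f r c b) ->
  forall b r c, b < M -> f r c b -> b <= r.
Proof.
move=> nv; elim=> [|b IH] r c bM fb //.
have := nv r c b bM; rewrite /viol fb /= -ltnNge => lt.
have [r' [c' [B fa]]] := wcont_pos (leq_ltn_trans (leq0n _) lt).
have := IH r' c' (ltnW bM) fa; move: B; rewrite /bef => /orP[]; first lia.
move=> /andP[/eqP e lt']; rewrite e in fa.
by have := tab_row Tf fb fa lt'; lia.
Qed.

(** A letter b occurs at most once in each column, and a column that contains it in
row b or lower meets row b of the outer shape. *)
Lemma cont_le_row b : (forall r c, f r c b -> b <= r) -> cont N C f b <= kp b.
Proof.
move=> h; case: (Tf) => sup _ _ _.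
rewrite /cont /wcont exchange_big /=.
apply: (@leq_trans (\sum_(c < C) (c < kp b))).
  apply: leq_sum => c _; case cb: (c < kp b).
    have U r r' : f r c b -> f r' c b -> r = r'.
      move=> f1 f2; case: (ltngtP r r') => // lt; [have := tab_col Hsg Hkp Tf f1 f2 lt | have := tab_col Hsg Hkp Tf f2 f1 lt]; lia.
    suff : rk (fun r => f r c b) N <= 1 by [].
    elim: N => [|k IH]; first by rewrite /rk big_ord0.
    rewrite rkS; case fk: (f k c b); last by lia.
    suff -> : rk (fun r => f r c b) k = 0 by [].
    rewrite /rk big1 // => -[j jk] _ /=; apply/eqP; rewrite eqb0; apply/negP => fj.
    by have := U _ _ fj fk; lia.
  rewrite leqn0; apply/eqP; rewrite big1 // => r _; apply/eqP; rewrite eqb0 /=; apply/negP => fr.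
  have := h _ _ fr => /(shape_le Hkp); have := sup _ _ _ fr; lia.
have kC : kp b <= C by case: Hkp.
by rewrite -/(rk (fun c => c < kp b) C) rk_initial.
Qed.
End LatticeRows.

(** The rook-strip condition on lam/sig, in terms of row lengths. *)
Definition strip (lam sig : nat -> nat) : Prop :=
  [/\ forall r, lam r <= (sig r).+1 &
      forall r, sig r < lam r -> sig r.+1 < lam r.+1 -> sig r != sig r.+1].

(** A straight tableau that is lattice in both blocks is cut into the letters below
m and the others. *)
Section Split.
Variables (N C m p : nat) (kp : nat -> nat).
Hypotheses (Hkp : row_shape N C kp) (Nm : N <= m).
Let zero := fun _ : nat => 0.

Lemma shape0 : row_shape N C zero. Proof. by []. Qed.

Section Take.
Variable f : tab.
Hypotheses (Tf : tableau zero kp f) (fp : forall r c a, f r c a -> a < p + m).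
Hypothesis Lf : lattice N C (block_pair p m) f.

(** By [small_row], a box in row r contains a letter below m exactly if it contains
r. *)
Definition low_rows r := rk (fun c => f r c r) C.
Definition has_high r c := [exists a : 'I_p, f r c (m + a)].

(** Row lengths of the part where all letters are below m. *)
Definition only_low_rows r := rk (fun c => f r c r && ~~ has_high r c) C.
Definition high_part : tab := fun r c a => f r c (m + a).

Lemma straight_ge r c b : f r c b -> r <= b.
Proof.
case: (Tf) => sup ne _ col; elim: r b => // r IH b fb.
have [d fd] : exists d, f r c d.
  by apply: ne; have := sup _ _ _ fb; have [h _ _] := Hkp; have := h r; rewrite /zero; lia.
by have := IH _ fd; have := col _ _ _ _ fd fb; lia.
Qed.

(** Column strictness forces the letters of row r to be at least r, and the lattice
condition forces the small ones to be at most r. *)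
Lemma small_row r c b : f r c b -> b < m -> b = r.
Proof.
move=> fb bm; have := straight_ge fb.
suff : b <= r by lia.
apply: (lattice_row (M := m) Tf _ bm fb) => r' c' b' lt.
by apply: Lf; rewrite /block_pair; lia.
Qed.

Lemma rowN r c b : f r c b -> r < m.
Proof. by move/(tab_bound Hkp Tf); lia. Qed.

Lemma letter_cases r c b : f r c b -> b = r \/ exists2 a, a < p & b = m + a.
Proof.
move=> fb; have [lt|ge] := ltnP b m; first by left; exact: small_row fb lt.
by right; exists (b - m); have := fp fb; lia.
Qed.

Lemma has_highP r c a : f r c (m + a) -> has_high r c.
Proof.
move=> fa; have ap : a < p by have := fp fa; lia.
by apply/existsP; exists (Ordinal ap).
Qed.

Lemma low_rowsE r c : (c < low_rows r) = f r c r.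
Proof.
apply: rk_lt_down => [i j lt fj|i /(tab_bound Hkp Tf)]; last by lia.
have [d fd] : exists d, f r i d.
  by case: (Tf) => sup ne _ _; apply: ne; have := sup _ _ _ fj; rewrite /zero; lia.
by have := tab_row Tf fd fj lt; have := rowN fj; case: (letter_cases fd) => [e|[a _ e]]; [by rewrite -{4}e|lia].
Qed.

Lemma only_low_rowsE r c : (c < only_low_rows r) = f r c r && ~~ has_high r c.
Proof.
apply: rk_lt_down => [i j lt /andP[fj nb]|i /andP[/(tab_bound Hkp Tf)+ _]]; last by lia.
apply/andP; split; first by move: fj; rewrite -!low_rowsE; lia.
apply/negP => /existsP[a fa]; have := tab_row Tf fa fj lt; have := rowN fj; lia.
Qed.

Lemma sig_le_lam r : only_low_rows r <= low_rows r.
Proof.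
case: (leqP (only_low_rows r) (low_rows r)) => // lt.
by move: (lt); rewrite only_low_rowsE -low_rowsE ltnn.
Qed.

Lemma lam_le_kp r : low_rows r <= kp r.
Proof.
case: (leqP (low_rows r) (kp r)) => // lt; move: (lt); rewrite low_rowsE.
by case: (Tf) => sup _ _ _ /sup; lia.
Qed.

Lemma above_small r c : f r.+1 c r.+1 -> f r c r && ~~ has_high r c.
Proof.
move=> fb; case: (Tf) => sup ne _ col.
have [d fd] : exists d, f r c d.
  by apply: ne; have := sup _ _ _ fb; have [h _ _] := Hkp; have := h r; rewrite /zero; lia.
have lt := col _ _ _ _ fd fb; have := rowN fb => rm.
apply/andP; split; first by case: (letter_cases fd) => [e|[a _ e]]; [rewrite -{2}e|lia].
by apply/negP => /existsP[a fa]; have := col _ _ _ _ fa fb; lia.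
Qed.

Lemma lam_shape : row_shape N C low_rows.
Proof.
have [h1 h2 h3] := Hkp; split=> r.
- case: (leqP (low_rows r.+1) (low_rows r)) => // lt; move: (lt); rewrite low_rowsE => /above_small.
  by rewrite -low_rowsE ltnn.
- by move=> /h2 e; have := lam_le_kp r; lia.
- by have := h3 r; have := lam_le_kp r; lia.
Qed.

Lemma sig_shape : row_shape N C only_low_rows.
Proof.
have [h1 h2 h3] := lam_shape; split=> r.
- case: (leqP (only_low_rows r.+1) (only_low_rows r)) => // lt; move: (lt); rewrite only_low_rowsE => /andP[/above_small].
  by rewrite -only_low_rowsE ltnn.
- by move=> /h2 e; have := sig_le_lam r; lia.
- by have := h3 r; have := sig_le_lam r; lia.
Qed.

(** A box with small and large letters has only large letters to its right and
below it. *)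
Lemma lam_sig_strip : strip low_rows only_low_rows.
Proof.
have B r c : only_low_rows r <= c -> c < low_rows r -> has_high r c.
  by rewrite leqNgt only_low_rowsE low_rowsE => + fr; rewrite fr /= negbK.
split=> r.
  rewrite leqNgt; apply/negP => lt.
  have := B r (only_low_rows r) (leqnn _) (ltnW lt) => /existsP[a fa].
  by move: lt; rewrite low_rowsE => fr; have := tab_row Tf fa fr (ltnSn _); have := rowN fr; lia.
move=> h1 h2; apply/eqP => e.
have /existsP[a fa] := B _ _ (leqnn _) h1; move: h2; rewrite -e low_rowsE => fr.
by case: (Tf) => _ _ _ col; have := col _ _ _ _ fa fr; have := rowN fr; lia.
Qed.

Lemma hi_tableau : tableau only_low_rows kp high_part.
Proof.
case: (Tf) => sup ne row col; split.
- move=> r c a fa; have := sup _ _ _ fa.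
  suff : ~~ (c < only_low_rows r) by lia.
  by rewrite only_low_rowsE (has_highP fa) andbF.
- move=> r c /andP[h1 h2]; have [|b fb] := ne r c; first by rewrite /zero; lia.
  case: (letter_cases fb) => [e|[a _ e]]; last by exists a; rewrite /high_part -e.
  move: h1; rewrite leqNgt only_low_rowsE -{2}e fb /= negbK => /existsP[a fa]; by exists a.
- by move=> r c a b fa fb; have := row _ _ _ _ fa fb; lia.
- by move=> r c a b fa fb; have := col _ _ _ _ fa fb; lia.
Qed.

Lemma hi_lt r c a : high_part r c a -> a < p.
Proof. by move/fp; lia. Qed.

Lemma hi_viol r c b : viol N C high_part r c b = viol N C f r c (m + b).
Proof. by rewrite /viol /high_part -addnS. Qed.

Lemma hi_lattice r c b : ~~ viol N C high_part r c b.
Proof.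
case h: (high_part r c b.+1); last by rewrite /viol h.
by rewrite hi_viol; apply: Lf; have := hi_lt h; rewrite /block_pair; lia.
Qed.

Lemma cont_lo b : b < m -> cont N C f b = low_rows b.
Proof.
move=> bm; have E r c : f r c b -> r = b by move/small_row => /(_ bm).
have [bN|bN] := ltnP b N; last first.
  have [_ -> //] := lam_shape.
  rewrite /cont /wcont big1 // => r _; rewrite big1 // => c _.
  by apply/eqP; rewrite eqb0 /=; apply/negP => /E e; have := ltn_ord r; lia.
transitivity (wcont N C (fun r c => (r == b) && true) f b); last by rewrite (@wcont_row N C (fun _ => true) f b b bN).
by apply: eq_wcont => r c _ _; case fr: (f r c b); rewrite ?andbF ?(E _ _ fr) ?eqxx.
Qed.

(** The small letters are determined by the shape that they occupy. *)
Lemma split_unique r c a : f r c a =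
  if a < m then (a == r) && (c < low_rows r) else high_part r c (a - m).
Proof.
case: ltnP => am; last by rewrite /high_part subnKC.
by case: eqP => [->|ne]; [rewrite low_rowsE|apply/negP => /small_row/(_ am)].
Qed.
End Take.

Section Build.
Variables (lam sig : nat -> nat) (h : tab).
Hypotheses (Hlam : row_shape N C lam) (Hsig : row_shape N C sig).
Hypotheses (sl : forall r, sig r <= lam r) (lk : forall r, lam r <= kp r).
Hypotheses (st : strip lam sig) (Th : tableau sig kp h) (hp : forall r c a, h r c a -> a < p).
Hypothesis Lh : forall r c b, ~~ viol N C h r c b.

Definition glue : tab := fun r c a =>
  if a < m then (a == r) && (c < lam r) else h r c (a - m).

Lemma glueP r c a : glue r c a -> [/\ a < m, a = r & c < lam r] \/ [/\ m <= a & h r c (a - m)].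
Proof. by rewrite /glue; case: ltnP => am; [move=> /andP[/eqP]; left|right]. Qed.

Lemma glue_bound r c a : glue r c a -> [&& r < N, c < C & a < p + m].
Proof.
have [h1 h2 h3] := Hlam.
move=> /glueP[[am e lt]|[am hr]].
  have := h3 r; case: (ltnP r N) => [|/h2]; lia.
by have /andP[-> ->] := tab_bound Hkp Th hr; have := hp hr; lia.
Qed.

(** The rook-strip condition excludes a large letter left of a small one, or above
it. *)
Lemma glue_tableau : tableau zero kp glue.
Proof.
case: (Th) => sup ne row col; case: st => st1 st2; have [k1 k2 k3] := Hkp.
have lam_dec : forall r, lam r.+1 <= lam r by case: Hlam.
have sig_dec : forall r, sig r.+1 <= sig r by case: Hsig.
split.
- by move=> r c a /glueP[[_ _ lt]|[_ /sup]]; have := lk r; rewrite /zero; lia.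
- move=> r c /andP[_ ck]; have rN : r < N by case: (ltnP r N) => // /k2; lia.
  have rm : r < m by lia.
  have [cs|cs] := ltnP c (sig r).
    by exists r; rewrite /glue rm eqxx /=; have := sl r; lia.
  have [|a ha] := ne r c; first by lia.
  by exists (m + a); rewrite /glue ltnNge leq_addr /= addKn.
- move=> r c a b /glueP[[am e1 l1]|[am h1]] /glueP[[bm e2 l2]|[bm h2]]; try lia.
    by have := sup _ _ _ h1; have := st1 r; lia.
  by have := row _ _ _ _ h1 h2; lia.
- move=> r c a b /glueP[[am e1 l1]|[am h1]] /glueP[[bm e2 l2]|[bm h2]]; try lia.
    have := sup _ _ _ h1; have := st1 r; have := st1 r.+1; have := lam_dec r; have := sig_dec r => q1 q2 q3 q4 q5.
    by have /eqP := st2 r ltac:(lia) ltac:(lia); lia.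
  by have := col _ _ _ _ h1 h2; lia.
Qed.

Lemma glue_hi : high_part glue = h.
Proof.
apply/funext=> r; apply/funext=> c; apply/funext=> a.
by rewrite /high_part /glue ltnNge leq_addr /= addKn.
Qed.

Lemma glue_lattice : lattice N C (block_pair p m) glue.
Proof.
move=> r c b /andP[bm _]; have [le|gt] := ltnP b m; last first.
  by rewrite -(subnKC gt) -hi_viol glue_hi.
have {bm}lt : b.+1 < m by rewrite ltn_neqAle bm.
rewrite /viol {1}/glue lt; case: eqP => //= e; case: ltnP => //= cl; subst r.
rewrite -ltnNge.
have [_ l2 l3] := Hlam; have bN : b.+1 < N by case: (ltnP b.+1 N) => // /l2; lia.
have E1 : wcont N C (bef b.+1 c) glue b = lam b.
  have bN' : b < N by lia.
  have := @wcont_row N C (fun c => c < lam b) (fun _ _ _ => true) 0 b bN'.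
  under [X in _ = X]eq_bigr do rewrite andbT.
  rewrite -/(rk (fun c => c < lam b) C) rk_initial // => <-.
  apply: eq_wcont => r' c' _ _; rewrite /glue le andbT; case: eqVneq => [<-|]; last by rewrite !andbF.
  by rewrite /bef ltnSn.
have E2 : wcont N C (bef b.+1 c) glue b.+1 + 1 <= lam b.+1.
  have cC : c < C by have := l3 b.+1; lia.
  have := @wcont_row N C (fun c => c < lam b.+1) (fun _ _ _ => true) 0 b.+1 bN.
  under [X in _ = X]eq_bigr do rewrite andbT.
  rewrite -/(rk (fun c => c < lam b.+1) C) rk_initial // => <-.
  have := @wcont_pt N C (fun _ _ _ => true) 0 b.+1 c bN cC => /= <-.
  rewrite /wcont -big_split; apply: leq_sum => r' _; rewrite -big_split; apply: leq_sum => c' _ /=.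
  rewrite /glue lt; case: (eqVneq b.+1 r') => [<-|ne]; last first.
    by rewrite !andbF.
  rewrite /bef ltnn eqxx /= andbT; lia.
by have [l1 _ _] := Hlam; have := l1 b; lia.
Qed.
End Build.
End Split.

(** * Lattice tableaux on a rotated partition *)

Local Open Scope nat_scope.

Section Shift.
Variables (N C : nat).

(** Moving boxes one row down is injective, and it turns l into l'. *)
Lemma wcont_shift_down (B B' : nat -> nat -> bool) (f f' : tab) l l' :
  (forall r c, B r c -> f r c l -> B' r.+1 c /\ f' r.+1 c l') ->
  (forall c, f' N c l' = false) -> wcont N C B f l <= wcont N C B' f' l'.
Proof.
move=> H z; apply: (@leq_trans (\sum_(r < N) \sum_(c < C) (B' r.+1 c && f' r.+1 c l'))).
  apply: leq_sum => r _; apply: leq_sum => c _.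
  by case: (boolP (_ && _)) => // /andP[h1 h2]; have [-> ->] := H _ _ h1 h2.
have : \sum_(r < N.+1) \sum_(c < C) (B' r c && f' r c l') = wcont N C B' f' l'.
  rewrite big_ord_recr /= [X in _ + X]big1 ?addn0 // => c _; by rewrite z andbF.
by rewrite big_ord_recl /= => <-; rewrite leq_addl.
Qed.

Lemma wcont_shift_up (B B' : nat -> nat -> bool) (f f' : tab) l l' :
  (forall r c, B r.+1 c -> f r.+1 c l -> B' r c /\ f' r c l') ->
  (forall c, f 0 c l = false) -> wcont N C B f l <= wcont N C B' f' l'.
Proof.
move=> H z; rewrite /wcont; case: N => [|n]; first by rewrite !big_ord0.
rewrite big_ord_recl big_ord_recr /= [X in X + _ <= _]big1 ?add0n => [|c _]; last by rewrite z andbF.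
apply: leq_trans (leq_addr _ _); apply: leq_sum => r _; apply: leq_sum => c _.
rewrite /bump leq0n add1n.
by case: (boolP (_ && _)) => // /andP[h1 h2]; have [-> ->] := H _ _ h1 h2.
Qed.
End Shift.

Definition rect_rows P Q : nat -> nat := fun r => if r < P then Q else 0.

Lemma rect_shape P Q : row_shape P Q (rect_rows P Q).
Proof. split=> [r|r le|r]; rewrite /rect_rows.
- by case: (ltnP r P) => h; [rewrite (_ : _ <= Q) //; case: ifP|rewrite ifF //; lia].
- by rewrite ltnNge le.
- by case: ifP. Qed.

(** The complement in the rectangle with P rows and Q columns of the partition with
row lengths [sg]; [col_height c] is the height of its column c, so that column c
of the complement starts in that row. *)
Section Rotated.
Variables (P Q : nat) (sg : nat -> nat).
Hypothesis Hsg : row_shape P Q sg.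
Let kp := rect_rows P Q.

Definition col_height c := rk (fun r => c < sg r) P.

Lemma colhE c r : (r < col_height c) = (c < sg r).
Proof.
apply: rk_lt_down => [i j lt|i]; first by move/leq_trans; apply; apply: (shape_le Hsg); lia.
by case: (ltnP i P) => // le; case: Hsg => _ /(_ _ le) ->.
Qed.

Lemma colh_dec c c' : c <= c' -> col_height c' <= col_height c.
Proof.
move=> h; case: (leqP (col_height c') (col_height c)) => // lt.
have := colhE c' (col_height c); rewrite lt => /esym h2.
by have := colhE c (col_height c); rewrite ltnn; lia.
Qed.

(** Each column is filled with 0, 1, 2, ... from its top. *)
Definition rot_tab : tab := fun r c a => (sg r <= c < kp r) && (a == r - col_height c).

Lemma kp_cond r c : (c < kp r) = (r < P) && (c < Q).
Proof. by rewrite /kp /rect_rows; case: (ltnP r P). Qed.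

Section Unique.
Variable f : tab.
Hypotheses (Tf : tableau sg kp f) (Lf : forall r c b, ~~ viol P Q f r c b).

Lemma rot_lower r c a : f r c a -> r - col_height c <= a.
Proof.
case: (Tf) => sup ne _ col; elim: r a => // r IH a fa.
have [le|gt] := leqP r.+1 (col_height c); first by lia.
have [d fd] : exists d, f r c d.
  by apply: ne; have := sup _ _ _ fa; rewrite !kp_cond; have := colhE c r; lia.
by have := IH _ fd; have := col _ _ _ _ fd fa; lia.
Qed.

(** At the first box where it fails, let the letter be b+1.  All earlier letters
are as in [rot_tab], and below each earlier b there is an earlier b+1.  So b has
not been read more often than b+1, against the lattice condition. *)
Lemma rot_upper r c a : f r c a -> a <= r - col_height c.
Proof.
have [n le] := ubnP (r * Q + (Q - c)).
elim: n r c a le => // n IH r c a le fa.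
have IH' r' c' a' : bef r c r' c' -> f r' c' a' -> a' = r' - col_height c'.
  move=> B fa'; have /andP[_ cQ] := tab_bound (rect_shape P Q) Tf fa'.
  have /andP[_ cQ'] := tab_bound (rect_shape P Q) Tf fa.
  apply/eqP; rewrite eqn_leq rot_lower // andbT; apply: IH fa'.
  apply: leq_trans (le : r * Q + (Q - c) <= n).
  move: B; rewrite /bef => /orP[lt|/andP[/eqP -> lt]]; last by rewrite ltn_add2l; lia.
  have : r'.+1 * Q <= r * Q by rewrite leq_mul2r lt orbT.
  by rewrite mulSn; lia.
rewrite leqNgt; apply/negP; case: a fa => // b fa lt.
have := Lf r c b; rewrite /viol fa /= => /negP; apply.
case: (Tf) => sup ne _ col.
have bd : forall c, f P c b.+1 = false.
  by move=> c'; apply/negP => /sup; rewrite kp_cond ltnn; lia.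
apply: (@wcont_shift_down P Q _ _ _ _ _ _ _ bd) => r' c' B fb.
have e := IH' _ _ _ B fb.
have s' := sup _ _ _ fb; rewrite kp_cond in s'.
have ch : col_height c' <= r' by have := colhE c' r'; lia.
have B' : bef r c r'.+1 c'.
  move: B; rewrite /bef => /orP[l1|/andP[/eqP e1 l1]].
    move: l1; rewrite leq_eqVlt => /predU1P[e2|->//].
    rewrite e2 ltnn eqxx /= ltnNge; apply/negP => le'.
    have := colh_dec le'; lia.
  by rewrite e1 in fb; have := tab_row Tf fa fb l1; lia.
split=> //.
have [d fd] : exists d, f r'.+1 c' d.
  apply: ne; rewrite kp_cond; have [h1 h2 h3] := Hsg; have := h1 r'.
  suff : r'.+1 < P by lia.
  have /andP[rP _] := tab_bound (rect_shape P Q) Tf fa; move: B'; rewrite /bef; lia.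
by rewrite -(_ : d = b.+1) // (IH' _ _ _ B' fd) e; lia.
Qed.

Lemma rot_unique : f = rot_tab.
Proof.
apply/funext=> r; apply/funext => c; apply/funext => a; rewrite /rot_tab.
case: (Tf) => sup ne _ _.
apply/idP/andP => [fa|[/ne[d fd] /eqP->]].
  by split; [exact: sup fa|rewrite eqn_leq rot_upper ?rot_lower].
by rewrite -(_ : d = r - col_height c) //; apply/eqP; rewrite eqn_leq rot_upper ?rot_lower.
Qed.
End Unique.

Lemma rot_tableau : tableau sg kp rot_tab.
Proof.
split.
- by move=> r c a /andP[].
- by move=> r c h; exists (r - col_height c); rewrite /rot_tab h eqxx.
- move=> r c a b /andP[_ /eqP->] /andP[_ /eqP->].
  by have := colh_dec (leqnSn c); lia.
- move=> r c a b /andP[h /eqP->] /andP[_ /eqP->].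
  by have := colhE c r; lia.
Qed.

(** Above each b+1 there is a b, which is read earlier. *)
Lemma rot_lattice r c b : ~~ viol P Q rot_tab r c b.
Proof.
rewrite /viol; case fr: (rot_tab r c b.+1) => //=; rewrite -ltnNge -addn1.
have /andP[rP cQ] := tab_bound (rect_shape P Q) rot_tableau fr.
have E : 1 = wcont P Q (fun r' c' => (r' == r) && (c' == c)) rot_tab b.+1.
  by rewrite wcont_pt ?fr.
rewrite [X in _ + X <= _]E (@wcontD P Q _ _ (fun r' c' => bef r c r' c' || ((r' == r) && (c' == c)))); last first.
  by move=> r' c' _; rewrite /bef; lia.
apply: wcont_shift_up => [r' c' B /andP[h1 /eqP h2]|c']; last first.
  by rewrite /rot_tab sub0n andbF.
rewrite kp_cond in h1; have ch : col_height c' <= r' by lia.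
split; first by move: B; rewrite /bef; lia.
rewrite /rot_tab kp_cond (_ : b == r' - col_height c'); last by lia.
by have := colhE c' r'; lia.
Qed.

(** Column c contains the letter a exactly if it has more than a boxes, that is, if
row P - a - 1 of the removed partition does not reach it. *)
Lemma rot_cont a : cont P Q rot_tab a = if a < P then Q - sg (P - a.+1) else 0.
Proof.
rewrite /cont /wcont exchange_big /=.
case: ltnP => aP; last first.
  rewrite big1 // => c _; rewrite big1 // => r _; apply/eqP; rewrite eqb0 /rot_tab.
  by have := ltn_ord r; lia.
have hQ : sg (P - a.+1) <= Q by case: Hsg.
have E (c : 'I_Q) : \sum_(r < P) rot_tab r c a = ~~ (c < sg (P - a.+1)).
  have cQ := ltn_ord c; have K := colhE c (P - a.+1).
  case lt: (c < sg (P - a.+1)) K => /= K.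
    rewrite big1 // => r _; apply/eqP; rewrite eqb0 /rot_tab; apply/negP => /andP[h /eqP h'].
    by have := colhE c r; have := ltn_ord r; lia.
  have rP : a + col_height c < P by lia.
  rewrite (bigD1 (Ordinal rP)) //= big1 ?addn0 => [|r].
    by rewrite /rot_tab addnK eqxx andbT kp_cond rP cQ andbT; have := colhE c (a + col_height c); lia.
  rewrite -val_eqE /= => ne; apply/eqP; rewrite eqb0 /rot_tab; apply/negP => /andP[h /eqP h'].
  by have := colhE c r; lia.
rewrite (eq_bigr _ (fun c _ => E c)).
have : \sum_(c < Q) ~~ (c < sg (P - a.+1)) + rk (fun c => c < sg (P - a.+1)) Q = Q.
  rewrite /rk -big_split /= -[RHS]card_ord -sum1_card; apply: eq_bigr => c _.
  by case: (_ < _).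
by rewrite rk_initial // => H; rewrite -[LHS](addnK (sg (P - a.+1))) H.
Qed.
End Rotated.

(** * Partitions as row-length functions *)

Local Open Scope fset_scope.
Local Open Scope nat_scope.

Lemma trans_geq : transitive geq.
Proof. by move=> y x z h1 h2; apply: leq_trans h2 h1. Qed.

(** In a weakly decreasing sequence the zeros come last. *)
Lemma nth_filter0 s i : sorted geq s -> nth 0 [seq x <- s | x != 0] i = nth 0 s i.
Proof.
elim: s i => //= x s IH i ps; case: eqP => [e|ne] /=.
  subst x; have z : all (pred1 0) s.
    by apply/allP => y ys; have /(order_path_min trans_geq)/allP/(_ y ys) := ps; rewrite /= leqn0.
  have -> : [seq x <- s | x != 0] = [::].
    by rewrite -(filter_pred0 s); apply: eq_in_filter => y /(allP z)/= ->.
  rewrite nth_nil; case: i => // i /=.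
  have [lt|le] := ltnP i (size s); last by rewrite nth_default.
  by have /eqP -> := allP z _ (mem_nth 0 lt).
by case: i => //= i; apply: IH; apply: path_sorted ps.
Qed.

Lemma prow_mkpart s i : sorted geq s -> prow (mkpart s) i = nth 0 s i.
Proof.
move=> ss; rewrite /prow /= sorted_sort //; last by apply: sorted_filter => //; exact: trans_geq.
  exact: nth_filter0.
exact: trans_geq.
Qed.

Lemma part_neq0 (l : part) i : i < size l -> 0 < prow l i.
Proof.
move=> h; rewrite lt0n; apply/negP => /eqP e.
have /andP[_ /negP] : is_part l by case: (l).
by apply; rewrite -e mem_nth.
Qed.

Lemma part_ext (l m : part) : prow l =1 prow m -> l = m.
Proof.
move=> E.
have le (k j : part) : prow k =1 prow j -> size k <= size j.
  move=> E'; rewrite leqNgt; apply/negP => lt.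
  by have := part_neq0 lt; rewrite E' /prow nth_default.
apply: val_inj => /=; apply: (@eq_from_nth _ 0) => [|i _]; last exact: E.
by apply/eqP; rewrite eqn_leq !le // => i; rewrite E.
Qed.

Lemma prow_dec (l : part) i j : i <= j -> prow l j <= prow l i.
Proof.
move=> h; have [lt|le] := ltnP j (size l); last by rewrite /prow nth_default.
have /andP[ss _] : is_part l by case: (l).
have := sorted_leq_nth trans_geq leqnn 0 ss.
by apply; rewrite ?inE ?(leq_ltn_trans h lt).
Qed.

Lemma part_shape (l : part) N C : size l <= N -> prow l 0 <= C -> row_shape N C (prow l).
Proof.
move=> h1 h2; split=> r; first exact: prow_dec.
  by move=> h; rewrite /prow nth_default // (leq_trans h1 h).
exact: leq_trans (prow_dec _ (leq0n r)) h2.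
Qed.

Lemma part_shape_self (l : part) : row_shape (size l) (prow l 0) (prow l).
Proof. exact: part_shape. Qed.

Definition shape_part N (g : nat -> nat) : part := mkpart (mkseq g N).

Lemma prow_shape_part N C g : row_shape N C g -> prow (shape_part N g) = g.
Proof.
move=> [h1 h2 h3]; apply/funext => r; rewrite prow_mkpart.
  have [lt|le] := ltnP r N; first by rewrite nth_mkseq.
  by rewrite nth_default ?size_mkseq // h2.
apply/(sortedP 0) => i; rewrite size_mkseq => lt.
by rewrite !nth_mkseq //= ?h1 //; lia.
Qed.

Lemma shape_size (l : part) N C : row_shape N C (prow l) -> size l <= N /\ prow l 0 <= C.
Proof.
move=> [h1 h2 h3]; split; last exact: h3.
rewrite leqNgt; apply/negP => lt; have := part_neq0 lt; by rewrite h2.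
Qed.

Lemma in_diag l (b : box) : (b \in diag l) = (b.2 < prow l b.1).
Proof.
case: b => r c; rewrite /diag !inE /=; apply/allpairsPdep/idP => [[i [j]]|lt].
  by rewrite !mem_iota !add0n => -[hi hj [-> ->]].
exists r, c; rewrite !mem_iota !add0n; split=> //=.
by rewrite ltnNge; apply/negP => le; move: lt; rewrite /prow nth_default.
Qed.

Lemma pinclP (l m : part) : reflect (forall r, prow l r <= prow m r) (pincl l m).
Proof.
rewrite /pincl; case: fsubsetP => H.
  constructor=> r; rewrite leqNgt; apply/negP => lt.
  by have := H (r, prow m r); rewrite !in_diag /= lt ltnn => /(_ isT).
by constructor=> G; apply: H => -[r c]; rewrite !in_diag /= => lt; apply: leq_trans lt (G r).
Qed.

Lemma in_skew t s (b : box) : (b \in skew t s) = (prow s b.1 <= b.2 < prow t b.1).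
Proof. by rewrite /skew inE !in_diag -leqNgt. Qed.

Lemma psizeE (l : part) N : size l <= N -> psize l = \sum_(r < N) prow l r.
Proof.
move=> h; rewrite /psize sumnE (big_nth 0) big_mkord.
rewrite (big_ord_widen N (fun i => nth 0 l i) h) [RHS](bigID (fun i : 'I_N => i < size l)) /=.
rewrite [X in _ = _ + X]big1 ?addn0 // => i ni; rewrite /prow nth_default //; lia.
Qed.

Lemma prow_rect p q : prow (rect p q) = rect_rows p q.
Proof.
apply/funext => r; rewrite prow_mkpart ?nth_nseq //.
by apply/(sortedP 0) => i; rewrite size_nseq => lt; rewrite !nth_nseq lt (ltnW lt) /=.
Qed.

Lemma strip_rook (l s : part) : (forall r, prow s r <= prow l r) ->
  rook_strip (skew l s) <-> strip (prow l) (prow s).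
Proof.
move=> sl; split=> [R|[st1 st2]].
  split=> r.
    rewrite leqNgt; apply/negP => lt.
    have := R (r, prow s r) (r, (prow s r).+1); rewrite !in_skew /= leqnn leqnSn lt (ltnW lt).
    by move=> /(_ isT isT (or_introl erefl)) [/eqP]; rewrite (ltn_eqF (ltnSn _)).
  move=> h1 h2; apply/eqP => e.
  have := R (r, prow s r) (r.+1, prow s r.+1); rewrite !in_skew /= !leqnn h1 h2.
  by move=> /(_ isT isT (or_intror e)) [/eqP]; rewrite (ltn_eqF (ltnSn _)).
have col r r' c : prow s r <= c < prow l r -> prow s r' <= c < prow l r' -> r < r' -> False.
  move=> h1 h2 lt.
  have q1 := prow_dec l lt; have q2 := prow_dec s (leqnSn r); have q3 := prow_dec s lt.
  have q4 := sl r; have q5 := st1 r; have q6 := st1 r.+1; have q7 := sl r.+1.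
  by have /eqP := st2 r ltac:(lia) ltac:(lia); lia.
move=> [r c] [r' c']; rewrite !in_skew /= => h1 h2 [e|e]; subst.
  have -> // : c = c'.
  have := st1 r'; move: h1 h2; set u := prow s r'; set v := prow l r'.
  by move=> /andP[h1 h2] /andP[h3 h4] h5; apply/eqP; rewrite eqn_leq; apply/andP; split; lia.
case: (ltngtP r r') => [lt|lt|->//]; exfalso; [exact: col h1 h2 lt|exact: col h2 h1 lt].
Qed.

(** * Fillings, contents and reading words *)

Local Open Scope fset_scope.
Local Open Scope nat_scope.

Definition tabF (F : filling) : tab := fun r c a => a.+1 \in F (r, c).

(** Boxes outside D receive the empty set; letters from n on are dropped. *)
Definition filT (D : {fset box}) n (f : tab) : filling :=
  [fsfun b in D => [fset a in [seq i.+1 | i <- iota 0 n & f b.1 b.2 i]] | fset0].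

Lemma in_filT (D : {fset box}) n (f : tab) (b : box) a : (a \in filT D n f b) =
  [&& b \in D, 0 < a, a <= n & f b.1 b.2 a.-1].
Proof.
rewrite fsfunE; case: (b \in D); last by rewrite inE.
rewrite !inE /=; apply/mapP/and3P => [[i]|[a0 an fa]].
  by rewrite mem_filter mem_iota add0n /= => /andP[fi ib] ->.
by exists a.-1; rewrite ?mem_filter ?mem_iota ?fa ?prednK //= add0n; lia.
Qed.

Lemma filT_pos (D : {fset box}) n (f : tab) (b : box) : 0 \notin filT D n f b.
Proof. by rewrite in_filT andbF. Qed.

Lemma tabF_filT (D : {fset box}) n (f : tab) : (forall r c a, f r c a -> ((r, c) : box) \in D /\ a < n) ->
  tabF (filT D n f) = f.
Proof.
move=> h; apply/funext => r; apply/funext => c; apply/funext => a.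
rewrite /tabF in_filT /=; apply/and3P/idP => [[]//|fa].
by have [h1 h2] := h _ _ _ fa.
Qed.

(** The predicate [tabF] forgets whether a box contains 0. *)
Lemma fill_ext (F F' : filling) : (forall b, 0 \notin F b) -> (forall b, 0 \notin F' b) ->
  tabF F = tabF F' -> F = F'.
Proof.
move=> z z' E; apply/fsfunP => -[r c]; apply/fsetP => -[|a].
  by rewrite (negbTE (z _)) (negbTE (z' _)).
exact: (congr1 (fun g : tab => g r c a) E).
Qed.

Lemma fill_supp (F : filling) b : (b \in finsupp F) = (F b != fset0).
Proof. by rewrite mem_finsupp. Qed.

Lemma svt_tab (s t : part) (F : filling) : svt (skew t s) F <->
  (forall b, 0 \notin F b) /\ tableau (prow s) (prow t) (tabF F).
Proof.
split=> [[sup pos row col]|[z [sup ne row col]]].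
  have z b : 0 \notin F b by apply/negP => /pos.
  split=> //; split.
  - move=> r c a fa; have : ((r, c) : box) \in finsupp F.
      by rewrite fill_supp; apply/fset0Pn; exists a.+1.
    by rewrite sup in_skew.
  - move=> r c h; have : ((r, c) : box) \in finsupp F by rewrite sup in_skew.
    rewrite fill_supp => /fset0Pn[[|a] fa]; first by rewrite (negbTE (z _)) in fa.
    by exists a.
  - by move=> r c a b fa fb; have := row _ _ _ _ fa fb.
  - by move=> r c a b fa fb; have := col _ _ _ _ fa fb.
split.
- apply/fsetP => -[r c]; rewrite fill_supp in_skew /=; apply/fset0Pn/idP => [[[|a] fa]|h].
  + by rewrite (negbTE (z _)) in fa.
  + exact: sup fa.
  + by have [a fa] := ne _ _ h; exists a.+1.
- by move=> b a fa; rewrite lt0n; apply/negP => /eqP e; rewrite e (negbTE (z _)) in fa.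
- move=> r c [|a] [|b] // fa fb; first by rewrite (negbTE (z _)) in fb.
  exact: row fa fb.
- move=> r c [|a] [|b] // fa fb; try by rewrite (negbTE (z _)) in fb.
    exact: col fa fb.
Qed.

Section Counting.
Variables (N C : nat) (F : filling).
Hypothesis bd : forall b : box, b \in finsupp F -> (b.1 < N) && (b.2 < C).

(** The boxes of the rectangle outside the support contribute nothing. *)
Lemma wcont_fill (B : nat -> nat -> bool) i :
  \sum_(b <- finsupp F | B b.1 b.2) (i.+1 \in F b) = wcont N C B (tabF F) i.
Proof.
pose G (b : box) := nat_of_bool (B b.1 b.2 && (i.+1 \in F b)).
have -> : wcont N C B (tabF F) i =
    \sum_(b <- [seq ((r, c) : box) | r <- iota 0 N, c <- iota 0 C]) G b.
  rewrite big_allpairs /wcont -(big_mkord xpredT (fun r => \sum_(c < C) (B r c && tabF F r c i))).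
  rewrite /index_iota subn0; apply: eq_bigr => r _.
  by rewrite -(big_mkord xpredT (fun c => nat_of_bool (B r c && tabF F r c i))) /index_iota subn0.
rewrite [RHS](bigID (fun b : box => b \in finsupp F)) /= [X in _ + X]big1 ?addn0; last first.
  move=> b; rewrite fill_supp negbK => /eqP e.
  by rewrite /G e inE andbF.
rewrite -[RHS]big_filter [RHS](perm_big (finsupp F)) /=; last first.
  apply: uniq_perm => //.
  - by rewrite filter_uniq // allpairs_uniq ?iota_uniq // => -[? ?] [? ?] _ _ [-> ->].
  - move=> b; rewrite mem_filter andb_idr // => /bd /andP[h1 h2].
    by apply/allpairsP; exists b; rewrite !mem_iota !add0n; case: b h1 h2.
by rewrite big_mkcond; apply: eq_bigr => b _; rewrite /G; case: (B _ _).
Qed.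

Lemma cm_big (I : Type) (r : seq I) (P : pred I) (G : I -> {cmonom nat}) i :
  (\big[mmul/mone]_(x <- r | P x) G x) i = \sum_(x <- r | P x) G x i.
Proof.
by apply: (big_morph (fun m : {cmonom nat} => m i)) => [x y|]; rewrite ?cmM ?cm1.
Qed.

Lemma xmonE i : xmon F i = \sum_(b <- finsupp F) (i \in F b).
Proof.
rewrite /xmon cm_big; apply: eq_bigr => b _; rewrite cm_big.
rewrite (eq_bigr (fun j => nat_of_bool (j == i))) => [|j _]; last by rewrite ucmE.
have -> : \sum_(j <- F b) (j == i) = \sum_(j <- F b | j == i) 1.
  by rewrite [RHS]big_mkcond; apply: eq_bigr => j _; case: eqP.
by rewrite sum1_count count_uniq_mem.
Qed.
End Counting.

Section Degree.
Variables (N C n : nat) (F : filling).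
Hypothesis bd : forall b : box, b \in finsupp F -> (b.1 < N) && (b.2 < C).
Hypothesis z : forall b, 0 \notin F b.
Hypothesis Fn : forall r c a, tabF F r c a -> a < n.

Lemma xmon0 : xmon F 0 = 0.
Proof. by rewrite xmonE big1 // => b _; rewrite (negbTE (z b)). Qed.

Lemma xmonS i : xmon F i.+1 = cont N C (tabF F) i.
Proof. by rewrite xmonE; exact: (wcont_fill bd (fun _ _ => true) i). Qed.

Lemma cont_big l : n <= l -> cont N C (tabF F) l = 0.
Proof.
move=> le; rewrite /cont /wcont big1 // => r _; rewrite big1 // => c _; apply/eqP.
by rewrite eqb0 /=; apply/negP => /Fn; lia.
Qed.

Lemma tdegE : tdeg F = \sum_(l < n) cont N C (tabF F) l.
Proof.
rewrite /tdeg (@mdegEw _ _ [fset (nat_of_ord i).+1 | i in 'I_n]); last first.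
  apply/fsubsetP => -[|i]; rewrite -cmE_neq0 ?xmon0 // xmonS => h.
  have lt : i < n by rewrite ltnNge; apply: contra h => /cont_big->.
  by apply/imfsetP; exists (Ordinal lt).
rewrite big_imfset /=; last by move=> i j _ _ [/val_inj].
by rewrite big_enum; apply: eq_bigr => i _; rewrite xmonS.
Qed.
End Degree.

(** An occurrence in a concatenation is an occurrence in one of the blocks. *)
Lemma flatten_split (T S : eqType) (g : T -> seq S) s u i v :
  flatten [seq g b | b <- s] = u ++ i :: v -> exists s1 b s2 x y,
  [/\ s = s1 ++ b :: s2, g b = x ++ i :: y & v = y ++ flatten [seq g b | b <- s2]].
Proof.
elim: s u => [|b s IH] u /= E; first by case: u E.
have [lt|ge] := ltnP (size u) (size (g b)).
  have E1 : take (size u) (g b) = u.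
    by have := congr1 (take (size u)) E; rewrite takel_cat ?(ltnW lt) // take_size_cat.
  have := cat_take_drop (size u) (g b); rewrite E1 => E2.
  move: E; rewrite -E2 -catA => /eqP; rewrite eqseq_cat // eqxx /= => /eqP E3.
  case Ed: (drop (size u) (g b)) E3 => [|i' y] /= E3.
    by have := congr1 size Ed; rewrite size_drop /=; lia.
  case: E3 => ei ev; subst i'.
  by exists [::], b, s, u, y; rewrite /= -E2 Ed ev.
have E1 : take (size (g b)) u = g b.
  have := congr1 (take (size (g b))) E.
  by rewrite take_size_cat // takel_cat.
have E2 := cat_take_drop (size (g b)) u; rewrite E1 in E2.
move: E; rewrite -E2 -catA => /eqP; rewrite eqseq_cat // eqxx /= => /eqP E3.
have [s1 [b' [s2 [x [y [h1 h2 h3]]]]]] := IH _ E3.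
by exists (b :: s1), b', s2, x, y; rewrite h1.
Qed.

Lemma reverse_lattice_split w : reverse_lattice w <->
  forall u i v, w = u ++ i :: v -> 2 <= i -> count_mem i v < count_mem i.-1 v.
Proof.
split=> [R u i v e h|R k kw h].
  have := R (size u); rewrite e size_cat /= nth_cat ltnn subnn /=.
  rewrite -cat_rcons drop_size_cat ?size_rcons //; apply=> //; lia.
by apply: (R (take k w)) => //; rewrite -drop_nth // cat_take_drop.
Qed.

Lemma reading_total : total reading_order.
Proof. by move=> [r c] [r' c']; rewrite /reading_order /=; lia. Qed.

Lemma reading_trans : transitive reading_order.
Proof. by move=> [r c] [r' c'] [r1 c1]; rewrite /reading_order /=; lia. Qed.

Lemma reading_bef b b' : reading_order b b' -> b != b' -> bef b.1 b.2 b'.1 b'.2.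
Proof.
case: b b' => [r c] [r' c']; rewrite /reading_order /bef /=; case: (ltngtP r' r) => //= e.
by subst; case: (ltngtP c c') => // -> _; rewrite eqxx.
Qed.

Lemma bef_reading b b' : bef b.1 b.2 b'.1 b'.2 -> ~~ reading_order b' b.
Proof.
case: b b' => [r c] [r' c']; rewrite /reading_order /bef /=.
by case: (ltngtP r r') => //= _; rewrite -ltnNge.
Qed.

Section Words.
Variables (N C : nat) (F : filling).
Hypothesis bd : forall b : box, b \in finsupp F -> (b.1 < N) && (b.2 < C).
Let g (b : box) := sort leq (F b).
Let s := sort reading_order (finsupp F).

Lemma g_count i b : count_mem i (g b) = (i \in F b).
Proof.
have /permP E : perm_eq (g b) (F b) by rewrite perm_sort.
by rewrite E count_uniq_mem ?fset_uniq.
Qed.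

Lemma count_flatten i (t : seq box) :
  count_mem i (flatten [seq g b | b <- t]) = \sum_(b <- t) (i \in F b).
Proof.
elim: t => [|b t IH]; first by rewrite big_nil.
by rewrite /= count_cat big_cons g_count IH.
Qed.

Lemma word_count i : count_mem i.+1 (word F) = cont N C (tabF F) i.
Proof.
rewrite /word count_flatten; rewrite -[RHS](wcont_fill bd (fun _ _ => true) i).
by apply: perm_big; rewrite perm_sort.
Qed.

(** The order of the word is the reverse of the order in which boxes are read. *)
Lemma s_after s1 b s2 : s = s1 ++ b :: s2 ->
  [seq b' <- s | bef b.1 b.2 b'.1 b'.2] = s2.
Proof.
move=> e; have un : uniq s by rewrite sort_uniq.
have so : pairwise reading_order s.
  by rewrite -(sorted_pairwise reading_trans); apply: sort_sorted; exact: reading_total.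
rewrite e in un so *; move: so; rewrite pairwise_cat pairwise_cons.
rewrite allrel_consr => /and3P[/andP[/allP h1 _] _ /andP[/allP h2 _]].
rewrite filter_cat /= (_ : bef b.1 b.2 b.1 b.2 = false) /=; last by rewrite /bef !ltnn andbF.
have -> : [seq b' <- s1 | bef b.1 b.2 b'.1 b'.2] = [::].
  rewrite -(filter_pred0 s1); apply: eq_in_filter => b' b1; apply/negP => /bef_reading.
  by rewrite h1.
apply/all_filterP/allP => b' b2; apply: reading_bef; first exact: h2.
move: un; rewrite cat_uniq /= => /and3P[_ _ /andP[nb _]].
by apply: contra nb => /eqP->.
Qed.

Lemma count_after i s1 b s2 : s = s1 ++ b :: s2 ->
  count_mem i.+1 (flatten [seq g b' | b' <- s2]) = wcont N C (bef b.1 b.2) (tabF F) i.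
Proof.
move=> e; rewrite count_flatten -(s_after e) big_filter -[RHS](wcont_fill bd (bef b.1 b.2) i).
by apply: perm_big; rewrite perm_sort.
Qed.

(** Inside a box the letters increase strictly. *)
Lemma count_in_box i x y b : g b = x ++ i :: y -> count_mem i y = 0 /\ count_mem i.-1 y = 0.
Proof.
move=> e; have un : uniq (g b) by rewrite sort_uniq fset_uniq.
have so : sorted leq (g b) by apply: sort_sorted; exact: leq_total.
rewrite e in un so; move: un; rewrite cat_uniq /= => /and3P[_ _ /andP[ny _]].
have [_ /(order_path_min leq_trans)/allP h] := cat_sorted2 so.
split; apply/count_memPn => //; apply/negP => iy; have := h _ iy.
case: i {e so h} ny iy => [|i] /= ny iy; first by rewrite iy in ny.
by rewrite ltnn.
Qed.

(** What follows an occurrence of i in the word consists of the larger letters of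
its box, which are irrelevant to the pair (i-1, i), and of the boxes read before
that box. *)
Lemma lattice_word : reverse_lattice (word F) <-> forall r c b, ~~ viol N C (tabF F) r c b.
Proof.
rewrite reverse_lattice_split; split=> [R r c b|L u i v e i2].
  rewrite /viol; case fb: (tabF F r c b.+1) => //=; rewrite -ltnNge.
  have bs : ((r, c) : box) \in s.
    by rewrite mem_sort fill_supp; apply/fset0Pn; exists b.+2.
  have bg : b.+2 \in g (r, c) by rewrite mem_sort.
  have [s1 [s2 es]] : exists s1 s2, s = s1 ++ (r, c) :: s2.
    by case/splitPr: bs => s1 s2; exists s1, s2.
  have [x [y ex]] : exists x y, g (r, c) = x ++ b.+2 :: y.
    by case/splitPr: bg => x y; exists x, y.
  have := R (flatten [seq g b | b <- s1] ++ x) b.+2 (y ++ flatten [seq g b | b <- s2]).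
  have -> : word F = flatten [seq g b | b <- s] by [].
  rewrite {1}es map_cat flatten_cat /= ex -!catA /= => /(_ erefl isT).
  have [z1 z2] := count_in_box ex; rewrite /= in z2.
  by rewrite !count_cat z1 z2 !add0n !(count_after _ es).
have [s1 [b [s2 [x [y [es eg ->]]]]]] := flatten_split e.
have [z1 z2] := count_in_box eg; rewrite !count_cat z1 z2 !add0n.
case: i i2 e eg z1 z2 => [|[|i]] // _ e eg z1 z2.
rewrite (count_after i.+1 es) (count_after i es) ltnNge; apply/negP => le.
have /negP := L b.1 b.2 i; apply; rewrite /viol le andbT.
have : i.+2 \in sort leq (F b) by rewrite eg mem_cat inE eqxx orbT.
by rewrite mem_sort /tabF; case: (b).
Qed.
End Words.

(** * Truncation of Grothendieck series to n variables *)

Local Open Scope ring_scope.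

Lemma sign_diff a b : (-1 : int) ^ (a%:Z - b%:Z) = (-1) ^+ (a + b).
Proof.
have u : (-1 : int) \is a GRing.unit by rewrite unitrN1.
rewrite exprzDr // -exprz_inv invrN1 exprD.
by [].
Qed.

Lemma finsum_fs (R : nmodType) (I : finType) (P : pred I) (F : I -> R) :
  \sum_(i | P i) F i = \sum_(i \in [set i | P i]%classic) F i.
Proof. by apply: bigfs => [|i _]; rewrite ?index_enum_uniq ?mem_index_enum. Qed.

Definition nilp : part := mkpart [::].

Lemma prow_nilp : prow nilp = fun _ => 0%N.
Proof. by apply/funext => i; rewrite prow_mkpart ?nth_nil. Qed.

Lemma diag_skew l : diag l = skew l nilp.
Proof. by apply/fsetP => b; rewrite in_skew in_diag prow_nilp. Qed.

Section TruncatedGroth.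
Import fingroup perm mpoly.

Definition groth_unsgn n (l : part) : mpoly n int :=
  tab_poly (size l) (prow l 0) n (fun _ => 0%N) (prow l).

(** The Grothendieck polynomial in n variables. *)
Definition groth_trunc n (l : part) : mpoly n int := (-1) ^+ psize l *: groth_unsgn n l.

(** The exponents of x_1, ..., x_n; they determine a monomial in these variables,
as x_0 does not occur in tableaux. *)
Definition mlow n (m : {cmonom nat}) : 'X_{1..n} := [multinom m i.+1 | i < n].

Lemma groth_unsgn_sym n l (s : 'S_n) : msym s (groth_unsgn n l) = groth_unsgn n l.
Proof. exact: tab_poly_sym (shape0 _ _) (part_shape_self l) s. Qed.

Definition ftab_fill n (l s : part) (T : ftab (size l) (prow l 0) n) : filling :=
  filT (skew l s) n (tabf T).

Lemma skew_bound (l s : part) (b : box) : b \in skew l s -> ((b.1 < size l) && (b.2 < prow l 0))%N.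
Proof.
rewrite in_skew => /andP[_ h]; apply/andP; split.
  by rewrite ltnNge; apply/negP => le; move: h; rewrite /prow nth_default.
exact: leq_trans h (prow_dec l (leq0n _)).
Qed.

Lemma ftab_fillK n l s T : tableau (prow s) (prow l) (tabf T) -> tabF (@ftab_fill n l s T) = tabf T.
Proof.
move=> [sup _ _ _]; apply: tabF_filT => r c a fa; split; last by case/and3P: (tabf_bound fa).
by rewrite in_skew; exact: sup fa.
Qed.

Lemma ftab_fill_svt n l s T : tableau (prow s) (prow l) (tabf T) -> svt (skew l s) (@ftab_fill n l s T).
Proof. by move=> Tf; apply/svt_tab; split; [move=> b; exact: filT_pos|rewrite ftab_fillK]. Qed.

Lemma fill_ftab n l s (F : filling) : svt (skew l s) F -> (forall r c a, tabF F r c a -> (a < n)%N) ->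
  exists T, [/\ tableau (prow s) (prow l) (tabf T), tabf T = tabF F & @ftab_fill n l s T = F].
Proof.
move=> sF Fn; have [z Tf] := (svt_tab s l F).1 sF.
have E : tabf (mkT (size l) (prow l 0) n (tabF F)) = tabF F.
  apply: tabf_mk => r c a fa; have /andP[-> ->] := tab_bound (part_shape_self l) Tf fa.
  exact: Fn fa.
exists (mkT (size l) (prow l 0) n (tabF F)); rewrite E; split=> //.
apply: fill_ext => // [b|]; first exact: filT_pos.
by rewrite ftab_fillK E.
Qed.

(** A tableau with monomial m has only letters from 1 to n, and these tableaux
correspond to elements of the finite type [ftab]. *)
Lemma groth_coef n l (m : {cmonom nat}) : m 0%N = 0%N -> (forall i, (n < i)%N -> m i = 0%N) ->
  groth l m = (groth_trunc n l)@_(mlow n m).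
Proof.
move=> m0 mn; rewrite /groth /groth_trunc mcoeffZ /groth_unsgn /tab_poly linear_sum /= mulr_sumr.
under [RHS]eq_bigr do rewrite mcoeffZ mcoeffX.
pose P := [set T : ftab (size l) (prow l 0) n | is_tab (fun _ => 0%N) (prow l) T &&
   ([multinom cont (size l) (prow l 0) (tabf T) i | i < n] == mlow n m)]%classic.
transitivity (\sum_(T \in P) (-1 : int) ^+ (psize l + tabsize (size l) (prow l 0) n (tabf T))); last first.
  rewrite -finsum_fs big_mkcondr /=; apply: eq_bigr => T _.
  by rewrite exprD; case: eqP => _; rewrite ?mulr1 ?mulr0.
have H T : is_tab (fun _ => 0%N) (prow l) T -> tableau (prow nilp) (prow l) (tabf T).
  by move=> /asboolP; rewrite prow_nilp.
have bd (F : filling) b : svt (diag l) F -> b \in finsupp F -> ((b.1 < size l) && (b.2 < prow l 0))%N.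
  by rewrite diag_skew => -[-> _ _ _]; apply: skew_bound.
have posF (F : filling) : svt (diag l) F -> forall b, 0%N \notin F b.
  by rewrite diag_skew => /svt_tab[].
rewrite (reindex_fsbig (fun T : ftab (size l) (prow l 0) n => ftab_fill nilp T) P).
  apply: eq_fsbigr => T /set_mem /= /andP[/H Tf _].
  rewrite sign_diff addnC; congr (_ ^+ (_ + _)).
  have sv := ftab_fill_svt Tf; rewrite -diag_skew in sv.
  rewrite (@tdegE (size l) (prow l 0) n) ?ftab_fillK //.
  - by move=> b; exact: bd.
  - exact: posF.
  - by move=> r c a /tabf_bound/and3P[].
split.
- move=> T /= /andP[/H Tf /eqP E].
  have sv := ftab_fill_svt Tf; rewrite -diag_skew in sv.
  split=> //; apply/eqP/cmP => -[|i]; first by rewrite m0 xmon0 //; exact: posF.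
  rewrite (@xmonS (size l) (prow l 0)) ?ftab_fillK //; last by move=> b; exact: bd.
  have [lt|ge] := ltnP i n.
    by have /mnmP/(_ (Ordinal lt)) := E; rewrite !mnmE.
  rewrite mn // /cont /wcont big1 // => r _; rewrite big1 // => c _; apply/eqP.
  by rewrite eqb0 /=; apply/negP => /tabf_bound; lia.
- move=> T T' /set_mem /= /andP[/H Tf _] /set_mem /= /andP[/H Tf' _] E.
  by apply: tabf_inj; rewrite -(ftab_fillK Tf) E ftab_fillK.
- move=> F /= [sv xm_]; have sv' := sv; rewrite diag_skew in sv'.
  have Fn r c a : tabF F r c a -> (a < n)%N.
    move=> fa; rewrite ltnNge; apply/negP => le.
    have := xmonE F a.+1; rewrite xm_ mn //.
    have bs : ((r, c) : box) \in finsupp F by rewrite fill_supp; apply/fset0Pn; exists a.+1.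
    by rewrite (big_fsetD1 _ bs) /= -/(tabF F r c a) fa.
  have [T [Tf E EF]] := fill_ftab sv' Fn.
  exists T => //; apply/andP; split; first by apply/asboolP; rewrite -prow_nilp.
  apply/eqP/mnmP => i; rewrite !mnmE -xm_ E (@xmonS (size l) (prow l 0)) //.
  by move=> b; exact: bd.
Qed.

Lemma groth_coef0 l (m : {cmonom nat}) : m 0%N != 0%N -> groth l m = 0.
Proof.
move=> m0; rewrite /groth; apply: fsbig1 => F [sv e].
by move: m0; rewrite -e xmon0 //; move: sv; rewrite diag_skew => /svt_tab[].
Qed.
End TruncatedGroth.

(** * Lattice tableaux and triples (lambda, sigma, T) *)

Local Open Scope ring_scope.

(** Triples (lambda, sigma, T) where T has letters from 1 to p.  They correspond to the
straight tableaux of shape k that are lattice in both blocks of letters, whatever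
the number of small letters is, provided it is large enough. *)
Definition split_data (k : part) (p : nat) : set (part * part * filling) :=
  [set y | [/\ pincl y.1.2 y.1.1 && pincl y.1.1 k, rook_strip (skew y.1.1 y.1.2),
    svt (skew k y.1.2) y.2, reverse_lattice (word y.2) &
    forall r c a, tabF y.2 r c a -> (a < p)%N]]%classic.

Lemma svt_bound (k s : part) (F : filling) b : svt (skew k s) F ->
  b \in finsupp F -> ((b.1 < size k) && (b.2 < prow k 0))%N.
Proof. by move=> [-> _ _ _]; apply: skew_bound. Qed.

Section LatticeSum.
Variables (p m : nat) (k : part).
Hypothesis km : (size k <= m)%N.
Let N := size k.
Let C := prow k 0.
Let Hk : row_shape N C (prow k) := part_shape_self k.
Let z := fun _ : nat => 0%N.

Definition latT (T : ftab N C (p + m)) : bool :=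
  is_tab z (prow k) T && `[< lattice N C (block_pair p m) (tabf T) >].

Definition split_of (T : ftab N C (p + m)) : part * part * filling :=
  (shape_part N (low_rows C (tabf T)), shape_part N (only_low_rows C m p (tabf T)),
   filT (skew k (shape_part N (only_low_rows C m p (tabf T)))) p (high_part m (tabf T))).

Section OneTableau.
Variable T : ftab N C (p + m).
Hypothesis LT : latT T.
Let f := tabf T.

Lemma latT_tab : tableau z (prow k) f.
Proof. by case/andP: LT => /asboolP. Qed.
Lemma latT_lat : lattice N C (block_pair p m) f.
Proof. by case/andP: LT => _ /asboolP. Qed.
Lemma latT_lt r c a : f r c a -> (a < p + m)%N.
Proof. by case/tabf_bound/and3P. Qed.

Lemma latT_lam : prow (shape_part N (low_rows C f)) = low_rows C f.
Proof. exact: prow_shape_part (lam_shape Hk km latT_tab latT_lt latT_lat). Qed.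
Lemma latT_sig : prow (shape_part N (only_low_rows C m p f)) = only_low_rows C m p f.
Proof. exact: prow_shape_part (sig_shape Hk km latT_tab latT_lt latT_lat). Qed.

Lemma latT_hi : tabF (split_of T).2 = high_part m f.
Proof.
have [sup _ _ _] := hi_tableau Hk km latT_tab latT_lt latT_lat.
apply: tabF_filT => r c a fa; split; last exact: (hi_lt km latT_lt fa).
by rewrite in_skew latT_sig; exact: sup fa.
Qed.

Lemma split_of_data : split_data k p (split_of T).
Proof.
have Tf := latT_tab; have Lf := latT_lat; have fp := latT_lt.
have sv : svt (skew k (split_of T).1.2) (split_of T).2.
  apply/svt_tab; split; first by move=> b; exact: filT_pos.
  by rewrite latT_hi latT_sig; exact: (hi_tableau Hk km Tf fp Lf).
split=> //=.
- apply/andP; split; apply/pinclP => r; rewrite ?latT_lam ?latT_sig.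
    exact: (sig_le_lam Hk km Tf fp Lf r).
  exact: (lam_le_kp Hk km Tf fp Lf r).
- apply/strip_rook; first by move=> r; rewrite latT_lam latT_sig; exact: (sig_le_lam Hk km Tf fp Lf r).
  by rewrite latT_lam latT_sig; exact: (lam_sig_strip Hk km Tf fp Lf).
- apply/(lattice_word (fun b => svt_bound sv)); rewrite latT_hi => r c b.
  exact: (hi_lattice km fp Lf r c b).
- by rewrite latT_hi => r c a; exact: (hi_lt km latT_lt).
Qed.

Lemma latT_cont_lo b : (b < m)%N -> cont N C f b = prow (split_of T).1.1 b.
Proof. by move=> bm; rewrite latT_lam; exact: (cont_lo Hk km latT_tab latT_lt latT_lat bm). Qed.

Lemma latT_cont_hi a : cont N C f (m + a) = cont N C (tabF (split_of T).2) a.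
Proof. by rewrite latT_hi. Qed.
End OneTableau.

(** The large letters are those of T, and the small ones are given by
[split_unique]. *)
Lemma split_of_inj T T' : latT T -> latT T' -> split_of T = split_of T' -> T = T'.
Proof.
move=> L L' E; apply: tabf_inj.
have E1 : low_rows C (tabf T) = low_rows C (tabf T').
  by rewrite -(latT_lam L) -(latT_lam L'); exact: (congr1 (fun y => prow y.1.1) E).
have E2 : high_part m (tabf T) = high_part m (tabf T').
  by rewrite -(latT_hi L) -(latT_hi L'); exact: (congr1 (fun y => tabF y.2) E).
apply/funext => r; apply/funext => c; apply/funext => a.
rewrite (split_unique Hk km (latT_tab L) (@latT_lt T) (latT_lat L)).
by rewrite (split_unique Hk km (latT_tab L') (@latT_lt T') (latT_lat L')) E1 E2.
Qed.

(** The preimage of (lambda, sigma, T) has r in the first lambda_r boxes of row r,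
and the letters of T raised by m. *)
Lemma split_of_surj y : split_data k p y -> exists2 T, latT T & split_of T = y.
Proof.
case: y => [[l s] F] [/= /andP[/pinclP sl /pinclP lk] rk_ sv rl Fp].
have [z0 TF] := (svt_tab s k F).1 sv.
have Hl : row_shape N C (prow l).
  split=> [r|r h|r]; first exact: prow_dec.
    by have [_ h2 _] := Hk; apply/eqP; rewrite -leqn0 -(h2 r h).
  by have [_ _ h3] := Hk; apply: leq_trans (lk r) (h3 r).
have Hs : row_shape N C (prow s).
  split=> [r|r h|r]; first exact: prow_dec.
    by have [_ h2 _] := Hl; apply/eqP; rewrite -leqn0 -(h2 r h).
  by have [_ _ h3] := Hl; apply: leq_trans (sl r) (h3 r).
have st : strip (prow l) (prow s) by apply/strip_rook.
have LF := (lattice_word (fun b => svt_bound sv)).1 rl.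
pose f := glue m (prow l) (tabF F).
have Tf : tableau z (prow k) f by exact: (glue_tableau Hk km Hl Hs sl lk st TF).
have Lf : lattice N C (block_pair p m) f by apply: glue_lattice.
have E : tabf (mkT N C (p + m) f) = f.
  by apply: tabf_mk => r c a; exact: (glue_bound Hk km Hl TF Fp).
have LT : latT (mkT N C (p + m) f) by apply/andP; rewrite E; split; apply/asboolP; rewrite ?E.
exists (mkT N C (p + m) f) => //.
have Eh : high_part m f = tabF F by exact: glue_hi.
have fp r c a : f r c a -> (a < p + m)%N.
  by case/(glue_bound Hk km Hl TF Fp)/and3P.
have bg r c : (c < prow k r)%N -> has_high m p f r c = ~~ (c < prow s r)%N.
  move=> ck; apply/existsP/idP => [[a fa]|ns].
    have : tabF F r c a by rewrite -Eh.
    by case: TF => sup _ _ _ /sup; rewrite -leqNgt => /andP[].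
  have [_ ne _ _] := TF; have [|a fa] := ne r c; first by rewrite leqNgt ns.
  have ap := Fp _ _ _ fa; exists (Ordinal ap).
  by rewrite -Eh in fa.
have fr r c : f r c r = (c < prow l r)%N.
  have [rm|mr] := ltnP r m; first by rewrite /f /glue rm eqxx.
  have [_ h2 _] := Hl; rewrite (h2 r) ?(leq_trans km mr) //; apply/negP => h.
  by have := tab_bound Hk Tf h; rewrite ltnNge (leq_trans km mr).
have lt_ext x y : (forall c, (c < x) = (c < y))%N -> x = y.
  move=> h; apply/eqP; rewrite eqn_leq leqNgt h ltnn /=.
  by rewrite leqNgt -h ltnn.
have El : shape_part N (low_rows C f) = l.
  apply: part_ext => r; rewrite -E latT_lam // E.
  by apply: lt_ext => c; rewrite (low_rowsE Hk km Tf fp Lf) fr.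
have Es : shape_part N (only_low_rows C m p f) = s.
  apply: part_ext => r; rewrite -E latT_sig // E.
  apply: lt_ext => c; rewrite (only_low_rowsE Hk km Tf fp Lf) fr.
  have slr := sl r; have lkr := lk r.
  have [ck|ck] := ltnP c (prow k r); first by rewrite bg // negbK; lia.
  by move: slr lkr ck; rewrite /C; case: ltnP => /=; lia.
rewrite /split_of E El Es Eh; congr (_, _).
apply: fill_ext => // [b|]; first exact: filT_pos.
apply: tabF_filT => r c a fa; split; last exact: Fp fa.
by case: TF => sup _ _ _; rewrite in_skew; exact: sup fa.
Qed.

Lemma lattice_sum (R : nmodType) (G : part -> (nat -> nat) -> R) :
  (forall l w w', (forall a, (a < p)%N -> w a = w' a) -> G l w = G l w') ->
  \sum_(T | latT T) G (split_of T).1.1 (fun a => cont N C (tabf T) (m + a)) =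
  \sum_(y \in split_data k p) G y.1.1 (fun a => cont N C (tabF y.2) a).
Proof.
move=> Gext; rewrite finsum_fs (reindex_fsbig split_of [set T | latT T]%classic (split_data k p)).
  by apply: eq_fsbigr => T /set_mem /= LT; apply: Gext => a _; rewrite latT_cont_hi.
split.
- by move=> T LT; exact: split_of_data.
- by move=> T T' /set_mem LT /set_mem LT'; exact: split_of_inj.
- by move=> y /split_of_surj[T LT <-]; exists T.
Qed.

Lemma split_data_finite : finite_set (split_data k p).
Proof.
have -> : split_data k p = (split_of @` [set T | latT T])%classic.
  apply/seteqP; split=> [y /split_of_surj[T LT <-]|y [T LT <-]]; first by exists T.
  exact: split_of_data.
by apply: finite_image; apply: finite_finset.
Qed.

Lemma latT_sz T : latT T -> tabsize N C (p + m) (tabf T) =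
  (psize (split_of T).1.1 + \sum_(a < p) cont N C (tabf T) (m + a))%N.
Proof.
move=> LT; have fin := latT_tab LT.
have S (F : nat -> nat) : (\sum_(l < p + m) F l = \sum_(l < m) F l + \sum_(a < p) F (m + a))%N.
  by rewrite addnC big_split_ord.
rewrite /tabsize (S (cont N C (tabf T))); congr (_ + _)%N.
rewrite (@psizeE _ m); last first.
  have := lam_shape Hk km fin (@latT_lt T) (latT_lat LT); rewrite -(latT_lam LT) => /shape_size[h _].
  exact: leq_trans h km.
by apply: eq_bigr => b _; exact: latT_cont_lo.
Qed.
End LatticeSum.

(** * The product with a rectangle as a sum of alternants *)

Local Open Scope ring_scope.

Definition ycont (k : part) (y : part * part * filling) a :=
  cont (size k) (prow k 0) (tabF y.2) a.
Definition ysign (k : part) p y : int :=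
  (-1) ^+ (psize y.1.1 + \sum_(a < p) ycont k y a)%N.
Definition rectf (p q : nat) : nat -> nat := fun j => if (j < p)%N then q else 0%N.

(** The exponent vector (q + mu, lambda), where mu is the content of T. *)
Definition yexp (k : part) (p q : nat) (y : part * part * filling) : nat -> nat :=
  fun j => (if j < p then q + ycont k y j else prow y.1.1 (j - p))%N.

Section Expansion.
Import fingroup perm mpoly.
Variables (p m q : nat) (k : part).
Hypothesis km : (size k <= m)%N.
Let n := (p + m)%N.
Let N := size k.
Let C := prow k 0.

Lemma letter_of_lt j : (j < n)%N -> (letter_of p m j < n)%N.
Proof. by rewrite /letter_of /n; case: (ltnP j p); lia. Qed.

Lemma letter_of_inj : injective (fun i : 'I_n => Ordinal (letter_of_lt (ltn_ord i))).
Proof.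
have K a b : (a < p + m)%N -> (b < p + m)%N -> letter_of p m a = letter_of p m b -> a = b.
  by rewrite /letter_of; case: (ltnP a p); case: (ltnP b p); lia.
by move=> i j [] h; apply: ord_inj; exact: K (ltn_ord i) (ltn_ord j) h.
Qed.

(** Symmetry allows the variables to be permuted so that the small letters belong to
the last variables. *)
Lemma groth_unsgn_rot : groth_unsgn n k = \sum_(T : ftab N C n | is_tab (fun _ => 0%N) (prow k) T)
  (-1) ^+ tabsize N C n (tabf T) *: xmono n (varexp p m N C (tabf T)).
Proof.
rewrite -(groth_unsgn_sym k (perm letter_of_inj)^-1) /groth_unsgn /tab_poly linear_sum /=.
apply: eq_bigr => T _; rewrite msymZ msym_xmono invgK; congr (_ *: _).
by apply: eq_xmono => i lt; rewrite insubT permE.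
Qed.

(** The exponents of the rectangle are constant on each block of variables, so the
cancellation applies in the presence of that factor. *)
Lemma block_expansion : alt (Kdelta n * (xmono n (rectf p q) * groth_unsgn n k)) =
  \sum_(y \in split_data k p) ysign k p y *: alternant n (yexp k p q y).
Proof.
rewrite groth_unsgn_rot !mulr_sumr alt_sum.
transitivity (\sum_(T : ftab N C n | is_tab (fun _ => 0%N) (prow k) T)
   tab_term p m N C (rectf p q) (tabf T)).
  apply: eq_bigr => T _; rewrite -!scalerAr altZ /tab_term /alternant; congr (_ *: alt (_ * _)).
  by rewrite -xmonoD.
rewrite (lattice_cancellation (shape0 N C) (part_shape_self k)); last first.
  by move=> j _ jp; rewrite /rectf; case: (ltnP j p); case: (ltnP j.+1 p) => //; lia.
pose G (l : part) (w : nat -> nat) : mpoly n int :=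
  (-1) ^+ (psize l + \sum_(a < p) w a) *: alternant n (fun j => if (j < p)%N then q + w j else prow l (j - p))%N.
have Gext l w w' : (forall a, (a < p)%N -> w a = w' a) -> G l w = G l w'.
  move=> E; rewrite /G; congr ((-1) ^+ (_ + _) *: _); first by apply: eq_bigr => a _; exact: E.
  by apply: eq_alternant => i _; case: ltnP => // /E->.
rewrite -[RHS](lattice_sum km Gext) /latT; apply: eq_bigr => T LT.
have {}LT : latT T by [].
rewrite /tab_term /G (latT_sz km LT); congr (_ *: _).
apply: eq_alternant => j jn; rewrite /rectf /varexp /letter_of; case: (ltnP j p) => jp //.
rewrite add0n (latT_cont_lo km LT) //; move: jn; rewrite /n; lia.
Qed.
End Expansion.

Section Alternants.
Import fingroup perm mpoly.

Lemma vdm_sym n (g : mpoly n int) : (forall s : 'S_n, msym s g = g) -> vdm n * g = alt (Kdelta n * g).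
Proof. by move=> sg; rewrite /vdm mulrC -alt_sym // mulrC. Qed.

Lemma svt0 (k s : part) (F : filling) : svt (skew k s) F -> (forall r c a, tabF F r c a -> (a < 0)%N) ->
  forall r, (prow k r <= prow s r)%N.
Proof.
move=> /svt_tab[_ [_ ne _ _]] F0 r; rewrite leqNgt; apply/negP => lt.
by have [|a /F0] := ne r (prow s r); first by rewrite leqnn.
Qed.

(** Without large letters, sigma is all of k, hence lambda as well. *)
Lemma split_data0 k : split_data k 0 = [set (k, k, filT fset0 0 (fun _ _ _ => false))]%classic.
Proof.
set F0 := filT _ _ _.
have E0 b : F0 b = fset0 by apply/fsetP => a; rewrite in_filT !in_fset0.
have tF0 : tabF F0 = fun _ _ _ => false.
  by apply/funext => r; apply/funext => c; apply/funext => a; rewrite /tabF E0 in_fset0.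
apply/seteqP; split=> [[[l s] F]|y ->] /=.
  move=> [/= /andP[/pinclP sl /pinclP lk] _ sv _ Fz].
  have ks := svt0 sv Fz.
  have -> : l = k by apply: part_ext => r; apply/eqP; rewrite eqn_leq lk (leq_trans (ks r)).
  have -> : s = k by apply: part_ext => r; apply/eqP; rewrite eqn_leq ks andbT (leq_trans (sl r)).
  congr (_, _); have [z _] := (svt_tab _ _ _).1 sv.
  apply: fill_ext => // [b|]; first by rewrite E0 in_fset0.
  rewrite tF0; apply/funext => r; apply/funext => c; apply/funext => a.
  by apply/negP => /Fz.
have kk : pincl k k by apply/pinclP.
have sv : svt (skew k k) F0.
  apply/svt_tab; split=> [b|]; first by rewrite E0 in_fset0.
  by rewrite tF0; split=> // r c /andP[h1 h2]; have := leq_ltn_trans h1 h2; rewrite ltnn.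
split=> //=; first by rewrite kk.
- by move=> b b'; rewrite in_skew => /andP[h1 h2]; have := leq_ltn_trans h1 h2; rewrite ltnn.
- by apply/(lattice_word (fun b => svt_bound sv)) => r c b; rewrite tF0.
- by rewrite tF0.
Qed.

(** The case of a single block in [block_expansion]: only the superstandard tableau
survives. *)
Lemma vdm_groth n (l : part) : (size l <= n)%N -> vdm n * groth_trunc n l = alternant n (prow l).
Proof.
move=> ln; rewrite /groth_trunc -scalerAr vdm_sym; last by move=> s; exact: groth_unsgn_sym.
have := @block_expansion 0 n 0 l ln.
rewrite split_data0 fsbig_set1.
have -> : xmono n (rectf 0 0) = 1 by rewrite xmonoE big1.
rewrite mul1r => ->; rewrite /ysign big_ord0 addn0 scalerA -expr2 sqrr_sign scale1r.
by apply: (@eq_alternant 0 n) => i _; rewrite /yexp subn0.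
Qed.

(** Multiplying by a symmetric polynomial commutes with alternation. *)
Lemma product_expansion p m q (k : part) : (size k <= m)%N ->
  vdm (p + m) * (groth_trunc (p + m) (rect p q) * groth_unsgn (p + m) k) =
  \sum_(y \in split_data k p) ysign k p y *: alternant (p + m) (yexp k p q y).
Proof.
move=> km; rewrite -block_expansion // [LHS]mulrA vdm_groth; last first.
  have := rect_shape p q; rewrite -prow_rect => /shape_size[h _].
  exact: leq_trans h (leq_addr _ _).
rewrite prow_rect /alternant mulrC -alt_sym; last by move=> s; exact: groth_unsgn_sym.
by congr alt; rewrite mulrC -mulrA.
Qed.
End Alternants.

(** * Straightening alternants *)

Local Open Scope ring_scope.

Section LinearExtension.
Variables (K : choiceType) (R : lmodType int) (G : K -> R).
Implicit Types a b : {malg int[K]}.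

Definition lext a : R := \sum_(l <- msupp a) a@_l *: G l.

Lemma lextW a (D : {fset K}) : (msupp a `<=` D)%fset -> lext a = \sum_(l <- D) a@_l *: G l.
Proof.
move=> h; rewrite /lext (big_fset_incl _ h) // => l _ nl.
by rewrite (mcoeff_outdom nl) scale0r.
Qed.

Lemma lextD a b : lext (a + b) = lext a + lext b.
Proof.
pose D := (msupp a `|` msupp b)%fset.
rewrite (@lextW a D) ?fsubsetUl // (@lextW b D) ?fsubsetUr // (@lextW (a + b) D) ?msuppD_le //.
by rewrite -big_split; apply: eq_bigr => l _; rewrite mcoeffD scalerDl.
Qed.

Lemma lext0 : lext 0 = 0.
Proof. by rewrite /lext msupp0 big_seq_fset0. Qed.

Lemma lextZ c a : lext (c *: a) = c *: lext a.
Proof.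
have h : (msupp (c *: a) `<=` msupp a)%fset.
  by apply/fsubsetP => l; rewrite -!mcoeff_neq0 mcoeffZ mulf_eq0 negb_or => /andP[].
rewrite (lextW h) /lext scaler_sumr; apply: eq_bigr => l _.
by rewrite mcoeffZ scalerA.
Qed.

Lemma lextU l : lext << l >> = G l.
Proof. by rewrite (@lextW _ [fset l]%fset) ?msuppU_le // big_seq_fset1 mcoeffUU scale1r. Qed.

Lemma lextB a b : lext (a - b) = lext a - lext b.
Proof. by apply: (addIr (lext b)); rewrite -lextD !subrK. Qed.

Lemma lext_sum (I : Type) (r : seq I) (P : pred I) (F : I -> {malg int[K]}) :
  lext (\sum_(i <- r | P i) F i) = \sum_(i <- r | P i) lext (F i).
Proof. exact: (big_morph lext lextD lext0). Qed.
End LinearExtension.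

Definition gcoef (a : Gamma) (l : part) : int := a@_l.

Lemma gcoefD a b l : gcoef (a + b) l = gcoef a l + gcoef b l. Proof. exact: mcoeffD. Qed.
Lemma gcoefB a b l : gcoef (a - b) l = gcoef a l - gcoef b l. Proof. exact: mcoeffB. Qed.
Lemma gcoefU l l' : gcoef << l >> l' = (l == l')%:R. Proof. by rewrite /gcoef mcoeffU. Qed.

Section Straightening.
Import fingroup perm mpoly.

Definition gpoly n (a : Gamma) : mpoly n int := lext (groth_trunc n) a.

Lemma upd_id al j : upd al j (al j) (al j.+1) = al.
Proof. by apply/funext => i; rewrite /upd; case: eqP => [->//|_]; case: eqP => [->|]. Qed.

(** The relation [alternant_swap] with s = al j and t + 1 = al (j + 1), solved for
its first term.  When t = s it reads 2 X = 0 for the difference X of the two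
alternants. *)
Lemma alternant_step n al j : (j.+1 < n)%N -> (al j < al j.+1)%N ->
  alternant n al = if al j.+1 == (al j).+1 then alternant n (upd al j (al j).+1 (al j.+1))
    else alternant n (upd al j (al j).+1 (al j.+1)) - alternant n (upd al j (al j.+1).-1 (al j).+1)
       + alternant n (upd al j (al j.+1) (al j).+1).
Proof.
move=> jn lt; have [b eb] : exists b, al j.+1 = b.+1 by exists (al j.+1).-1; lia.
have := @alternant_swap n al j (al j) b jn; rewrite -eb upd_id.
case: eqP => [e|_] H.
  have e' : b = al j by lia.
  by move: H; rewrite e' -e upd_id => /(@int_poly_opp 0 n)/eqP; rewrite subr_eq0 => /eqP.
by rewrite -[LHS](subrK (alternant n (upd al j (al j).+1 (al j.+1)))) H eb /= opprB addrC addrA addrAC.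
Qed.

(** A weighted sum with weights decreasing by one: it grows when the first of two
adjacent exponents grows and their sum does not decrease. *)
Definition wsum K (al : nat -> nat) := (\sum_(i < K) (K - i) * al i)%N.

Lemma wsum_upd K al j x y : (j.+1 < K)%N -> (al j < x)%N -> (al j + al j.+1 <= x + y)%N ->
  (wsum K al < wsum K (upd al j x y))%N.
Proof.
move=> jK ax le; pose i0 := Ordinal (ltnW jK); pose i1 := Ordinal jK.
have n01 : i1 != i0 by rewrite -val_eqE /=; lia.
rewrite /wsum (bigD1 i0) //= (bigD1 i1) //= [X in (_ < X)%N](bigD1 i0) //= [X in (_ < _ + X)%N](bigD1 i1) //=.
rewrite {1 2}/upd eqxx (gtn_eqF (ltnSn j)) eqxx !addnA.
rewrite (eq_bigr (fun i : 'I_K => (K - i) * upd al j x y i)%N); last first.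
  by move=> i /andP[h0 h1]; rewrite /upd -!val_eqE /= in h0 h1 *; rewrite (negbTE h0) (negbTE h1).
rewrite ltn_add2r (_ : K - j = (K - j.+1).+1)%N; last by lia.
rewrite !mulSn; set w := (K - j.+1)%N.
have : (w * (al j + al j.+1) <= w * (x + y))%N by rewrite leq_mul2l le orbT.
by rewrite !mulnDr; lia.
Qed.

Lemma wsum_le K al M : (forall i, al i <= M)%N -> (wsum K al <= K * K * M)%N.
Proof.
move=> h; rewrite /wsum -mulnA -[X in (_ <= X * _)%N]card_ord -sum_nat_const.
by apply: leq_sum => i _; apply: leq_mul => //; apply: leq_subr.
Qed.

(** The second clause keeps the partitions that arise from exponents that are not
decreasing away from the coefficient that is needed later: exponents at least q
before position p, and above q at position p, remain so. *)
Definition straightened K al (a : Gamma) : Prop :=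
  [/\ forall n, (K <= n)%N -> alternant n al = vdm n * gpoly n a,
   forall p q, (forall j, j < p -> q <= al j)%N -> (q < al p)%N ->
     forall l, (prow l p <= q)%N -> gcoef a l = 0 &
   (forall i, al i.+1 <= al i)%N -> a = << shape_part K al >>].

(** Straightening an ascent replaces both entries by larger ones than the smaller of
the two. *)
Lemma upd_bounds al j x y p q : (al j < x)%N -> (al j < y)%N ->
  (forall i, i < p -> q <= al i)%N -> (q < al p)%N ->
  (forall i, i < p -> q <= upd al j x y i)%N /\ (q < upd al j x y p)%N.
Proof.
move=> ax ay h hp; split=> [i ip|]; rewrite /upd.
  case: eqP => [e|_]; first by have := h i ip; rewrite e; lia.
  case: eqP => [e|_]; last exact: h.
  by have := h j ltac:(lia); lia.
case: eqP => [e|_]; first by rewrite e in hp; lia.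
by case: eqP => [e|_] //; have := h j ltac:(lia); lia.
Qed.

(** An ascent is removed by [alternant_step].  Each step raises [wsum] while the
maximum of the exponents does not grow, and both exponents involved become larger
than the smaller of the two was. *)
Lemma straighten K al : (forall i, (K <= i)%N -> al i = 0%N) -> exists a, straightened K al a.
Proof.
(* the exponents stay bounded by M, so wsum stays bounded by K * K * M *)
pose M := (\max_(i < K) al i)%N => sup.
have bd i : (al i <= M)%N.
  have [lt|ge] := ltnP i K; last by rewrite sup.
  exact: (leq_bigmax (Ordinal lt)).
move: M bd => M; have [d] := ubnP (K * K * M - wsum K al)%N.
elim: d al sup => // d IH al sup le bd.
have [dec|] := pselect (forall i, (al i.+1 <= al i)%N).
  exists << shape_part K al >>.
  have sh : row_shape K M al by split.
  split=> // [n Kn|p q _ qp l lp].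
    have sh' : row_shape K M (prow (shape_part K al)) by rewrite (prow_shape_part sh).
    have [h _] := shape_size sh'.
    by rewrite /gpoly lextU vdm_groth ?(prow_shape_part sh) // (leq_trans h).
  rewrite gcoefU; case: eqP => // e.
  by move: lp; rewrite -e (prow_shape_part sh) leqNgt qp.
move=> nd; have [j lt] : exists j, (al j < al j.+1)%N.
  apply: contrapT => no; apply: nd => i; rewrite leqNgt; apply/negP => h; apply: no; by exists i.
have jK : (j.+1 < K)%N by rewrite ltnNge; apply/negP => h; rewrite (sup _ h) in lt.
have next x y : (al j < x <= M)%N -> (al j < y <= M)%N -> (al j + al j.+1 <= x + y)%N ->
    exists a, straightened K (upd al j x y) a.
  move=> /andP[x1 x2] /andP[y1 y2] xy; apply: IH.
  - move=> i Ki; rewrite /upd; case: eqP => [e|_]; first by lia.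
    by case: eqP => [e|_]; [lia|exact: sup].
  - have := wsum_upd jK x1 xy; have : (wsum K (upd al j x y) <= K * K * M)%N.
      apply: wsum_le => i; rewrite /upd; do 2! [case: eqP => // _]; exact: bd.
    move: le; set u := (K * K * M)%N; lia.
  - by move=> i; rewrite /upd; do 2! [case: eqP => // _].
have bj := bd j.+1.
have [a1 [p1 q1 _]] := next (al j).+1 (al j.+1) ltac:(lia) ltac:(lia) ltac:(lia).
have [e|ne] := eqVneq (al j.+1) (al j).+1.
  exists a1; split=> [n Kn|p q h hp l lp|dec]; last by have := dec j; lia.
    by rewrite (alternant_step (leq_trans jK Kn) lt) e eqxx -{2}e p1.
  have [h1 h2] := upd_bounds (j := j) (x := (al j).+1) (y := al j.+1) (ltnSn _) lt h hp.
  exact: q1 h1 h2 l lp.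
have [a2 [p2 q2 _]] := next (al j.+1).-1 (al j).+1 ltac:(lia) ltac:(lia) ltac:(lia).
have [a3 [p3 q3 _]] := next (al j.+1) (al j).+1 ltac:(lia) ltac:(lia) ltac:(lia).
exists (a1 - a2 + a3); split=> [n Kn|p q h hp l lp|dec]; last by have := dec j; lia.
  rewrite (alternant_step (leq_trans jK Kn) lt) (negbTE ne) p1 // p2 // p3 //.
  by rewrite /gpoly lextD lextB mulrDr mulrBr.
have B x y (hx : (al j < x)%N) (hy : (al j < y)%N) := upd_bounds hx hy h hp.
have [h1 h1'] := B (al j).+1 (al j.+1) (ltnSn _) lt.
have [h2 h2'] := B (al j.+1).-1 (al j).+1 ltac:(lia) (ltnSn _).
have [h3 h3'] := B (al j.+1) (al j).+1 lt (ltnSn _).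
by rewrite gcoefD gcoefB (q1 _ _ h1 h1' l lp) (q2 _ _ h2 h2' l lp) (q3 _ _ h3 h3' l lp).
Qed.
End Straightening.

(** * Uniqueness of expansions *)

Local Open Scope ring_scope.

Definition gsupp (a : Gamma) : {fset part} := msupp a.

Lemma gsuppP a l : (l \in gsupp a) = (gcoef a l != 0).
Proof. by rewrite /gcoef /gsupp mcoeff_neq0. Qed.

Lemma gamma_seriesE a m : gamma_series a m = \sum_(l <- gsupp a) gcoef a l * groth l m.
Proof. by []. Qed.

Lemma gcoef_ext a b : gcoef a =1 gcoef b -> a = b.
Proof. by move=> E; apply/malgP. Qed.

(** Monomials in x_1, ..., x_n. *)
Definition bounded_mon n (m : {cmonom nat}) : Prop := m 0%N = 0%N /\ forall i, (n < i)%N -> m i = 0%N.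

Lemma bounded_ex (m : {cmonom nat}) n0 : m 0%N = 0%N -> exists2 n, (n0 <= n)%N & bounded_mon n m.
Proof.
move=> m0; exists (n0 + \max_(i <- finsupp m) i)%N; first exact: leq_addr.
split=> // i lt; apply/eqP; rewrite cmE_eq0; apply/negP => im.
suff : (i <= \max_(i <- finsupp m) i)%N by lia.
by rewrite (big_fsetD1 i) //= leq_maxl.
Qed.

Lemma mmul_bounded n (u v m : {cmonom nat}) : mmul u v = m -> bounded_mon n m ->
  bounded_mon n u /\ bounded_mon n v.
Proof.
move=> <- [m0 mn]; have E i : mmul u v i = (u i + v i)%N by rewrite cmM.
split; split=> [|i lt]; [move: m0|move: (mn i lt)|move: m0|move: (mn i lt)]; rewrite E; lia.
Qed.

Lemma gcoef0 l : gcoef 0 l = 0. Proof. exact: mcoeff0. Qed.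

Section Coefficients.
Import fingroup perm mpoly.

Definition liftm n (k : 'X_{1..n}) : {cmonom nat} :=
  \big[mmul/mone]_(i < n) \big[mmul/mone]_(j < k i) ucm i.+1.

Lemma liftmE n (k : 'X_{1..n}) i : liftm k i = \sum_(j < n | j.+1 == i) k j :> nat.
Proof.
rewrite /liftm cm_big [RHS]big_mkcond; apply: eq_bigr => j _; rewrite cm_big.
under eq_bigr do rewrite ucmE.
by rewrite sum_nat_const card_ord; case: eqP => _; rewrite ?muln1 ?muln0.
Qed.

Lemma liftm_bounded n (k : 'X_{1..n}) : bounded_mon n (liftm k).
Proof.
split=> [|i lt]; rewrite liftmE big1 // => j /eqP e.
by have := ltn_ord j; lia.
Qed.

Lemma liftmK n (k : 'X_{1..n}) : mlow n (liftm k) = k.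
Proof.
apply/mnmP => i; rewrite mnmE liftmE (big_pred1 i) //.
Qed.

Lemma mlowK n m : bounded_mon n m -> liftm (mlow n m) = m.
Proof.
move=> [m0 mn]; apply/eqP/cmP => -[|i]; first by have [-> _] := liftm_bounded (mlow n m).
have [lt|ge] := ltnP i n; last by have [_ ->] := liftm_bounded (mlow n m); rewrite // mn.
by have /mnmP/(_ (Ordinal lt)) := liftmK (mlow n m); rewrite !mnmE.
Qed.

Lemma mlowM n u v : mlow n (mmul u v) = (mlow n u + mlow n v)%MM.
Proof. by apply/mnmP => i; rewrite mnmDE !mnmE cmM. Qed.

Lemma gamma_coef n a m : bounded_mon n m -> gamma_series a m = (gpoly n a)@_(mlow n m).
Proof.
move=> [m0 mn]; rewrite gamma_seriesE /gpoly /lext linear_sum /=.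
by apply: eq_bigr => l _; rewrite mcoeffZ (groth_coef l m0 mn).
Qed.

Lemma gamma_coef0 a (m : {cmonom nat}) : m 0%N != 0%N -> gamma_series a m = 0.
Proof. by move=> h; rewrite gamma_seriesE big1 // => l _; rewrite groth_coef0 ?mulr0. Qed.

(** The factors of a monomial in x_1, ..., x_n are such monomials too. *)
Lemma psmul_coef n l k m : bounded_mon n m ->
  psmul (groth l) (groth k) m = (groth_trunc n l * groth_trunc n k)@_(mlow n m).
Proof.
move=> bm; rewrite mcoeffM.
pose d := (mdeg (mlow n m)).+1.
pose P := [set k : 'X_{1..n < d} * 'X_{1..n < d} | mlow n m == (k.1 + k.2)%MM]%classic.
rewrite [RHS]finsum_fs /psmul.
rewrite (reindex_fsbig (fun k : 'X_{1..n < d} * 'X_{1..n < d} =>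
   (liftm k.1, liftm k.2) : {cmonom nat} * {cmonom nat}) P).
  apply: eq_fsbigr => -[k1 k2] /= _.
  have [b1 b1'] := liftm_bounded k1; have [b2 b2'] := liftm_bounded k2.
  by rewrite (groth_coef l b1 b1') (groth_coef k b2 b2') !liftmK.
split.
- move=> [k1 k2] /= /eqP e; rewrite -(mlowK bm) e; apply/eqP/cmP => i.
  by rewrite cmM !liftmE -big_split; apply: eq_bigr => j _; rewrite mnmDE.
- move=> [k1 k2] [k3 k4] _ _ /= [e1 e2].
  congr (_, _); apply: val_inj; rewrite /= -[LHS]liftmK -[RHS]liftmK ?e1 ?e2 //.
- move=> [u v] /= e; have [bu bv] := mmul_bounded e bm.
  have E : mlow n m = (mlow n u + mlow n v)%MM by rewrite -e mlowM.
  have dE : mdeg (mlow n m) = (mdeg (mlow n u) + mdeg (mlow n v))%N by rewrite E mdegD.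
  have du : (mdeg (mlow n u) < d)%N by rewrite ltnS dE leq_addr.
  have dv : (mdeg (mlow n v) < d)%N by rewrite ltnS dE leq_addl.
  exists (BMultinom du, BMultinom dv); first exact/eqP/E.
  by rewrite /= !mlowK.
Qed.

Lemma psmul_coef0 l k (m : {cmonom nat}) : m 0%N != 0%N -> psmul (groth l) (groth k) m = 0.
Proof.
move=> m0; apply: fsbig1 => -[u v] /= e.
have : (u 0%N != 0%N) || (v 0%N != 0%N).
  by move: m0; rewrite -e cmM; case: (u 0%N).
by case/orP => h; [rewrite (groth_coef0 l h) mul0r|rewrite (groth_coef0 k h) mulr0].
Qed.

Lemma gpoly_series a b n : gamma_series a = gamma_series b -> gpoly n a = gpoly n b.
Proof.
move=> E; apply/mpolyP => k; have bender_knuth := liftm_bounded k.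
by rewrite -[k]liftmK -!gamma_coef // E.
Qed.

Lemma vdm_gpoly n a : (forall l, l \in gsupp a -> (size l <= n)%N) ->
  vdm n * gpoly n a = \sum_(l <- gsupp a) gcoef a l *: alternant n (prow l).
Proof.
move=> h; rewrite /gpoly /lext mulr_sumr; apply: eq_big_seq => l la.
by rewrite -scalerAr vdm_groth // h.
Qed.

(** For l0 of minimal size in the support, the coefficient at x^(l0 + delta) of
[vdm] times the polynomial is the coefficient of l0. *)
Lemma gpoly_inj a n : (forall l, l \in gsupp a -> (size l <= n)%N) -> gpoly n a = 0 -> a = 0.
Proof.
move=> h z; apply: gcoef_ext => l; rewrite gcoef0.
have [//|nz] := eqVneq (gcoef a l) 0; exfalso; rewrite -gsuppP in nz.
have [l0 l0a M] : exists2 l0, l0 \in gsupp a & forall l, l \in gsupp a -> (psize l0 <= psize l)%N.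
  case: (@arg_minnP _ (FSetSub nz) xpredT (fun l : gsupp a => psize (fsval l)) isT) => i _ Mi.
  by exists (fsval i) => [|l' la]; [exact: fsvalP|exact: (Mi (FSetSub la))].
have := vdm_gpoly h; rewrite z mulr0 => /(congr1 (mcoeff [multinom (prow l0 i + (n.-1 - i))%N | i < n])).
rewrite mcoeff0 linear_sum /= (big_fsetD1 l0) //= mcoeffZ alternant_coef; last 3 first.
- by move=> i j; apply: prow_dec.
- by move=> i j; apply: prow_dec.
- by [].
have -> : [forall i : 'I_n, prow l0 i == prow l0 i] by apply/forallP.
rewrite mulr1 big1_seq ?addr0 => [E|l' /andP[_]].
  by move: l0a; rewrite gsuppP -E eqxx.
rewrite in_fsetD1 => /andP[ne la]; rewrite mcoeffZ alternant_coef; last 3 first.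
- by move=> i j; apply: prow_dec.
- by move=> i j; apply: prow_dec.
- by rewrite -!psizeE ?h ?M.
case: forallP => [E|]; last by rewrite mulr0.
case/eqP: ne; apply: part_ext => i; have [lt|ge] := ltnP i n.
  exact/eqP/(E (Ordinal lt)).
by rewrite /prow !nth_default // (leq_trans (h _ _) ge).
Qed.

Lemma gamma_series_inj : injective gamma_series.
Proof.
move=> a b E; apply/eqP; rewrite -subr_eq0; apply/eqP.
pose n := (\max_(l <- gsupp (a - b)%R) size l)%N.
apply: (@gpoly_inj _ n) => [l la|]; first by rewrite /n (big_fsetD1 l) //= leq_maxl.
by rewrite /gpoly lextB -/(gpoly n a) -/(gpoly n b) (gpoly_series _ E) subrr.
Qed.

(** A power series identity may be checked on one monomial at a time, in as many
variables as it needs, so the identity in all large numbers of variables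
suffices. *)
Lemma groth_mul_eq l k a n0 : (forall n, (n0 <= n)%N -> gpoly n a = groth_trunc n l * groth_trunc n k) ->
  groth_mul l k = a.
Proof.
move=> H; apply: gamma_series_inj.
have E : gamma_series a = psmul (groth l) (groth k).
  apply/funext => m; have [m0|m0] := eqVneq (m 0%N) 0%N; last first.
    by rewrite gamma_coef0 // psmul_coef0.
  have [n n0n bm] := bounded_ex n0 m0.
  by rewrite (gamma_coef a bm) (psmul_coef l k bm) H.
by rewrite E; apply: (@xgetPex _ 0 [set a : Gamma | gamma_series a = psmul (groth l) (groth k)]%classic); exists a.
Qed.
End Coefficients.

(** * The coproduct coefficients *)

Local Open Scope ring_scope.

(** The pairs (sigma, T) counted by d^n_(l m). *)
Definition skew_pairs (n l m : part) : set (part * filling) :=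
  [set sT | [/\ pincl sT.1 l && pincl l n, rook_strip (skew l sT.1),
    svt (skew n sT.1) sT.2, reverse_lattice (word sT.2) & has_content (word sT.2) m]]%classic.

Lemma prow_stack p q (l m : part) j : (prow l 0 <= q)%N ->
  prow (stack p q l m) j = (if j < p then q + prow m j else prow l (j - p))%N.
Proof.
move=> lq; have E i : nth 0%N ([seq (q + prow m i)%N | i <- iota 0 p] ++ l) i =
    (if i < p then q + prow m i else prow l (i - p))%N.
  rewrite nth_cat size_map size_iota; case: ltnP => // h.
  by rewrite (nth_map 0%N) ?size_iota // nth_iota.
rewrite prow_mkpart ?E //; apply/(sortedP 0%N) => i _; rewrite !E /=.
case: (ltnP i.+1 p) => h1; case: (ltnP i p) => h2; try lia.
- by rewrite leq_add2l prow_dec.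
- by apply: leq_trans (leq_addr _ _); apply: leq_trans lq; apply: prow_dec.
- by apply: prow_dec; lia.
Qed.

(** A lattice tableau has a partition as content: the balance at the end of the
reading. *)
Lemma ycont_dec n p y a : split_data n p y -> (ycont n y a.+1 <= ycont n y a)%N.
Proof.
move=> [_ _ sv rl _]; have Lf := (lattice_word (fun b => svt_bound sv)).1 rl.
have [_ Tf] := (svt_tab y.1.2 n y.2).1 sv.
have := balance (part_shape_self n) Tf (a := a) (r0 := size n) (c0 := 0) (fun r c _ => Lf r c a).
have E b : wcont (size n) (prow n 0) (bef (size n) 0) (tabF y.2) b = ycont n y b.
  by apply: eq_wcont => r c rn _; rewrite /bef rn.
by rewrite !E.
Qed.

Lemma ycont_out n p y a : split_data n p y -> (p <= a)%N -> ycont n y a = 0%N.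
Proof. by move=> [_ _ _ _ lt] pa; exact: (cont_big _ _ lt pa). Qed.

Lemma content_cnt n s (F : filling) m : svt (skew n s) F ->
  has_content (word F) m <-> forall a, cont (size n) (prow n 0) (tabF F) a = prow m a.
Proof.
move=> sv; have E a := word_count (fun b => svt_bound sv) a.
by split=> H a; [rewrite -E|rewrite E].
Qed.

Lemma gcoef_sum (I : eqType) (r : seq I) (c : I -> int) (F : I -> Gamma) l :
  gcoef (\sum_(i <- r) c i *: F i) l = \sum_(i <- r) c i * gcoef (F i) l.
Proof. by rewrite /gcoef raddf_sum /=; apply: eq_bigr => i _; rewrite mcoeffZ. Qed.

Section DGformula.
Import fingroup perm mpoly.
Variables (n l m : part).
Let p := maxn (size l) (size m).
Let q := maxn (prow l 0) (prow m 0).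
Let K := (p + size n)%N.

Let target : set (part * part * filling) :=
  [set y | y.1.1 = l /\ forall a, ycont n y a = prow m a]%classic.

(** If lambda does not fit below the rectangle with q columns, straightening only
gives partitions whose part number p+1 exceeds q, whereas that part of the index
in question is at most q.  Otherwise the exponents form a partition, which has
to be compared with (q + m, l). *)
Lemma straight_coef y (a : Gamma) : split_data n p y -> straightened K (yexp n p q y) a ->
  gcoef a (stack p q l m) = `[< target y >]%:R.
Proof.
move=> Yy [_ P2 P3]; have lq : (prow l 0 <= q)%N by exact: leq_maxl.
have [qy|yq] := ltnP q (prow y.1.1 0).
  rewrite (P2 p q); first last.
  - by rewrite prow_stack // ltnn subnn.
  - by rewrite /yexp ltnn subnn.
  - by move=> j jp; rewrite /yexp jp leq_addr.
  by rewrite asboolF // => -[e _]; rewrite e ltnNge lq in qy.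
have dec i : (yexp n p q y i.+1 <= yexp n p q y i)%N.
  rewrite /yexp; case: (ltnP i.+1 p) => h1; case: (ltnP i p) => h2; try lia.
  - by rewrite leq_add2l; apply: ycont_dec Yy.
  - by apply: leq_trans (leq_addr _ _); apply: leq_trans yq; apply: prow_dec.
  - by apply: prow_dec; lia.
have yn : forall r, (prow y.1.1 r <= prow n r)%N by case: Yy => /andP[_ /pinclP].
have sh : row_shape K (yexp n p q y 0) (yexp n p q y).
  split=> // [r Kr|r].
    rewrite /yexp ltnNge (leq_trans (leq_addr _ _) Kr) /=.
    have : (prow n (r - p) = 0)%N by rewrite /prow nth_default //; move: Kr; rewrite /K; lia.
    by move=> z; apply/eqP; rewrite -leqn0 -z yn.
  by elim: r => // r IH; apply: leq_trans (dec r) IH.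
rewrite (P3 dec) gcoefU; congr (nat_of_bool _)%:R.
apply/eqP/asboolP => [e|[e1 e2]].
  have E j : yexp n p q y j = prow (stack p q l m) j by rewrite -e (prow_shape_part sh).
  split.
    apply: part_ext => i; have := E (p + i)%N; rewrite prow_stack // /yexp.
    by rewrite ltnNge leq_addr /= addKn.
  move=> b; have [lt|ge] := ltnP b p.
    by have := E b; rewrite prow_stack // /yexp lt => /addnI.
  by rewrite (ycont_out Yy ge) /prow nth_default // (leq_trans _ ge) // leq_maxr.
apply: part_ext => i; rewrite (prow_shape_part sh) prow_stack // /yexp.
by rewrite e1; case: ltnP => // _; rewrite e2.
Qed.

Lemma dG_sum : dG n l m = \sum_(y \in split_data n p) (ysign n p y * (-1) ^+ psize n) * `[< target y >]%:R.
Proof.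
have straight y : exists a, split_data n p y -> straightened K (yexp n p q y) a.
  have [Yy|nY] := pselect (split_data n p y); last by exists 0.
  have [|a sa] := @straighten K (yexp n p q y); last by exists a.
  move=> i Ki; rewrite /yexp ltnNge (leq_trans (leq_addr _ _) Ki) /=.
  have yn : forall r, (prow y.1.1 r <= prow n r)%N by case: Yy => /andP[_ /pinclP].
  have : (prow n (i - p) = 0)%N by rewrite /prow nth_default //; move: Ki; rewrite /K; lia.
  by move=> z; apply/eqP; rewrite -leqn0 -z yn.
have [st Hst] := choice straight.
have fin : finite_set (split_data n p) by exact: (@split_data_finite p (size n) n).
pose c y := ysign n p y * (-1) ^+ psize n.
pose a : Gamma := \sum_(y <- fset_set (split_data n p)) c y *: st y.
rewrite fsbig_finite // /dG -/p -/q /cG (@groth_mul_eq _ _ a K).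
  rewrite -/(gcoef a _) /a gcoef_sum; apply: eq_big_seq => y; rewrite in_fset_set // => /set_mem Yy.
  by rewrite (straight_coef Yy (Hst y Yy)).
move=> N KN; apply: (mulfI (vdm_neq0 N)).
have eN : N = (p + (N - p))%N by move: KN; rewrite /K; lia.
have nN : (size n <= N - p)%N by move: KN; rewrite /K; lia.
rewrite /groth_trunc -scalerAr -scalerAr -/(groth_trunc N (rect p q)).
have := product_expansion p q nN; rewrite -eN => ->.
rewrite fsbig_finite // /gpoly /a lext_sum mulr_sumr scaler_sumr.
apply: eq_big_seq => y; rewrite in_fset_set // => /set_mem Yy.
rewrite lextZ -scalerAr -/(gpoly N (st y)); have [-> // _ _] := Hst y Yy.
by rewrite /c [ysign _ _ _ * _]mulrC -scalerA.
Qed.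

Lemma target_sign y : target y -> split_data n p y ->
  ysign n p y * (-1) ^+ psize n = (-1) ^+ (psize l + psize m + psize n).
Proof.
move=> [e1 e2] Yy; rewrite /ysign e1 -exprD; congr (_ ^+ (_ + _ + _)).
rewrite (@psizeE _ p) ?leq_maxr //; apply: eq_bigr => a _; exact: e2.
Qed.

Lemma skew_pairs_image : skew_pairs n l m = ((fun y => (y.1.2, y.2)) @` (split_data n p `&` target))%classic.
Proof.
apply/seteqP; split=> [[s F] [/= sl rk_ sv rl hc]|sF [y [[sl rk_ sv rl lt] [e1 e2]] <-]].
  have H := (content_cnt m sv).1 hc.
  exists (l, s, F) => //; split=> //; split=> // r c a fa.
  rewrite ltnNge; apply/negP => pa; have := H a.
  rewrite [prow m a]nth_default ?(leq_trans (leq_maxr _ _) pa) //.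
  have /andP[rn cn] := tab_bound (part_shape_self n) ((svt_tab s n F).1 sv).2 fa.
  rewrite /cont /wcont (bigD1 (Ordinal rn)) //= (bigD1 (Ordinal cn)) //= fa; lia.
split=> //=; first by rewrite -e1.
  by rewrite -e1.
exact/(content_cnt m sv).
Qed.

Lemma skew_pairs_finite : finite_set (skew_pairs n l m).
Proof.
rewrite skew_pairs_image; apply: finite_image; apply: sub_finite_set (@split_data_finite p (size n) n (leqnn _)).
by move=> y [].
Qed.

(** The sum of [dG_sum] restricted to the pairs with the right contents, all of which
have the same sign. *)
Lemma dG_formula : dG n l m =
  (-1) ^+ (psize l + psize m + psize n) * (#|` fset_set (skew_pairs n l m)|)%:Z.
Proof.
have fin : finite_set (split_data n p) by exact: (@split_data_finite p (size n) n).
have fin' : finite_set (split_data n p `&` target)%classic.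
  by apply: sub_finite_set fin => y [].
rewrite dG_sum skew_pairs_image fset_set_image // card_in_imfset; last first.
  move=> [[l1 s1] F1] [[l2 s2] F2]; rewrite !in_fset_set //.
  by move=> /set_mem [_ [/= -> _]] /set_mem [_ [/= -> _]] [-> ->].
transitivity (\sum_(y \in (split_data n p `&` target)%classic) (-1 : int) ^+ (psize l + psize m + psize n)).
  rewrite fsbig_mkcondr; apply: eq_fsbigr => y /set_mem Yy.
  rewrite -[y \in target]/(`[< target y >]).
  by case: asboolP => h; [rewrite mulr1 target_sign|rewrite mulr0].
by rewrite fsbig_finite // big_const_seq count_predT iter_addr_0 -mulr_natr natz.
Qed.
End DGformula.

(** * Coefficients of the iterated coproduct *)

Local Open Scope ring_scope.

(** A lattice tableau of shape n/sigma has a content contained in n, by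
[lattice_row] and [cont_le_row]. *)
Lemma skew_pairs_incl n l m sF : skew_pairs n l m sF -> pincl l n /\ pincl m n.
Proof.
case: sF => s F [/= /andP[sl ln] _ sv rl hc]; split=> //.
have bd := fun b => @svt_bound n s F b sv.
have Lf := (lattice_word bd).1 rl; have [_ Tf] := (svt_tab s n F).1 sv.
have sn : forall r, (prow s r <= prow n r)%N.
  by move=> r; apply: leq_trans (pinclP _ _ sl r) (pinclP _ _ ln r).
have Hn := part_shape_self n.
have Hs : row_shape (size n) (prow n 0) (prow s).
  have [h1 h2 h3] := Hn; split=> [r|r h|r]; first exact: prow_dec.
    by apply/eqP; rewrite -leqn0 -(h2 r h).
  exact: leq_trans (sn r) (h3 r).
apply/pinclP => a; rewrite -((content_cnt m sv).1 hc a).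
apply: (cont_le_row Hs Hn Tf) => r c fa.
exact: (lattice_row (M := a.+1) Tf (fun r c b _ => Lf r c b) (ltnSn a) fa).
Qed.

Lemma fset_set_nil (T : choiceType) (A : set T) : (forall x, ~ A x) -> #|` fset_set A| = 0%N.
Proof.
move=> h; have -> : A = set0 by apply/seteqP; split=> // x /h.
by rewrite fset_set0 cardfs0.
Qed.

(** No pair is counted; hence the sum defining [Delta] is finite. *)
Lemma dG_incl n l m : ~~ (pincl l n && pincl m n) -> dG n l m = 0.
Proof.
move=> h; rewrite dG_formula fset_set_nil ?mulr0 // => sF /skew_pairs_incl[h1 h2].
by rewrite h1 h2 in h.
Qed.

Lemma pincl_finite n : finite_set [set l | pincl l n]%classic.
Proof.
pose g (u : {ffun 'I_(size n) -> 'I_(prow n 0).+1}) : part :=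
  shape_part (size n) (fun r => if insub r is Some i then u i : nat else 0%N).
apply: (@sub_finite_set _ _ (g @` setT)%classic); last first.
  by apply: finite_image; apply: finite_finset.
move=> l /= /pinclP ln; exists [ffun i : 'I_(size n) => inord (prow l i)] => //.
apply: part_ext => r; rewrite /g.
have [h1 h2 h3] := part_shape_self n.
set w := fun r => _; have -> : w = prow l; last first.
  rewrite (@prow_shape_part _ (prow n 0)) //; split=> [i|i h|i]; first exact: prow_dec.
    by apply/eqP; rewrite -leqn0 -(h2 i h).
  exact: leq_trans (ln i) (h3 i).
apply/funext => i; rewrite /w; case: insubP => [j _ ej|]; last first.
  by rewrite -leqNgt => h; symmetry; apply/eqP; rewrite -leqn0 -(h2 i h).
by rewrite ffunE ej inordK // ltnS; apply: leq_trans (ln i) (h3 i).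
Qed.

Lemma mcoeff_fsum (K : choiceType) (d : K -> int) (A : {fset K}) k0 :
  (forall k, k \notin A -> d k = 0) ->
  (\sum_(k \in [set: K]%classic) (<< d k *g k >> : {malg int[K]}))@_k0 = d k0.
Proof.
move=> h; rewrite (fsbigTE A) => [|k /h ->]; last by apply/malgP => j; rewrite mcoeffU mcoeff0 mul0rn.
rewrite raddf_sum /=; have [kA|kA] := boolP (k0 \in A).
  rewrite (big_fsetD1 k0) //= mcoeffUU big1_seq ?addr0 // => k /andP[_].
  by rewrite in_fsetD1 => /andP[/negbTE ne _]; rewrite mcoeffU ne.
rewrite h // big1_seq // => k /andP[_ kA']; rewrite mcoeffU; case: eqP => // e.
by rewrite e (negbTE kA) in kA'.
Qed.

Lemma linextU (K L : choiceType) (f : K -> {malg int[L]}) k : linext f << k >> = f k.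
Proof. exact: (lextU f k). Qed.

Lemma Delta_coef n l m : (Delta << n >>)@_(l, m) = dG n l m.
Proof.
rewrite /Delta linextU.
have fin : finite_set ([set l | pincl l n] `*` [set l | pincl l n])%classic.
  by apply: finite_setX; apply: pincl_finite.
rewrite (mcoeff_fsum (A := fset_set ([set l | pincl l n] `*` [set l | pincl l n])%classic)) // => -[k1 k2].
rewrite in_fset_set // => h; apply: dG_incl; apply: contra h => /andP[h1 h2].
exact/mem_set.
Qed.

Lemma tensor_coef (K L : choiceType) (a : {malg int[K]}) (b : {malg int[L]}) k l :
  (tensor a b)@_(k, l) = a@_k * b@_l.
Proof.
rewrite /tensor raddf_sum /=.
have E k' : (\sum_(l' <- msupp b) << a@_k' * b@_l' *g (k', l') >>)@_(k, l) =
    (a@_k' * b@_l) *+ (k' == k).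
  rewrite raddf_sum /=; have [lb|lb] := boolP (l \in msupp b).
    rewrite (big_fsetD1 l) //= mcoeffU xpair_eqE eqxx andbT big1_seq ?addr0 // => l' /andP[_].
    by rewrite in_fsetD1 => /andP[/negbTE ne _]; rewrite mcoeffU xpair_eqE ne andbF.
  rewrite (mcoeff_outdom lb) mulr0 mul0rn big1_seq // => l' /andP[_ lb'].
  rewrite mcoeffU xpair_eqE; case: eqP => //= _; case: eqP => // e.
  by rewrite e (negbTE lb) in lb'.
rewrite (eq_bigr _ (fun k' _ => E k')); have [ka|ka] := boolP (k \in msupp a).
  rewrite (big_fsetD1 k) //= eqxx big1_seq ?addr0 // => k' /andP[_].
  by rewrite in_fsetD1 => /andP[/negbTE ne _]; rewrite ne.
rewrite (mcoeff_outdom ka) mul0r big1_seq // => k' /andP[_ ka']; case: eqP => // e.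
by rewrite e (negbTE ka) in ka'.
Qed.

(** Only kappa contained in R contribute, by [dG_incl]. *)
Lemma Delta2_coef R l m n : (Delta2 << R >>)@_(l, m, n) =
  \sum_(k <- fset_set [set k | pincl k R]%classic) dG R k n * dG k l m.
Proof.
set D1 := fset_set _; rewrite /Delta2 /tensor_map /linext raddf_sum /=.
set X := Delta << R >>.
pose F (kl : part * part) := dG R kl.1 kl.2 * (dG kl.1 l m * (kl.2 == n)%:R).
have XE kl : X@_kl = dG R kl.1 kl.2 by case: kl => k1 k2; exact: Delta_coef.
have -> : \sum_(kl <- msupp X) (X@_kl *: tensor (Delta << kl.1 >>) << kl.2 >>)@_(l, m, n) =
    \sum_(kl <- msupp X) F kl.
  apply: eq_bigr => -[k1 k2] _; rewrite mcoeffZ tensor_coef XE Delta_coef /F /=.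
  by rewrite mcoeffU.
pose D := ((fun k => (k, n)) @` D1)%fset.
have inD1 k : (k \in D1) = pincl k R.
  rewrite /D1 in_fset_set; last exact: pincl_finite.
  by apply/idP/idP => [/set_mem|h]; [|apply/mem_set].
have -> : \sum_(kl <- msupp X) F kl = \sum_(kl <- (msupp X `|` D)%fset) F kl.
  apply: big_fset_incl; first exact: fsubsetUl.
  by move=> kl _ nX; rewrite /F -XE mcoeff_outdom ?mul0r.
have <- : \sum_(kl <- D) F kl = \sum_(kl <- (msupp X `|` D)%fset) F kl.
  apply: big_fset_incl; first exact: fsubsetUr.
  move=> [k1 k2] _ nD; rewrite /F /=; have [e|_] := eqVneq k2 n; last by rewrite !mulr0.
  rewrite dG_incl ?mul0r // e; apply: contra nD => /andP[h _].
  by apply/imfsetP; exists k1; rewrite ?inD1 // e.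
rewrite big_imfset /=; last by move=> k k' _ _ [].
by apply: eq_bigr => k _; rewrite /F /= eqxx mulr1.
Qed.

(** * The coproduct of a rectangle *)

Local Open Scope ring_scope.

(** Condition (ii) is rephrased by the complement of nu in the rectangle, rotated. *)
Section Complement.
Local Open Scope nat_scope.
Variables (p q : nat) (nu : part).
Hypothesis nR : pincl nu (rect p q).

Definition compf r := if r < p then q - prow nu (p - r.+1) else 0.

Lemma nu_le r : prow nu r <= rect_rows p q r.
Proof. by rewrite -prow_rect; apply: (pinclP _ _ nR). Qed.

Lemma compf_shape : row_shape p q compf.
Proof.
split=> [r|r h|r]; rewrite /compf.
- case: (ltnP r.+1 p) => // h; rewrite (ltnW h) leq_sub2l // prow_dec //; lia.
- by rewrite ltnNge h.
- by case: ifP => // _; exact: leq_subr.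
Qed.

Definition compl := shape_part p compf.

Lemma prow_compl : prow compl = compf.
Proof. exact: prow_shape_part compf_shape. Qed.

Lemma compfK r : r < p -> prow nu r = q - compf (p - r.+1).
Proof.
move=> rp; have := nu_le r; rewrite /rect_rows rp /compf (_ : p - r.+1 < p); last by lia.
by rewrite (_ : p - (p - r.+1).+1 = r); lia.
Qed.

Lemma in_rot (b : box) : (b \in rot_diag p q nu) = (b \in skew (rect p q) compl).
Proof.
case: b => r c; rewrite in_skew prow_rect prow_compl /= /rect_rows /compf.
apply/imfsetP/idP => [[[i j]] /=|].
  rewrite in_diag /= => ji [-> ->]; have := nu_le i; rewrite /rect_rows.
  case: (ltnP i p) => ip; last by lia.
  move=> le; rewrite (_ : p - i.+1 < p); last by lia.
  by rewrite (_ : p - (p - i.+1).+1 = i); lia.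
case: (ltnP r p) => // rp h; exists (p - r.+1, q - c.+1); last first.
  by congr (_, _) => /=; lia.
by rewrite in_diag /=; have := nu_le (p - r.+1); rewrite /rect_rows (_ : p - r.+1 < p); lia.
Qed.

Lemma rot_cover (k : part) : pincl k (rect p q) ->
  (diag k `|` rot_diag p q nu = diag (rect p q))%fset <-> pincl compl k.
Proof.
move=> kR; split=> [E|ck].
  apply/fsubsetP => b bc; have : b \in diag (rect p q).
    move: bc; rewrite !in_diag prow_compl prow_rect /compf /rect_rows; case: (ltnP b.1 p) => // _ h; apply: leq_trans h _; exact: leq_subr.
  rewrite -E in_fsetU => /orP[//|]; rewrite in_rot in_skew => /andP[h _].
  by move: bc; rewrite in_diag ltnNge h.
apply/fsetP => b; rewrite in_fsetU in_rot in_skew !in_diag.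
have := pinclP _ _ kR b.1; have := pinclP _ _ ck b.1.
move: (prow k _) (prow compl _) (prow (rect p q) _) => x y z yx xz.
by case: (ltnP b.2 x) => h1; case: (ltnP b.2 z) => h2; case: (leqP y b.2) => h3 //=; lia.
Qed.

Lemma rot_overlap (k : part) : pincl k (rect p q) ->
  (diag k `&` rot_diag p q nu = skew k compl)%fset.
Proof.
move=> kR; apply/fsetP => b; rewrite in_fsetI in_rot !in_skew in_diag.
have := pinclP _ _ kR b.1; move: (prow k _) (prow compl _) (prow (rect p q) _) => x y z xz.
by case: (ltnP b.2 x) => h1; case: (ltnP b.2 z) => h2; case: (leqP y b.2) => h3 //=; lia.
Qed.

Let rows := rect_rows p q.
Definition rotF : filling := filT (skew (rect p q) compl) p (rot_tab p q compf).

Lemma rot_tabF : tabF rotF = rot_tab p q compf.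
Proof.
apply: tabF_filT => r c a fa.
have [sup _ _ _] := rot_tableau compf_shape.
have h := sup _ _ _ fa; split; first by rewrite in_skew prow_rect prow_compl.
by have /andP[_ /eqP->] := fa; have := tab_bound (rect_shape p q) (rot_tableau compf_shape) fa; lia.
Qed.

Lemma rect_bd s (F : filling) : svt (skew (rect p q) s) F ->
  forall b : box, b \in finsupp F -> (b.1 < p) && (b.2 < q).
Proof.
move=> [-> _ _ _] b; rewrite in_skew prow_rect /rect_rows; case: (ltnP b.1 p) => _; [by case/andP|by rewrite ltn0 andbF].
Qed.

Lemma rotF_svt : svt (skew (rect p q) compl) rotF.
Proof.
apply/svt_tab; split; first by move=> b; exact: filT_pos.
by rewrite rot_tabF prow_compl prow_rect; exact: rot_tableau compf_shape.
Qed.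

(** By [rot_unique] the tableau is determined by sigma, and by [rot_cont] its content
is the rotated complement of sigma; hence sigma is the complement of nu. *)
Lemma skew_pairs_rect k sF : skew_pairs (rect p q) k nu sF <->
  [/\ pincl k (rect p q), pincl compl k, rook_strip (skew k compl) & sF = (compl, rotF)].
Proof.
case: sF => s F; split=> [[/= /andP[sk kR] rk_ sv rl hc]|[kR ck rk_ [-> ->]]].
  have bd := rect_bd sv.
  have Lf := (lattice_word bd).1 rl; have [z Tf] := (svt_tab s (rect p q) F).1 sv.
  have sR r : prow s r <= rows r.
    by rewrite /rows -prow_rect; apply: leq_trans (pinclP _ _ sk r) (pinclP _ _ kR r).
  have Hs : row_shape p q (prow s).
    split=> [r|r h|r]; first exact: prow_dec.
      by have := sR r; rewrite /rows /rect_rows ltnNge h /=; lia.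
    by have := sR r; rewrite /rows /rect_rows; case: ltnP; lia.
  rewrite prow_rect in Tf.
  have Ef := rot_unique Hs Tf Lf.
  have C a : prow nu a = if a < p then q - prow s (p - a.+1) else 0.
    by rewrite -(hc a) (word_count bd) Ef rot_cont.
  have es : s = compl.
    apply: part_ext => r; rewrite prow_compl /compf; case: (ltnP r p) => rp; last first.
      by case: Hs => _ -> .
    rewrite C (_ : p - r.+1 < p); last by lia.
    rewrite (_ : p - (p - r.+1).+1 = r); last by lia.
    by case: Hs => _ _ /(_ r); lia.
  rewrite -es; split=> //; congr (_, _).
  apply: fill_ext => // [b|]; first exact: filT_pos.
  by rewrite rot_tabF Ef es prow_compl.
have sv := rotF_svt; have bd := rect_bd sv.
split=> //=; first by rewrite ck.
- by apply/(lattice_word bd); rewrite rot_tabF => r c b; exact: rot_lattice compf_shape r c b.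
- move=> a; rewrite (word_count bd) rot_tabF (rot_cont compf_shape).
  case: ltnP => ap; first by rewrite -compfK.
  by have := nu_le a; rewrite /rect_rows ltnNge ap /=; lia.
Qed.
End Complement.

Definition rot_fits p q nu (k : part) : Prop :=
  [/\ pincl k (rect p q), (diag k `|` rot_diag p q nu = diag (rect p q))%fset &
   rook_strip (diag k `&` rot_diag p q nu)%fset].

(** The truth value of condition (ii), up to the sign. *)
Lemma dG_rect p q k nu : pincl nu (rect p q) ->
  dG (rect p q) k nu = (-1) ^+ (psize k + psize nu + psize (rect p q)) * `[< rot_fits p q nu k >]%:R.
Proof.
move=> nR; rewrite dG_formula; congr (_ * _).
case: asboolP => [[kR cov rk_]|nc].
  rewrite (_ : skew_pairs _ _ _ = [set (compl p q nu, rotF p q nu)]%classic) ?fset_set1 ?cardfs1 //.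
  apply/seteqP; split=> [sF /(skew_pairs_rect nR)[_ _ _ ->] //|sF ->].
  apply/(skew_pairs_rect nR); split=> //; first exact/(rot_cover nR).
  by rewrite -(rot_overlap nR).
rewrite fset_set_nil // => sF /(skew_pairs_rect nR)[kR ck rk_ _]; apply: nc; split=> //.
  exact/(rot_cover nR).
by rewrite (rot_overlap nR).
Qed.

Lemma card_fs_fsum (T : choiceType) (A : set T) : finite_set A ->
  #|` fset_set A|%:Z = \sum_(x \in A) 1 :> int.
Proof. by move=> fin; rewrite fsbig_finite // big_const_seq count_predT iter_addr_0 -mulr_natr mul1r natz. Qed.

Lemma card_fibers (T U : choiceType) (A : set T) (f : T -> U) (D : {fset U}) :
  finite_set A -> (forall x, A x -> f x \in D) ->
  #|` fset_set A|%:Z = \sum_(u <- D) #|` fset_set (A `&` [set x | f x = u])%classic|%:Z.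
Proof.
move=> fin fD; rewrite card_fs_fsum // fsbig_finite //.
transitivity (\sum_(x <- fset_set A) \sum_(u <- D) (f x == u)%:R : int).
  apply: eq_big_seq => x; rewrite in_fset_set // => /set_mem Ax.
  rewrite (big_fsetD1 (f x)) ?fD //= eqxx big1_seq ?addr0 // => u /andP[_].
  by rewrite in_fsetD1 eq_sym => /andP[/negbTE-> _].
rewrite exchange_big /=; apply: eq_bigr => u _.
rewrite card_fs_fsum; last by apply: sub_finite_set fin => x [].
rewrite fsbig_mkcondr -fsbig_finite //; apply: eq_fsbigr => x _.
have -> : (x \in [set x | f x = u]%classic) = (f x == u).
  by apply/idP/eqP => [/set_mem|h]; [|apply/mem_set].
by case: eqP.
Qed.

(** For a given tau, condition (ii) does not involve sigma and T, and the others say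
that (sigma, T) is counted by d^tau. *)
Lemma triples_fiber p q l m nu k :
  (triples p q l m nu `&` [set y | y.1.2 = k])%classic =
  if `[< rot_fits p q nu k >] then ((fun sF => (sF.1, k, sF.2)) @` skew_pairs k l m)%classic else set0.
Proof.
apply/seteqP; split.
  move=> [[s t] F] [[/= /andP[st tR] sv [sl lt rk_] [cov rk2] [rl hc]] e]; subst t.
  by rewrite asboolT //; exists (s, F) => //; split=> //=; rewrite sl.
case: asboolP => // -[kR cov rk2] y [[s F] [/= /andP[sl lk] rk_ sv rl hc] <-].
split=> //; split=> //=; rewrite kR andbT; apply/pinclP => r.
exact: leq_trans (pinclP _ _ sl r) (pinclP _ _ lk r).
Qed.

Lemma triples_finite p q l m nu : finite_set (triples p q l m nu).
Proof.
have fin := pincl_finite (rect p q).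
apply: (@sub_finite_set _ _ (\bigcup_(k in [set k | pincl k (rect p q)])
   ((fun sF => (sF.1, k, sF.2)) @` skew_pairs k l m))%classic).
  move=> y Ty; have Ry : pincl y.1.2 (rect p q) by case: Ty => /andP[].
  exists y.1.2 => //; have : (triples p q l m nu `&` [set x | x.1.2 = y.1.2])%classic y by [].
  by rewrite triples_fiber; case: ifP.
apply: bigcup_finite => // k _; apply: finite_image; exact: skew_pairs_finite.
Qed.

Lemma card_triples p q l m nu : #|` fset_set (triples p q l m nu)|%:Z =
  \sum_(k <- fset_set [set k | pincl k (rect p q)]%classic)
     `[< rot_fits p q nu k >]%:R * #|` fset_set (skew_pairs k l m)|%:Z :> int.
Proof.
rewrite (@card_fibers _ _ _ (fun y : part * part * filling => y.1.2)
   (fset_set [set k | pincl k (rect p q)]%classic)); last 2 first.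
- exact: triples_finite.
- move=> y [/andP[_ h] _ _ _ _]; rewrite in_fset_set; first exact/mem_set.
  exact: pincl_finite.
apply: eq_bigr => k _; rewrite triples_fiber; case: ifP => _; last first.
  by rewrite fset_set0 cardfs0 mul0r.
rewrite mul1r fset_set_image; last exact: skew_pairs_finite.
by rewrite card_in_imfset // => -[s F] [s' F'] _ _ [-> ->].
Qed.

Theorem proposition7p4 (m13 m22 : nat) (lambda mu nu : part) :
  let R := rect m13 m22 in
  let dR := (Delta2 << R >>)@_(lambda, mu, nu) in
  (~ [/\ pincl lambda R, pincl mu R & pincl nu R] -> dR = 0) /\
  ([/\ pincl lambda R, pincl mu R & pincl nu R] ->
     dR = (-1) ^ ((psize lambda + psize mu + psize nu)%N%:Z - (m22 * m13)%N%:Z)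
          * (#|` fset_set (triples m13 m22 lambda mu nu)|)%:Z).
Proof.
move=> R dR; rewrite /dR Delta2_coef.
have trans k l m : pincl k l -> pincl l m -> pincl k m by exact: fsubset_trans.
split=> [no|[lR mR nR]].
  rewrite big1_seq // => k /andP[_]; rewrite in_fset_set; last exact: pincl_finite.
  move=> /set_mem kR; have [n1|n1] := boolP (pincl nu R); last first.
    by rewrite dG_incl ?mul0r // (negbTE n1) andbF.
  rewrite [X in _ * X]dG_incl ?mulr0 //; apply/negP => /andP[lk mk].
  by apply: no; split=> //; [exact: trans lk kR|exact: trans mk kR].
rewrite card_triples mulr_sumr; apply: eq_bigr => k _.
rewrite dG_rect // dG_formula sign_diff.
have -> : psize (rect m13 m22) = (m22 * m13)%N.
  have hs : row_shape m13 m22 (prow (rect m13 m22)) by rewrite prow_rect; exact: rect_shape.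
  have [h1 _] := shape_size hs; rewrite (psizeE h1).
  rewrite (eq_bigr (fun _ => m22)) => [|i _]; first by rewrite sum_nat_const card_ord mulnC.
  by rewrite prow_rect /rect_rows ltn_ord.
rewrite mulrACA; congr (_ * _).
rewrite -exprD; set x := psize k; set y := psize lambda; set z := psize mu; set w := psize nu.
(* the size of kappa occurs in both signs *)
rewrite (_ : (x + w + m22 * m13 + (y + z + x) = (y + z + w + m22 * m13) + x.*2)%N); last by lia.
by rewrite exprD -mul2n exprM sqrrN !expr1n mulr1.
Qed.
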